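(* Let $p\in(1,\infty)$, $\theta\ge2$, $\alpha\in(0,\infty)$, let $m\ge 2$ be an integer, and let $L$ be a subspace of $L^p(\mu)\cap C(\Omega)$ for some Borel probability measure $\mu$ on a compact set $\Omega$. Let $B\subset L$ be a symmetric $\theta$-convex (with constant $\zeta>0$) body. Assume that for any fixed set of $m$ points $X=\{X_1,\ldots,X_m\}\subset\Omega$ there is a constant $W_B(X)$ such that $e_k(B,\|\cdot\|_{\infty,X})\le W_B(X)2^{-k/\alpha}$ for all $k\ge0$. Below, in expectations, $X=\{X_1,\dots,X_m\}$ with $X_1,\ldots,X_m$ independent random points distributed according to $\mu$. 1) Assume $p\ge\alpha$. Then there is a number $C=C(p,\theta,\zeta,\alpha)$, depending only on the indicated parameters, such that $$\mathbb{E}\sup_{f\in B}\Bigl|\frac1m\sum_{j=1}^m|f(X_j)|^p-\|f\|_p^p\Bigr|\le C\Bigl(A+A^{\frac{1}{\max\{\alpha,2\}}}\bigl(\sup_{f\in B}\mathbb{E}|f(X_1)|^p\bigr)^{1-\frac{1}{\max\{\alpha,2\}}}\Bigr),$$ where $$A=\frac{[\log m]^{\max\{\alpha,2\}(1-\frac1\theta)}}{m}\,\mathbb{E}\Bigl([W_B(X)]^\alpha\sup_{f\in B}\max_{1\le j\le m}|f(X_j)|^{p-\alpha}\Bigr).$$ 2) Assume $p\ge\max\{\alpha,2\}$ and assume that there is a symmetric $q$-convex (with constant $\eta>0$) body $D\subset L$, $q\ge 2$, such that $B\subset D$. Assume that for any fixed set of $m$ points $X=\{X_1,\ldots,X_m\}\subset\Omega$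 there is a constant $W_D(X)$ such that $e_k(D,\|\cdot\|_{\infty,X})\le W_D(X)2^{-k/\beta}$ for all $k\ge 0$, for some $\beta\in[2,p]$ (not depending on $X$). Then there is a number $C=C(p,\theta,\zeta,q,\eta,\alpha,\beta)$, depending only on the indicated parameters, such that $$\mathbb{E}\sup_{f\in B}\Bigl|\frac1m\sum_{j=1}^m|f(X_j)|^p-\|f\|_p^p\Bigr|\le C\Bigl(A_B+A_D+(A_B+A_D)^{1/\beta}\bigl(\sup_{f\in B}\mathbb{E}|f(X_1)|^p\bigr)^{1-\frac1\beta}\Bigr),$$ where $$A_B=\frac{[\log m]^{\beta\max\{1-\frac p\theta,0\}}}{m}\,\mathbb{E}\Bigl([W_B(X)]^\alpha\sup_{f\in B}\max_{1\le j\le m}|f(X_j)|^{p-\alpha}\Bigr),$$ $$A_D=\frac{[\log m]^{\beta(1-\frac1q)}}{m}\,\mathbb{E}\Bigl([W_D(X)]^\beta\sup_{f\in B}\max_{1\le j\le m}|f(X_j)|^{p-\beta}\Bigr).$$ 3) Assume $p\ge\max\{\alpha,2\}$ and assume that there is a Euclidean ball $D\subset L$ such that $B\subset D$. Then there is a constant $C=C(p,\theta,\zeta,\alpha)$, depending only on the indicated parameters, such that $$\mathbb{E}\sup_{f\in B}\Bigl|\frac1m\sum_{j=1}^m|f(X_j)|^p-\|f\|_p^p\Bigr|\le C\Bigl(A+A^{1/2}\bigl(\sup_{f\in B}\mathbb{E}|f(X_1)|^p\bigr)^{1/2}\Bigr),$$ where $$A=\frac1m\mathbb{E}\Bigl(\sup_{f\in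 D}\max_{1\le j\le m}|f(X_j)|^2\sup_{h\in B}\max_{1\le j\le m}|h(X_j)|^{p-2}\Bigr)+\frac{[\log m]^{2\max\{1-\frac p\theta,0\}}}{m}\mathbb{E}\Bigl([W_B(X)]^\alpha\sup_{h\in B}\max_{1\le j\le m}|h(X_j)|^{p-\alpha}\Bigr).$$
   Context: $\|f\|_p:=\bigl(\int_\Omega|f|^p\,d\mu\bigr)^{1/p}$. For a finite set $X=\{X_1,\ldots,X_m\}$, $\|f\|_{\infty,X}:=\max_{1\le j\le m}|f(X_j)|$ (a seminorm). Entropy numbers: for a set $F$ with a (quasi-)(semi)metric $\varrho$, $e_k(F,\varrho):=\inf\{\varepsilon:\exists f_1,\ldots,f_{n_k}\in F,\ F\subset\bigcup_{j=1}^{n_k}\{g:\varrho(f_j,g)<\varepsilon\}\}$, where $n_k=2^{2^k}$ for $k\ge1$ and $n_0=1$; $e_k(F,\|\cdot\|)$ refers to the distance induced by a (semi)norm $\|\cdot\|$. A norm $\|\cdot\|$ on a linear space $L$ is $q$-convex with constant $\eta>0$ if $\bigl\|\frac{f+g}{2}\bigr\|\le\max(\|f\|,\|g\|)-\eta\|f-g\|^q$ for all $f,g$ with $\|f\|\le1,\|g\|\le1$. A symmetric convex body $D\subset L$ is $q$-convex with constant $\eta$ if it is the unit ball $\{f\in L:\|f\|\le1\}$ of some norm on $L$ which is $q$-convex with constant $\eta$. A Euclidean ball in $L$ is the unit ball of a norm generated by some inner product on $L$. *)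

(* Defs.v *)
From HB Require Import structures.
From mathcomp Require Import all_boot all_order all_algebra.
From mathcomp Require Import all_classical all_reals all_analysis measurable_realfun.

Set Implicit Arguments.
Unset Strict Implicit.
Unset Printing Implicit Defensive.

Import Order.TTheory GRing.Theory Num.Theory.
Import numFieldNormedType.Exports.

Local Open Scope classical_set_scope.
Local Open Scope ring_scope.

Notation borel Omega := (g_sigma_algebraType (@open Omega)).

Section entropy.
Context {R : realType}.

Definition entropy_card (k : nat) : nat := if k is 0 then 1 else 2 ^ (2 ^ k).

(* The infimum is taken in [\bar R], so that it is +oo when no eps works. *)
Definition entropy_number (V : Type) (F : set V) (rho : V -> V -> R) (k : nat)
    : \bar R :=
  ereal_inf [set eps%:E | eps in
    [set eps : R | exists c : 'I_(entropy_card k) -> V,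
       (forall j, F (c j)) /\
       F `<=` [set g | exists j, rho (c j) g < eps]]].

End entropy.

Section function_spaces.
Context {R : realType} {Omega : ptopologicalType}.
Implicit Types (L B D : set (Omega -> R)) (f g : Omega -> R).

(* ||f||_{oo,X}; the points of X are allowed to coincide. *)
Definition norm_at (m : nat) (X : 'I_m -> Omega) f : R :=
  \big[Num.max/0]_(j < m) `|f (X j)|.

Definition entropy_bound (m : nat) B (a : R) (W : ('I_m -> Omega) -> R) :=
  forall (X : 'I_m -> Omega) (k : nat),
    (entropy_number B (fun f g => norm_at X (f - g)%R) k
       <= (W X * 2 `^ (- (k%:R / a)))%:E)%E.

Definition linear_subspace L :=
  L 0 /\ forall (a : R) f g, L f -> L g -> L (a *: f + g).

Definition is_norm L (N : (Omega -> R) -> R) :=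
  [/\ forall f, L f -> 0 <= N f,
      forall f, L f -> N f = 0 -> f = 0,
      forall (a : R) f, L f -> N (a *: f) = `|a| * N f
    & forall f g, L f -> L g -> N (f + g) <= N f + N g].

Definition q_convex_norm L (N : (Omega -> R) -> R) (q eta : R) :=
  forall f g, L f -> L g -> N f <= 1 -> N g <= 1 ->
    N (2^-1 *: (f + g)) <= Num.max (N f) (N g) - eta * N (f - g) `^ q.

Definition unit_ball L (N : (Omega -> R) -> R) : set (Omega -> R) :=
  [set f | L f /\ N f <= 1].

Definition q_convex_body L (q eta : R) B :=
  exists N, [/\ is_norm L N, q_convex_norm L N q eta & B = unit_ball L N].

Definition is_inner_product L (ip : (Omega -> R) -> (Omega -> R) -> R) :=
  [/\ forall f g, L f -> L g -> ip f g = ip g f,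
      forall (a : R) f g h, L f -> L g -> L h ->
        ip (a *: f + g) h = a * ip f h + ip g h,
      forall f, L f -> 0 <= ip f f
    & forall f, L f -> ip f f = 0 -> f = 0].

Definition euclidean_ball L D :=
  exists ip, is_inner_product L ip /\
             D = unit_ball L (fun f => Num.sqrt (ip f f)).

(* sup_{f in B} max_j |f(X_j)|^r, where 0^0 = 1 by the definition of powR. *)
Definition sup_max_pow (m : nat) B (r : R) (X : 'I_m -> Omega) : \bar R :=
  ereal_sup [set (\big[Num.max/0]_(j < m) `|f (X j)| `^ r)%:E | f in B].

End function_spaces.

Section sampling.
Context {R : realType} {Omega : ptopologicalType}.
Context {d : measure_display} {T : measurableType d} (P : probability T R).
Variable mu : probability (borel Omega) R.

Definition mutually_independent (m : nat)
    (X : 'I_m -> {RV P >-> borel Omega}) :=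
  forall (J : {set 'I_m}) (A : 'I_m -> set (borel Omega)),
    (forall j, measurable (A j)) ->
    P (\bigcap_(j in [set` J]) (X j @^-1` A j)) =
    (\prod_(j in J) P (X j @^-1` A j))%E.

Definition iid_sample (m : nat) (X : 'I_m -> {RV P >-> borel Omega}) :=
  (forall j A, measurable A -> distribution P (X j) A = mu A) /\
  mutually_independent X.

Definition discrepancy (m : nat) (p : R) (f : Omega -> R) (x : 'I_m -> Omega)
    : \bar R :=
  `| (m%:R^-1 * \sum_(j < m) `|f (x j)| `^ p)%:E
     - 'N[mu]_(p%:E)[EFin \o f] `^ p |%E.

End sampling.

Section expected_supremum.
Context {R : realType} {d : measure_display} {T : measurableType d}.
Variable P : probability T R.
Local Open Scope ereal_scope.

(* E sup_{f in B} Z_f. The pointwise supremum of an uncountable family need not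
   be measurable; as usual for the suprema of random processes, the expectation
   is then understood as the supremum of E max_{f in F} Z_f over the finite
   F included in B. By [expected_supE] this is the integral of the pointwise
   supremum as soon as the latter is attained by a countable subfamily, e.g. for
   Z_f(w) depending continuously on f in a separable space of functions (all of
   C(Omega) for Omega compact metrizable, or any finite-dimensional space). *)
Definition expected_sup (I : Type) (B : set I) (Z : I -> T -> \bar R) : \bar R :=
  ereal_sup [set \int[P]_w ereal_sup [set Z f w | f in F] | F in
    [set F : set I | finite_set F /\ F `<=` B]].

Lemma expected_supE (I : pointedType) (B B0 : set I) (Z : I -> T -> \bar R) :
    countable B0 -> B0 !=set0 -> B0 `<=` B ->
    (forall f, B f -> measurable_fun [set: T] (Z f)) ->
    (forall f w, B f -> 0 <= Z f w) ->
    (forall w, ereal_sup [set Z f w | f in B] =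
               ereal_sup [set Z f w | f in B0]) ->
  expected_sup B Z = \int[P]_w ereal_sup [set Z f w | f in B].
Proof.
move=> cB0 [b0 B0b0] B0B mZ Z0 supE.
have Bb0 := B0B _ B0b0.
have enum C : countable C -> C !=set0 -> exists e : nat -> I, range e = C.
  move=> /pfcard_geP[->[]//|[e] _]; by exists e; exact: image_eq.
have msup C : countable C -> C !=set0 -> C `<=` B ->
    measurable_fun [set: T] (fun w => ereal_sup [set Z f w | f in C]).
  move=> cC C0 CB; have [e eC] := enum _ cC C0.
  rewrite (_ : (fun _ => _) = (fun w => esups (fun n => Z (e n) w) 0%N)).
    by apply: measurable_fun_esups => n; apply: mZ; apply: CB; rewrite -eC; exists n.
  apply/funext => w; rewrite /esups /sdrop -eC; congr ereal_sup.
  apply/seteqP; split=> [_ [_ [n _ <-] <-]|_ [n _ <-]]; first by exists n.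
  by exists (e n) => //; exists n.
apply/eqP; rewrite eq_le; apply/andP; split.
  apply: ge_ereal_sup => _ [F [finF FB] <-].
  have [F0|[c Fc]] : F = set0 \/ F !=set0.
    by case: (pselect (F = set0)) => [|/eqP/set0P]; [left|right].
    apply: (@le_trans _ _ 0); last first.
      apply: integral_ge0 => w _.
      by apply: le_ereal_sup_tmp; exists (Z b0 w); [exists b0|exact: Z0].
    rewrite (_ : (fun _ => _) = cst -oo).
      by rewrite integral_cst//= probability_setT mule1 leNye.
    by apply/funext => w; rewrite F0 image_set0 ereal_sup0.
  apply: ge0_le_integral => //.
  - move=> w _; apply: le_ereal_sup_tmp.
    by exists (Z c w); [exists c|exact/Z0/FB].
  - by apply: msup => //; [exact: finite_set_countable|exists c].
  - under eq_fun do rewrite supE.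
    by apply: msup => //; exists b0.
  - move=> w _; apply: ereal_sup_le => _ [f Ff <-]; exists f => //; exact: FB.
have [e eB0] := enum _ cB0 (ex_intro _ _ B0b0).
pose g n w := ereal_sup [set Z f w | f in e @` `I_n.+1].
have Be i : B (e i) by apply: B0B; rewrite -eB0; exists i.
have g0 n w : 0 <= g n w.
  apply: le_ereal_sup_tmp; exists (Z (e 0%N) w); last exact: Z0.
  by exists (e 0%N) => //; exists 0%N.
have nd_g w : nondecreasing_seq (g ^~ w).
  move=> a b ab; apply: ereal_sup_le => _ [_ [i ia <-] <-].
  by exists (e i) => //; exists i => //=; exact: leq_trans ab.
have mg n : measurable_fun [set: T] (g n).
  apply: msup; first exact/finite_set_countable/finite_image/finite_II.
    by exists (e 0%N); exists 0%N.
  by move=> _ [i _ <-].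
have gE w : limn (g ^~ w) = ereal_sup [set Z f w | f in B].
  rewrite supE -eB0; apply/cvg_lim => //.
  rewrite (_ : ereal_sup _ = ereal_sup (range (g ^~ w))).
    exact: ereal_nondecreasing_cvgn.
  apply/eqP; rewrite eq_le; apply/andP; split.
    apply: ge_ereal_sup => _ [_ [i _ <-] <-].
    apply: le_ereal_sup_tmp; exists (g i w); first by exists i.
    by apply: ereal_sup_ubound; exists (e i) => //; exists i => /=.
  apply: ge_ereal_sup => _ [i _ <-].
  by apply: ereal_sup_le => _ [_ [j _ <-] <-]; exists (e j) => //; exists j.
under eq_integral => w _ do rewrite -gE.
rewrite monotone_convergence//.
apply: lime_le.
  apply: ereal_nondecreasing_is_cvgn => a b ab.
  by apply: ge0_le_integral => // w _; exact: nd_g.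
near=> n; apply: ereal_sup_ubound; exists (e @` `I_n.+1) => //.
split; first exact/finite_image/finite_II.
by move=> _ [i _ <-].
Unshelve. all: by end_near. Qed.

End expected_supremum.

(* Main.v *)
(* Symmetrization reduces the expected discrepancy to Rademacher averages, conditionally on
   the sample x_1, ..., x_m.  For a fixed sample these are bounded by the majorizing-measure
   chaining functional of the classes {(|f(x_j)|^p)_j : f in B} for a weighted l_r norm, and
   van Handel's contraction principle shows that, when the unit ball is theta-convex, the
   chaining functional is controlled by the l_theta rather than the l_1 sum of the scaled
   entropy numbers; only log m levels matter, whence the powers of log m.  In the Euclidean
   case the local metrics (\sum_j |f(x_j)|^(2p-2) h(x_j)^2)^(1/2) turn the ball into
   ellipsoids, whose entropy numbers satisfy a trace bound without logarithm.  The fixed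
   sample bounds have the form a(x)^(1/s) (\sup_B \sum_j |f(x_j)|^p)^(1-1/s); since the last
   supremum is at most m times \sup_B ||f||_p^p plus the discrepancy, Young's inequality
   gives a self-bounding inequality for the expected discrepancy.
   Symmetrization is proved for each sign pattern separately: the terms with one sign are
   independent of, and centered with respect to, those with the other. *)

Require Import Defs.
From HB Require Import structures.
From mathcomp Require Import all_boot all_order all_algebra.
From mathcomp Require Import all_classical all_reals all_analysis measurable_realfun.
From mathcomp Require Import zify ring lra.

Set Implicit Arguments.
Unset Strict Implicit.
Unset Printing Implicit Defensive.

Import Order.TTheory GRing.Theory Num.Theory.
Import numFieldNormedType.Exports.

Local Open Scope classical_set_scope.
Local Open Scope ring_scope.

(** * Real powers *)

(** The unit ball of [L] is uncountable, and a finite subfamily of it has no convexity. The proof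
    therefore runs on the unit ball of the rational span of a finite family: it is countable, so
    that suprema over it are measurable, and it is stable under midpoints and fits rational
    dilations, which is all that the convex chaining asks for. Minimizers need not exist there,
    hence near-minimizers with errors 2^-k.

    Generic chaining is written with natural-number labels instead of partitions. Level k may use
    2^(A 2^k) labels; this slack allows every quantity that must be constant on a cell (penalties,
    entropies, labels of another chaining) to be rounded and stored in the label.

    The exponent s enters twice. Sums of signs have tails of order exp(-t^s) relative to the
    l_(s/(s-1)) norm, which pairs the factor 2^(k/s) with the diameters of level k; and in the basic
    case the chaining metric is interpolated so that its entropy numbers decay exactly like
    2^(-k/s). *)

Section real_powers.
Context {R : realType}.
Implicit Types x y p q theta C : R.

Lemma powR_le1D x p q : 0 <= x -> 0 <= p <= q -> x `^ p <= 1 + x `^ q.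
Proof.
move=> x0 /andP[p0 pq]; have [x1|x1] := lerP x 1.
  by rewrite ler_wpDr ?powR_ge0//; have := @ge0_ler_powR R p p0 x 1; rewrite powR1 !nnegrE; apply.
by rewrite ler_wpDl// ler_powR// ltW.
Qed.

Lemma powRD_le x y p : 0 <= x -> 0 <= y -> 0 <= p ->
  (x + y) `^ p <= 2 `^ p * (x `^ p + y `^ p).
Proof.
move=> x0 y0 p0; wlog xy : x y x0 y0 / x <= y.
  by move=> h; have [xy|/ltW yx] := lerP x y; [exact: h|rewrite addrC (addrC (x `^ p)); exact: h].
apply: (@le_trans _ _ ((2 * y) `^ p)).
  by apply: ge0_ler_powR => //; rewrite ?nnegrE; lra.
by rewrite powRM// ler_wpM2l ?powR_ge0// lerDr powR_ge0.
Qed.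

(** Young's inequality for the product of y and x^(p-1), with the exponents p and p/(p-1); it
    replaces the mean value theorem and needs no separate treatment of 0. *)
Lemma powR_ltB x y p : 0 <= y -> y <= x -> 1 < p ->
  x `^ p - y `^ p <= p * (x - y) * x `^ (p - 1).
Proof.
move=> y0 yx p1.
have x0 : 0 <= x by lra.
have p0 : 0 < p by lra.
pose q := p / (p - 1).
have q0 : 0 < q by rewrite divr_gt0//; lra.
have := @conjugate_powR R y (x `^ (p - 1)) p q y0 (powR_ge0 _ _) p0 q0.
have -> : p^-1 + q^-1 = 1 by rewrite /q invf_div; field; lra.
move=> /(_ erefl).
rewrite -powRrM /q.
have -> : (p - 1) * (p / (p - 1)) = p by field; lra.
have <- := @mulr_powRB1 R x p x0 p0.
set z := x `^ (p - 1); set w := y `^ p.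
rewrite invf_div => h.
have : p * (y * z) <= p * (w / p + x * z * ((p - 1) / p)) by rewrite ler_wpM2l// ltW.
have -> : p * (w / p + x * z * ((p - 1) / p)) = w + x * z * (p - 1) by field; lra.
lra.
Qed.

Lemma powR_dist x y p : 0 <= x -> 0 <= y -> 1 < p ->
  `|x `^ p - y `^ p| <= p * `|x - y| * (x `^ (p - 1) + y `^ (p - 1)).
Proof.
move=> x0 y0 p1; wlog yx : x y x0 y0 / y <= x.
  move=> h; have [yx|/ltW xy] := leP y x; first exact: h.
  by rewrite distrC (distrC x) [x `^ _ + _]addrC; exact: h.
rewrite !ger0_norm ?subr_ge0//; last by apply: ge0_ler_powR => //; lra.
apply: le_trans (powR_ltB y0 yx p1) _.
by apply: ler_wpM2l; [rewrite mulr_ge0 ?subr_ge0//; lra|rewrite lerDl powR_ge0].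
Qed.

Lemma abs_powR_dist x y p : 1 < p ->
  `|(`|x| `^ p) - (`|y| `^ p)| <= p * `|x - y| * (`|x| `^ (p - 1) + `|y| `^ (p - 1)).
Proof.
move=> p1; apply: le_trans (powR_dist _ _ p1) _ => //.
rewrite ler_wpM2r ?addr_ge0 ?powR_ge0// ler_wpM2l ?(ltW (lt_trans _ p1))//.
exact: ler_dist_dist.
Qed.

Lemma powRD_ge0 x p q : 0 <= x -> 0 <= p -> 0 <= q ->
  x `^ (p + q) = x `^ p * x `^ q.
Proof.
move=> x0 p0 q0; have [->|xn0] := eqVneq x 0; last by rewrite powRD// xn0 implybT.
have [->|pn0] := eqVneq p 0; first by rewrite add0r powRr0 mul1r.
have {}p0 : 0 < p by rewrite lt_neqAle eq_sym pn0.
have pq0 : 0 < p + q by lra.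
by rewrite (@powR0 _ (p + q)) ?(@powR0 _ p) ?mul0r ?gt_eqF.
Qed.

Lemma powR_mul_le_add x y p q : 0 <= x -> 0 <= y -> 0 <= p -> 0 <= q ->
  x `^ p * y `^ q <= x `^ (p + q) + y `^ (p + q).
Proof.
move=> x0 y0 p0 q0; have [xy|/ltW yx] := lerP x y.
  rewrite ler_wpDl ?powR_ge0// powRD_ge0// ler_wpM2r ?powR_ge0//.
  by apply: ge0_ler_powR => //.
rewrite ler_wpDr ?powR_ge0// powRD_ge0// ler_wpM2l ?powR_ge0//.
by apply: ge0_ler_powR => //.
Qed.

Lemma ler_powR2l x y p : 0 <= x -> x <= y -> 0 <= p -> x `^ p <= y `^ p.
Proof. by move=> x0 xy p0; apply: ge0_ler_powR; rewrite ?nnegrE//; lra. Qed.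

Lemma powRK x p : 0 <= x -> p != 0 -> (x `^ p) `^ p^-1 = x.
Proof. by move=> x0 p0; rewrite -powRrM mulfV// powRr1. Qed.

Lemma powRVK x p : 0 <= x -> p != 0 -> (x `^ p^-1) `^ p = x.
Proof. by move=> x0 p0; rewrite -powRrM mulVf// powRr1. Qed.

Lemma powRD_ge x y p : 0 <= x -> 0 <= y -> 1 <= p ->
  x `^ p + y `^ p <= (x + y) `^ p.
Proof.
move=> x0 y0 p1; have p0 : 0 < p by lra.
rewrite -(mulr_powRB1 x0 p0) -(mulr_powRB1 y0 p0) -(mulr_powRB1 (addr_ge0 x0 y0) p0).
rewrite mulrDl; apply: lerD; apply: ler_wpM2l => //; apply: ler_powR2l; lra.
Qed.

Lemma sum_powR_ge (I : Type) (r : seq I) (x : I -> R) p :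
  1 <= p -> (forall i, 0 <= x i) ->
  \sum_(i <- r) x i `^ p <= (\sum_(i <- r) x i) `^ p.
Proof.
move=> p1 x0; elim: r => [|i r ih]; first by rewrite !big_nil powR_ge0.
rewrite !big_cons; apply: le_trans (powRD_ge _ _ _) => //; last exact: sumr_ge0.
by rewrite lerD2l.
Qed.

(** Source of the powers of log m: [n] will be the number of levels, of order log m. For p <= theta
    this is Hölder's inequality, obtained termwise from u^p <= 1 + u^theta with u = n^(1/theta) x_i;
    for p > theta it is the inclusion of l_1 in l_(p/theta), and no factor is lost. *)
Lemma sum_powR_le (I : Type) (r : seq I) (x : I -> R) (n : nat) p theta C :
  0 < p -> 0 < theta -> 0 <= C -> (0 < n)%N -> (size r <= n)%N ->
  (forall i, 0 <= x i) -> \sum_(i <- r) x i `^ theta <= C ->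
  \sum_(i <- r) x i `^ p <=
    (1 + C + C `^ (p / theta)) * n%:R `^ Num.max (1 - p / theta) 0.
Proof.
move=> p0 theta0 C0 n0 rn x0 xC.
have n0' : 0 < n%:R :> R by rewrite ltr0n.
have [ptheta|thetap] := lerP p theta.
  have -> : Num.max (1 - p / theta) 0 = 1 - p / theta.
    by apply/max_idPl; rewrite subr_ge0 ler_pdivrMr// mul1r.
  pose c := n%:R `^ theta^-1 : R.
  have c0 : 0 < c by rewrite powR_gt0.
  have h i : x i `^ p <= n%:R `^ (- (p / theta)) * (1 + n%:R * x i `^ theta).
    have cx : c * x i >= 0 by rewrite mulr_ge0// ltW.
    have : (c * x i) `^ p <= 1 + (c * x i) `^ theta by apply: powR_le1D; rewrite // (ltW p0).
    rewrite !powRM ?(ltW c0)// [c `^ theta]powRVK ?(ltW n0') ?gt_eqF// => hh.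
    rewrite powRN mulrC ler_pdivlMr ?powR_gt0//.
    by apply: le_trans hh; rewrite mulrC /c -powRrM [theta^-1 * p]mulrC.
  apply: le_trans (ler_sum _ (fun i _ => h i)) _.
  rewrite -mulr_sumr big_split/= -mulr_sumr big_const_seq count_predT iter_addr addr0.
  rewrite powRD ?(gt_eqF n0') ?implybT// powRr1 ?(ltW n0')//.
  rewrite [leRHS](_ : _ = n%:R `^ (- (p / theta)) * ((1 + C + C `^ (p / theta)) * n%:R)); last by ring.
  rewrite ler_wpM2l ?powR_ge0// !mulrDl mul1r -addrA lerD ?ler_nat//.
  by rewrite mulrC ler_wpDr ?mulr_ge0 ?powR_ge0 ?ler_wpM2r// ltW.
have -> : Num.max (1 - p / theta) 0 = 0.
  by apply/max_idPr; rewrite subr_le0 ler_pdivlMr// mul1r ltW.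
rewrite powRr0 mulr1.
have -> : \sum_(i <- r) x i `^ p = \sum_(i <- r) (x i `^ theta) `^ (p / theta).
  by apply: eq_bigr => i _; rewrite -powRrM mulrCA mulfV ?gt_eqF// mulr1.
apply: le_trans (sum_powR_ge _ _ _) _ => [|i|]; rewrite ?powR_ge0//.
  by rewrite ler_pdivlMr// mul1r ltW.
apply: (@le_trans _ _ (C `^ (p / theta))); last by rewrite lerDr; lra.
apply: ler_powR2l => //; last by rewrite divr_ge0// ltW.
by apply: sumr_ge0 => i _; rewrite powR_ge0.
Qed.

(** Near 0 the left side is 1 + O(x^2), far out it is at most exp |x|. For 1 <= q <= 2 a multiple of
    |x|^q dominates both x^2 on [0, 1/2] and |x| beyond. Sums of signs thereby get exponential
    moments in terms of an l_q norm. *)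
Lemma cosh_le x q : 1 <= q <= 2 ->
  (expR x + expR (- x)) / 2 <= expR (2 * `|x| `^ q).
Proof.
move=> /andP[q1 q2]; wlog x0 : x / 0 <= x.
  move=> h; have [x0|x0] := lerP 0 x; first exact: h.
  by have := h (- x); rewrite opprK normrN addrC; apply; lra.
rewrite ger0_norm//; have [x12|x12] := lerP x (1/2).
  (* exp x = 1 / exp(-x) <= 1 / (1 - x), and (1 + x + 2 x^2)(1 - x) = 1 + x^2 (1 - 2 x) is at least
     1 up to x = 1/2. *)
  have h1 : expR x <= 1 + x + 2 * x ^+ 2.
    rewrite -[expR x]invrK -expRN.
    have e0 := expR_gt0 (- x).
    rewrite -[leLHS]mul1r ler_pdivrMr//.
    apply: le_trans (_ : (1 + x + 2 * x ^+ 2) * (1 - x) <= _).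
      have : 0 <= x ^+ 2 * (1 - 2 * x) by rewrite mulr_ge0 ?sqr_ge0//; lra.
      rewrite !exprS expr0; nra.
    rewrite ler_wpM2l//; last exact: expR_ge1Dx.
    by rewrite !addr_ge0// mulr_ge0// sqr_ge0.
  have h2 : expR (- x) <= 1 - x + 2 * x ^+ 2.
    rewrite -[expR (- x)]invrK -expRN opprK.
    have e0 := expR_gt0 x.
    rewrite -[leLHS]mul1r ler_pdivrMr//.
    apply: le_trans (_ : (1 - x + 2 * x ^+ 2) * (1 + x) <= _).
      have : 0 <= x ^+ 2 * (1 + 2 * x) by rewrite mulr_ge0 ?sqr_ge0//; lra.
      rewrite !exprS expr0; nra.
    rewrite ler_wpM2l//; last exact: expR_ge1Dx.
    have := sqr_ge0 x; lra.
  apply: (@le_trans _ _ (1 + 2 * x ^+ 2)); first lra.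
  apply: le_trans (expR_ge1Dx _) _.
  rewrite ler_expR ler_wpM2l//.
  have [->|xn0] := eqVneq x 0; first by rewrite expr0n powR_ge0.
  rewrite -powR_mulrn//; apply: ger_powR => //.
  by rewrite lt_neqAle eq_sym xn0 x0; lra.
apply: (@le_trans _ _ (expR x)).
  have : expR (- x) <= expR x by rewrite ler_expR; lra.
  lra.
rewrite ler_expR.
have x00 : 0 < x by lra.
have h : 1 <= 2 * x `^ (q - 1).
  apply: (@le_trans _ _ (2 `^ (q - 1) * x `^ (q - 1))).
    rewrite -powRM//; have := @ler_powR2l 1 (2 * x) (q - 1).
    by rewrite powR1; apply; lra.
  rewrite ler_wpM2r ?powR_ge0//.
  by have := @ler_powR R 2 _ (q - 1) 1; rewrite powRr1//; apply; lra.
have -> : x `^ q = x * x `^ (q - 1) by rewrite mulr_powRB1//; lra.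
nra.
Qed.

End real_powers.

(** * Nested partitions and convex chaining *)

(** An admissible sequence of partitions: the cells of level k are the fibres of [c k] on [B]. The
    usual count is 2^(2^k) cells; the factor [A] leaves room for the rounded data that the
    constructions store in the labels. *)
Definition nested_labels (T : Type) (B : set T) (A : nat) (c : nat -> T -> nat) :=
  (forall k f, B f -> (c k f < 2 ^ (A * 2 ^ k))%N) /\
  (forall k f g, B f -> B g -> c k.+1 f = c k.+1 g -> c k f = c k g).

Definition label_constant (T S : Type) (B : set T) (c : nat -> T -> nat)
    (x : nat -> T -> S) :=
  forall k f g, B f -> B g -> c k f = c k g -> x k f = x k g.

(** Labels are combined in mixed radix; a combined label determines its components. *)
Lemma mulnD_inj n a b c d : (b < n)%N -> (d < n)%N ->
  (a * n + b = c * n + d)%N -> a = c /\ b = d.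
Proof.
move=> bn dn e; have n0 : (0 < n)%N by apply: leq_trans bn.
have := congr1 (fun z => z %/ n)%N e; have := congr1 (fun z => z %% n)%N e.
by rewrite !divnMDl// !divn_small// !addn0 !modnMDl !modn_small.
Qed.

Lemma mulnD_lt n N a b : (a < N)%N -> (b < n)%N -> (a * n + b < N * n)%N.
Proof. by move=> aN bn; apply: leq_trans (_ : a.+1 * n <= _)%N; [rewrite mulSn; lia|rewrite leq_mul2r aN orbT]. Qed.

(* A cell of level [k + 1] fixes the cell of level [k], the prelabel [p k.+1] and the
   label given by the splitting hypothesis; the diameters then obey
   [D (k + 1) = eps * D k + b (k + 1)]. *)
Lemma nested_contraction (R : realType) (T : Type) (B : set T) (d : T -> T -> R)
    (p : nat -> T -> nat) (P n : nat -> nat) (eps : R) (b : nat -> T -> R) :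
  (forall k f, B f -> (p k f < P k)%N) ->
  label_constant B p b ->
  (forall f g, B f -> B g -> p 0%N f = p 0%N g -> d f g <= b 0%N f) ->
  (forall k (A : set T) (D : R), A `<=` B ->
    (forall f g, A f -> A g -> p k.+1 f = p k.+1 g) ->
    (forall f g, A f -> A g -> d f g <= D) ->
    exists l : T -> nat, (forall f, A f -> (l f < n k)%N) /\
      forall f g, A f -> A g -> l f = l g -> d f g <= eps * D + b k.+1 f) ->
  exists (c : nat -> T -> nat) (D : nat -> T -> R),
  [/\ forall k f, B f -> (c k f < P 0 * \prod_(i < k) (P i.+1 * n i))%N,
      forall k f g, B f -> B g -> c k.+1 f = c k.+1 g -> c k f = c k g,
      label_constant B c D,
      forall k f g, B f -> B g -> c k f = c k g -> d f g <= D k f &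
      (forall f, D 0%N f = b 0%N f) /\
      forall k f, D k.+1 f = eps * D k f + b k.+1 f].
Proof.
move=> pP pb d0 step.
pose D := fix D (k : nat) (f : T) : R :=
  if k is k'.+1 then eps * D k' f + b k'.+1 f else b 0%N f.
pose good k (c : T -> nat) := [/\
  forall f, B f -> (c f < P 0 * \prod_(i < k) (P i.+1 * n i))%N,
  forall f g, B f -> B g -> c f = c g -> D k f = D k g &
  forall f g, B f -> B g -> c f = c g -> d f g <= D k f].
have next k c : good k c -> exists c', good k.+1 c' /\
    forall f g, B f -> B g -> c' f = c' g -> c f = c g.
  move=> [cP cD cd].
  (* The splitting hypothesis is applied to each nonempty set with old label [u] and new prelabel
     [v]; [D k] is constant there, so its value at any [f0] of the set serves as the diameter. *)
  pose A u v := [set f | [/\ B f, c f = u & p k.+1 f = v]].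
  have ex u v : exists l : T -> nat, (forall f, A u v f -> (l f < n k)%N) /\
      forall f g, A u v f -> A u v g -> l f = l g -> d f g <= D k.+1 f.
    have [[f0 [Bf0 f0u f0v]]|nA] := pselect (exists f, A u v f); last first.
      by exists (fun=> 0%N); split => [f Af|f g Af]; case: nA; exists f.
    have [||| l [ln ld]] := step k (A u v) (D k f0).
    - by move=> f [].
    - by move=> f g [_ _ ->] [_ _ ->].
    - move=> f g [Bf fu _] [Bg gu _]; rewrite -(cD f f0) ?fu//.
      by apply: cd => //; rewrite fu.
    exists l; split=> // f g Af Ag lfg.
    by rewrite /= (cD f f0)//; [exact: ld|case: Af|case: Af => _ ->].
  pose l u v := projT1 (cid (ex u v)).
  have lP u v := projT2 (cid (ex u v)).
  exists (fun f => ((c f * P k.+1 + p k.+1 f) * n k + l (c f) (p k.+1 f) f)%N).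
  have ln f : B f -> (l (c f) (p k.+1 f) f < n k)%N by move=> Bf; apply: (lP _ _).1.
  have split_eq f g : B f -> B g ->
      ((c f * P k.+1 + p k.+1 f) * n k + l (c f) (p k.+1 f) f =
       (c g * P k.+1 + p k.+1 g) * n k + l (c g) (p k.+1 g) g)%N ->
      [/\ c f = c g, p k.+1 f = p k.+1 g &
        l (c f) (p k.+1 f) f = l (c g) (p k.+1 g) g].
    move=> Bf Bg /(mulnD_inj (ln _ Bf) (ln _ Bg))[].
    by move=> /(mulnD_inj (pP _ _ Bf) (pP _ _ Bg))[].
  split; last by move=> f g Bf Bg /(split_eq _ _ Bf Bg)[].
  split.
  - move=> f Bf; rewrite big_ord_recr/= mulnA.
    by rewrite [X in (_ < X)%N]mulnA; apply: mulnD_lt (ln _ Bf); apply: mulnD_lt; [exact: cP|exact: pP].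
  - by move=> f g Bf Bg /(split_eq _ _ Bf Bg)[cfg pfg _] /=; rewrite (cD f g)// (pb _ f g).
  - move=> f g Bf Bg /(split_eq _ _ Bf Bg)[cfg pfg lfg].
    have Af : A (c f) (p k.+1 f) f by split.
    have Ag : A (c f) (p k.+1 f) g by split.
    have lfg' : l (c f) (p k.+1 f) f = l (c f) (p k.+1 f) g.
      by rewrite lfg -cfg -pfg.
    exact: ((lP (c f) (p k.+1 f)).2 f g Af Ag lfg').
have c0 : good 0%N (p 0%N).
  split => [f Bf|f g Bf Bg|f g Bf Bg].
  - by rewrite big_ord0 muln1 pP.
  - exact: pb.
  - exact: d0.
(* Dependent choice: labels are built together with their invariant, because the next level exists
   only for labels that satisfy it. *)
pose nxt k (c : {c | good k c}) : {c' | good k.+1 c'} :=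
  let e := cid (next k (projT1 c) (projT2 c)) in exist _ (projT1 e) (projT2 e).1.
pose c := fix c k : {c | good k c} :=
  if k is k'.+1 return {c | good k c} then nxt k' (c k') else exist _ _ c0.
exists (fun k => projT1 (c k)), D; split => //.
- by move=> k f Bf; have [+ _ _] := projT2 (c k); exact.
- by move=> k f g Bf Bg /=; apply: (projT2 (cid (next k (projT1 (c k)) (projT2 (c k))))).2.
- by move=> k; have [_ + _] := projT2 (c k).
- by move=> k; have [_ _ +] := projT2 (c k).
Qed.

Section chaining_tools.
Context {R : realType}.

Lemma approx_min (T : Type) (B : set T) (phi : T -> R) (e : R) :
  B !=set0 -> (forall y, B y -> 0 <= phi y) -> 0 < e ->
  exists2 y, B y & forall z, B z -> phi y <= phi z + e.
Proof.
move=> [y0 By0] phi0 e0.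
have hi : has_inf (phi @` B).
  by split; [exists (phi y0), y0|exists 0 => _ [y By <-]; exact: phi0].
have [_ [y By <-] ye] := inf_adherent e0 hi; exists y => // z Bz.
apply: le_trans (ltW ye) _; rewrite lerD2r.
by apply: ge_inf; [case: hi|exists z].
Qed.

Lemma sum_expr2V n : \sum_(k < n) (2^-1 : R) ^+ k <= 2.
Proof.
suff -> : \sum_(k < n) (2^-1 : R) ^+ k = 2 - 2 * 2^-1 ^+ n.
  by rewrite gerBl mulr_ge0// exprn_ge0.
elim: n => [|n ih]; first by rewrite big_ord0 expr0 mulr1 subrr.
by rewrite big_ord_recr/= ih exprS; lra.
Qed.

(** 6 = 2 + 2 + 2: the total increase of [K], the geometric errors, and the term of index 0, which
    has no predecessor. In use, [K k] is the near-minimal value of a penalized functional and [x k]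
    its penalty. *)
Lemma telescope_bound (K x : nat -> R) (kap : R) : 0 < kap <= 1 ->
  (forall k, 0 <= K k <= 2) -> x 0%N <= 2 ->
  (forall k, kap * x k.+1 <= K k.+1 - K k + 2^-1 ^+ k) ->
  forall n, \sum_(k < n) x k <= 6 / kap.
Proof.
move=> /andP[kap0 kap1] K02 x02 step n.
rewrite ler_pdivlMr// mulrC.
case: n => [|n]; first by rewrite big_ord0 mulr0.
rewrite big_ord_recl mulrDr mulr_sumr/=.
have h : \sum_(i < n) kap * x (bump 0 i) <= K n - K 0%N + \sum_(i < n) 2^-1 ^+ i.
  elim: n => [|n ih]; first by rewrite !big_ord0 subrr addr0.
  rewrite !big_ord_recr/=; have := step n; rewrite /bump/= in ih *; lra.
have /andP[K0 _] := K02 0%N; have /andP[_ Kn] := K02 n.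
have := sum_expr2V n.
have : kap * x 0%N <= 2.
  have [x0|x0] := leP 0 (x 0%N); first nra.
  nra.
lra.
Qed.

(** The ratio 1/4 survives the powers: (x/4 + y)^theta <= 2^theta ((x/4)^theta + y^theta), and
    2^theta / 4^theta <= 1/2. The sum then absorbs half of itself. *)
Lemma contraction_sum (x y : nat -> R) (theta : R) : 1 <= theta ->
  (forall k, 0 <= x k) -> (forall k, 0 <= y k) ->
  (forall k, x k.+1 <= x k / 4 + y k.+1) ->
  forall n, \sum_(k < n) x k `^ theta <=
    2 * (x 0%N `^ theta + 2 `^ theta * \sum_(k < n) y k `^ theta).
Proof.
move=> th1 x0 y0 xy n; have th0 : 0 <= theta by lra.
case: n => [|n]; first by rewrite !big_ord0 mulr0 addr0 mulr_ge0 ?powR_ge0.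
have step k : x k.+1 `^ theta <= 2^-1 * x k `^ theta + 2 `^ theta * y k.+1 `^ theta.
  have x4 : 0 <= x k / 4 by rewrite divr_ge0.
  apply: le_trans (ler_powR2l (x0 _) (xy k) th0) _.
  apply: le_trans (powRD_le x4 (y0 _) th0) _.
  rewrite mulrDr lerD2r.
  rewrite powRM ?invr_ge0// mulrCA mulrC ler_wpM2r ?powR_ge0//.
  rewrite -powRM ?invr_ge0//.
  have -> : 2 * 4^-1 = 2^-1 :> R by lra.
  have := @ger_powR R 2^-1 _ 1 theta th1; rewrite powRr1//; apply; lra.
have S0 m : 0 <= \sum_(k < m) x k `^ theta by apply: sumr_ge0 => i _; exact: powR_ge0.
rewrite [leLHS]big_ord_recl/=.
have h m : \sum_(i < m) x (bump 0 i) `^ theta <=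
    2^-1 * \sum_(i < m) x i `^ theta + 2 `^ theta * \sum_(i < m) y i.+1 `^ theta.
  elim: m => [|m ih]; first by rewrite !big_ord0 !mulr0 addr0.
  rewrite !big_ord_recr/=; have := step m; rewrite /bump/= in ih *; lra.
have e : \sum_(i < n) x i `^ theta <= \sum_(i < n.+1) x i `^ theta.
  by rewrite big_ord_recr/= lerDl powR_ge0.
have e2 : \sum_(i < n.+1) x i `^ theta = x 0%N `^ theta + \sum_(i < n) x (bump 0 i) `^ theta.
  by rewrite big_ord_recl.
have e3 : 2 `^ theta * \sum_(i < n) y i.+1 `^ theta <= 2 `^ theta * \sum_(i < n.+1) y i `^ theta.
  by rewrite ler_wpM2l ?powR_ge0// big_ord_recl/= lerDr powR_ge0.
have := h n; lra.
Qed.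

(** Origin of the budget 6 of [convex_chaining]: each level adds a grid label of i + 3 bits and
    2^(i+1) bits of entropy labels. The induction runs with the stronger [e + k + 4], which pays for
    the grid bits of the next level. *)
Lemma label_prod k :
  (1 * \prod_(i < k) (2 ^ (i + 3) * entropy_card i.+1) <= 2 ^ (6 * 2 ^ k))%N.
Proof.
rewrite mul1n; suff [e -> h] : exists2 e, (\prod_(i < k) (2 ^ (i + 3) * entropy_card i.+1) = 2 ^ e)%N & (e + k + 4 <= 6 * 2 ^ k)%N.
  by rewrite leq_exp2l//; lia.
elim: k => [|k [e eq h]]; first by exists 0%N; rewrite ?big_ord0.
exists (e + ((k + 3) + 2 ^ k.+1))%N.
  by rewrite big_ord_recr/= eq /entropy_card !expnD.
rewrite expnS.
have : (k < 2 ^ k)%N by rewrite ltn_expl.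
lia.
Qed.

(** A real number enters a label through its integer part at scale 2^-k. The value read back by
    [grid_value] lies above it by at most 2^-k, an error that is summable over the levels. *)
Definition grid_label (k : nat) (x : R) : nat := Num.truncn (2 ^+ k * x).

Definition grid_value (k n : nat) : R := 2^-1 ^+ k * n.+1%:R.

Lemma grid_valueP k x : 0 <= x ->
  x <= grid_value k (grid_label k x) <= x + 2^-1 ^+ k.
Proof.
move=> x0; have k0 : 0 < 2^-1 ^+ k :> R by rewrite exprn_gt0.
have kx0 : 0 <= 2 ^+ k * x by rewrite mulr_ge0// exprn_ge0.
have K : 2^-1 ^+ k * (2 ^+ k * x) = x.
  by rewrite mulrA -exprMn mulVf ?pnatr_eq0// expr1n mul1r.
have /andP[h1 /ltW h2] := truncn_itv kx0.
apply/andP; split; first by rewrite -[leLHS]K ler_pM2l.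
rewrite /grid_value -(natr1 (grid_label k x)) mulrDr mulr1 lerD2r.
by rewrite -[leRHS]K ler_pM2l.
Qed.

Lemma grid_label_lt k x j : 0 <= x -> x < 2 ^+ j -> (grid_label k x < 2 ^ (k + j))%N.
Proof.
move=> x0 xj; rewrite truncn_lt_nat; last by rewrite mulr_ge0// exprn_ge0.
by rewrite natrX exprD ltr_pM2l// exprn_gt0.
Qed.

End chaining_tools.

Section convex_chaining.
Context {R : realType}.

(** [D] depends on the cell and not only on the level: the weighted sums over the levels will be
    bounded along each point [f], whereas uniform diameters per level would only give Dudley's
    entropy sum. *)
Record chained (V : zmodType) (B : set V) (A : nat) (nu : V -> R)
  (D : nat -> V -> R) (c : nat -> V -> nat) : Prop := Chained {
    chained_nested : nested_labels B A c;
    chained_const : label_constant B c D;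
    chained_ge0 : forall k f, B f -> 0 <= D k f;
    chained_le : forall k f g, B f -> B g -> c k f = c k g -> nu (f - g) <= D k f
  }.

Lemma midpointB (V : lmodType R) (f y z : V) :
  f - 2^-1 *: (y + z) = 2^-1 *: ((f - y) + (f - z)).
Proof.
rewrite addrACA -opprD scalerBr; congr (_ - _).
by rewrite -mulr2n -[f *+ 2]scaler_nat scalerA mulVf ?pnatr_eq0// scale1r.
Qed.

(* Uniform convexity at the midpoint [u] of two near-minimizers. *)
Lemma convex_minimizers_close (V : lmodType R) (L : set V) (N nu : V -> R)
    (theta zeta t D s e : R) (f g y z : V) :
  1 <= theta -> 0 < zeta -> 0 < t -> 0 <= D -> 0 <= s -> 0 <= e ->
  (forall f g, L f -> L g -> L (f - g)) -> (forall f g, L f -> L g -> L (f + g)) ->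
  (forall f, L f -> L (2^-1 *: f)) ->
  (forall f, L f -> 0 <= N f) ->
  (forall f, L f -> 0 <= nu f) ->
  (forall (a : R) f, L f -> nu (a *: f) = `|a| * nu f) ->
  (forall f g, L f -> L g -> nu (f + g) <= 2 * (nu f + nu g)) ->
  L f -> L g -> L y -> L z -> N y <= 1 -> N z <= N y ->
  N (2^-1 *: (y + z)) <= N y - zeta * N (y - z) `^ theta ->
  (forall u, L u -> N u <= 1 ->
     N y + (t * nu (f - y)) `^ theta <= N u + (t * nu (f - u)) `^ theta + e `^ theta) ->
  nu (f - g) <= D -> t * nu (f - y) <= s -> t * nu (g - z) <= s ->
  N (y - z) <= zeta `^ (- theta^-1) * (3 * s + 2 * (t * D) + e).
Proof.
move=> th1 zeta0 t0 D0 s0 e0 LB LD Lh N0 nu0 nuZ nuD Lf Lg Ly Lz Ny1 Nzy Nu ymin fgD fys gzs.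
have th0 : 0 < theta by exact: lt_le_trans th1.
have tD0 : 0 <= t * D by rewrite mulr_ge0// ltW.
set u := 2^-1 *: (y + z) in Nu.
have Lu : L u by apply: Lh; exact: LD.
have Nyz : 0 <= zeta * N (y - z) `^ theta by rewrite mulr_ge0 ?powR_ge0// ltW.
have Nuy : N u <= N y by apply: le_trans Nu _; rewrite gerBl.
have {}ymin := ymin u Lu (le_trans Nuy Ny1).
have h : zeta * N (y - z) `^ theta <= (t * nu (f - u)) `^ theta + e `^ theta.
  have := powR_ge0 (t * nu (f - y)) theta.
  move: ymin Nu; move: (N u) (N y) (zeta * _) (_ `^ _) (_ `^ _) (_ `^ _) => *; lra.
have nufu : nu (f - u) <= nu (f - y) + nu (f - z).
  rewrite midpointB nuZ; last by apply: LD; exact: LB.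
  rewrite ger0_norm ?invr_ge0// ler_pdivrMl//.
  exact: nuD (LB _ _ Lf Ly) (LB _ _ Lf Lz).
have nufz : nu (f - z) <= 2 * (D + nu (g - z)).
  have -> : f - z = (f - g) + (g - z) by rewrite addrA subrK.
  apply: le_trans (nuD _ _ (LB _ _ Lf Lg) (LB _ _ Lg Lz)) _.
  by rewrite ler_pM2l// lerD2r.
have tnu : t * nu (f - u) <= 3 * s + 2 * (t * D).
  have : t * nu (f - u) <= t * (nu (f - y) + 2 * (D + nu (g - z))).
    by rewrite ler_pM2l// (le_trans nufu)// lerD2l.
  move: fys gzs; move: (nu (f - u)) (nu (f - y)) (nu (g - z)) => *; lra.
have nufu0 : 0 <= t * nu (f - u).
  by apply: mulr_ge0; [exact: ltW|apply: nu0; exact: LB].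
have stD0 : 0 <= 3 * s + 2 * (t * D) by rewrite addr_ge0// mulr_ge0.
have h2 : N (y - z) `^ theta <= zeta^-1 * (3 * s + 2 * (t * D) + e) `^ theta.
  rewrite ler_pdivlMl//; apply: le_trans h _.
  apply: le_trans (powRD_ge stD0 e0 th1).
  by rewrite lerD2r; apply: ler_powR2l => //; exact: ltW.
have Nyz0 : 0 <= N (y - z) by apply: N0; exact: LB.
rewrite -(powRK Nyz0 (lt0r_neq0 th0)).
apply: le_trans (ler_powR2l (powR_ge0 _ _) h2 _) _; first by rewrite invr_ge0 ltW.
have se0 : 0 <= 3 * s + 2 * (t * D) + e by exact: addr_ge0.
rewrite powRM ?powR_ge0 ?invr_ge0 ?(ltW zeta0)// (powRK se0 (lt0r_neq0 th0)).
by rewrite -powR_inv1 ?(ltW zeta0)// -powRrM mulN1r.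
Qed.

(* At level [k], [f] is represented by a near-minimizer over the ball of
   [N y + (t_k * nu (f - y)) ^ theta], where [t_k] grows geometrically.  The minima increase
   with [k] and are bounded, so that the penalties are summable; by [theta]-convexity the
   representatives of a cell lie in a small multiple of the ball, which the entropy labels
   then subdivide.  Only rational multiples are used, so that [L] may be countable. *)
Theorem convex_chaining (theta zeta gamma : R) :
  1 <= theta -> 0 < zeta -> 0 < gamma ->
  exists2 C, 0 <= C & forall (V : lmodType R) (L : set V) (N nu : V -> R) (E : R),
    (forall f g, L f -> L g -> L (f - g)) ->
    (forall (q : rat) f, L f -> L (ratr q *: f)) ->
    (forall f, L f -> 0 <= N f) ->
    (forall (a : R) f, L f -> N (a *: f) = `|a| * N f) ->
    (forall f g, L f -> L g -> N f <= 1 -> N g <= 1 ->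
       N (2^-1 *: (f + g)) <= Num.max (N f) (N g) - zeta * N (f - g) `^ theta) ->
    (forall f, L f -> 0 <= nu f) ->
    (forall (a : R) f, L f -> nu (a *: f) = `|a| * nu f) ->
    (forall f g, L f -> L g -> nu (f + g) <= 2 * (nu f + nu g)) ->
    0 < E ->
    let B := [set f | L f /\ N f <= 1] in
    (forall k, exists l : V -> nat, (forall f, B f -> (l f < entropy_card k)%N) /\
      forall f g, B f -> B g -> l f = l g -> nu (f - g) <= E * 2 `^ (- (k%:R / gamma))) ->
    exists (c : nat -> V -> nat) (D : nat -> V -> R), chained B 6 nu D c /\
      forall n f, B f -> \sum_(k < n) (2 `^ (k%:R / gamma) * D k f / E) `^ theta <= C.
Proof.
move=> th1 zeta0 gamma0.
have th0 : 0 < theta by lra.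
pose w k : R := 2 `^ (k%:R / gamma).
have w0 k : 0 < w k by rewrite powR_gt0.
pose T : R := 2 `^ gamma^-1.
have T1 : 1 < T.
  have := @gt0_ltr_powR R gamma^-1; rewrite invr_gt0 => /(_ gamma0 1 2).
  by rewrite powR1; apply; rewrite ?nnegrE//; lra.
have wS k : w k.+1 = T * w k.
  by rewrite /w /T -powRD ?pnatr_eq0 ?implybT//; congr powR; rewrite -natr1; field; lra.
pose z0 := zeta `^ (- theta^-1).
have z0p : 0 < z0 by rewrite powR_gt0.
(* With this value the coefficient 16 a z0 of the old diameter in the new one equals 1 / (4 T),
   hence 1/4 after multiplication by the weights [w], which grow by T per level: the ratio of
   [contraction_sum]. *)
pose a := (64 * z0 * T)^-1.
have a0 : 0 < a by rewrite invr_gt0 !mulr_gt0//; lra.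
have az0 : a * z0 = (64 * T)^-1.
  by rewrite /a; field; rewrite !gt_eqF//; lra.
pose kap := 1 - T `^ (- theta).
have Tth : 0 < T `^ (- theta) < 1.
  rewrite powR_gt0 ?(lt_trans _ T1)//= powRN invf_lt1 ?powR_gt0 ?(lt_trans _ T1)//.
  have T0 : 0 <= T by lra.
  by have := @gt0_ltr_powR R theta th0 1 T; rewrite powR1; apply; rewrite ?nnegrE.
have kap01 : 0 < kap <= 1 by rewrite /kap; move: Tth => /andP[]; lra.
pose C1 := 6 / kap.
pose C := 2 * (1 + 2 `^ theta * ((76 / a) `^ theta * (C1 + 2 `^ theta * 2))).
have C10 : 0 <= C1 by rewrite divr_ge0//; lra.
exists C.
  apply: mulr_ge0 => //; apply: addr_ge0 => //; apply: mulr_ge0; first exact: powR_ge0.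
  apply: mulr_ge0; first exact: powR_ge0.
  by apply: addr_ge0 => //; apply: mulr_ge0 => //; exact: powR_ge0.
move=> V L N nu E LB LZ N0 NZ Ncvx nu0 nuZ nuD E0 B ent.

have L0 f : L f -> L 0 by move=> /(LZ 0); rewrite rmorph0 scale0r.
have LN f : L f -> L (- f).
  by move=> Lf; rewrite -sub0r; apply: LB => //; exact: L0 Lf.
have LD f g : L f -> L g -> L (f + g).
  by move=> Lf Lg; rewrite -[g]opprK; apply: LB => //; exact: LN.
have Lhalf f : L f -> L (2^-1 *: f).
  by move=> /(LZ 2^-1); rewrite fmorphV/= rmorph_nat.
have nuN f : L f -> nu (- f) = nu f.
  by move=> Lf; rewrite -scaleN1r nuZ// normrN1 mul1r.
have NN f : L f -> N (- f) = N f.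
  by move=> Lf; rewrite -scaleN1r NZ// normrN1 mul1r.
have nu00 f : L f -> nu 0 = 0 by move=> Lf; rewrite -(scale0r f) nuZ// normr0 mul0r.
have nuB f g : L f -> L g -> nu (f - g) = nu (g - f).
  by move=> Lf Lg; rewrite -opprB nuN//; exact: LB.
have nu_tri f g h : L f -> L g -> L h -> nu (f - h) <= 2 * (nu (f - g) + nu (g - h)).
  move=> Lf Lg Lh; have -> : f - h = (f - g) + (g - h) by rewrite addrA subrK.
  by apply: nuD; exact: LB.
have [t tE] : {t : nat -> R | forall k, t k = a * w k / E} by eexists.
have t0 k : 0 < t k by rewrite tE divr_gt0// mulr_gt0.
have tS k : t k.+1 = T * t k by rewrite !tE wS; ring.
pose Phi k f y := N y + (t k * nu (f - y)) `^ theta.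
have [pi piP] : exists pi : nat -> V -> V, forall k f, B f ->
    B (pi k f) /\ forall z, B z -> Phi k f (pi k f) <= Phi k f z + 2^-1 ^+ k.
  have /choice[pi piP] : forall kf : nat * V, exists y, B kf.2 ->
      B y /\ forall z, B z -> Phi kf.1 kf.2 y <= Phi kf.1 kf.2 z + 2^-1 ^+ kf.1.
    move=> [k f]/=; have [Bf|nBf] := pselect (B f); last by exists f.
    have [|||y By yP] := @approx_min R V B (Phi k f) (2^-1 ^+ k).
    - by exists f.
    - by move=> y [Ly _]; rewrite addr_ge0 ?powR_ge0// N0.
    - by rewrite exprn_gt0.
    by exists y.
  by exists (fun k f => pi (k, f)) => k f Bf; exact: (piP (k, f) Bf).
have BL f : B f -> L f by case.
have piB k f : B f -> B (pi k f) by move=> /(piP k)[].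
have piL k f : B f -> L (pi k f) by move=> /(piB k)[].
pose sig k f := t k * nu (f - pi k f).
have sig0 k f : B f -> 0 <= sig k f.
  by move=> Bf; rewrite mulr_ge0 ?(ltW (t0 _))// nu0//; apply: LB; [exact: BL|exact: piL].
have K2 k f : B f -> 0 <= Phi k f (pi k f) <= 2.
  move=> Bf; apply/andP; split; first by apply: addr_ge0; [exact/N0/piL|exact: powR_ge0].
  (* Comparison with the competitor f itself, whose penalty vanishes: the near-minimal value is at
     most N f + 2^-k <= 2. *)
  have PhiE : Phi k f f = N f.
    by rewrite /Phi subrr (nu00 f (BL f Bf)) mulr0 powR0 ?addr0// gt_eqF.
  have [_ /(_ f Bf)] := piP k f Bf; rewrite PhiE.
  have : 2^-1 ^+ k <= 1 :> R by rewrite exprn_ile1//; lra.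
  case: Bf => _; lra.
have sig2 k f : B f -> sig k f <= 2.
  move=> Bf; have /andP[_ h] := K2 k f Bf.
  have {}h : sig k f `^ theta <= 2.
    by apply: le_trans h; rewrite /Phi lerDr; exact/N0/piL.
  have [//|s2] := leP (sig k f) 2; have : sig k f <= sig k f `^ theta by apply: le1r_powR; lra.
  lra.
have sigsum n f : B f -> \sum_(k < n) sig k f `^ theta <= C1.
  move=> Bf; apply: (@telescope_bound R (fun k => Phi k f (pi k f)) (fun k => sig k f `^ theta) kap) => //.
  - by move=> k; exact: K2.
  - have /andP[_] := K2 0%N f Bf; apply: le_trans.
    by rewrite /Phi lerDr; exact/N0/piL.
  (* The representative of level k + 1 competes at level k, where its penalty is smaller by the
     factor T^-theta; the near-minimal values thus grow by [kap] = 1 - T^-theta times the penalty,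
     up to 2^-k. *)
  - move=> k; have [_ /(_ (pi k.+1 f) (piB _ _ Bf))] := piP k f Bf.
    have -> : Phi k f (pi k.+1 f) = Phi k.+1 f (pi k.+1 f) - kap * sig k.+1 f `^ theta.
      have h0 : 0 <= t k * nu (f - pi k.+1 f).
        by rewrite mulr_ge0 ?(ltW (t0 _))// nu0//; apply: LB; [exact: BL|exact: piL].
      have T0 : 0 <= T by lra.
      rewrite /Phi /sig tS -mulrA (powRM _ T0 h0).
      rewrite /kap powRN; set z := (_ `^ theta in RHS); set z' := (t k * _) `^ _.
      have : T `^ theta != 0 by rewrite gt_eqF// powR_gt0; lra.
      by move=> ?; field.
    lra.
pose p k f := if k is 0%N then 0%N else grid_label k (sig k f).
pose tau k f := grid_value k (p k f) : R.
have tauP k f : B f -> sig k.+1 f <= tau k.+1 f <= sig k.+1 f + 2^-1 ^+ k.+1.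
  by move=> Bf; exact/grid_valueP/sig0.
(* From the estimate of a cell: 6 s / t for the distances to the representatives and 8 (3 s + e) / t
   for the entropy of their differences, together (30 s + 8 e) / t. *)
pose b k f := if k is 0%N then E else (30 * tau k f + 8 * 2 `^ (- (k%:R / theta))) / t k.
have [|||| c [D [cP cn Dc Dle [D0 DS]]]] := @nested_contraction R V B (fun f g => nu (f - g)) p
  (fun k => if k is k'.+1 then 2 ^ (k' + 3) else 1)%N (fun k => entropy_card k.+1) (4 * T)^-1 b.
- case=> [//|k f Bf /=]; rewrite /p.
  apply: leq_trans (grid_label_lt (j := 2) _ (sig0 _ _ Bf) _) _.
    by apply: le_lt_trans (sig2 _ _ Bf) _; rewrite expr2; lra.
  by rewrite leq_exp2l// addSn -addnS.
- by case=> [//|k f g Bf Bg /= pfg]; rewrite /tau /= pfg.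
- move=> f g Bf Bg _ /=.
  have [l [l1 lE]] := ent 0%N.
  have := lE f g Bf Bg; rewrite mul0r oppr0 powRr0 mulr1; apply.
  by have := l1 f Bf; have := l1 g Bg; rewrite /entropy_card !ltnS !leqn0 => /eqP -> /eqP ->.
- move=> k A D AB pA dA; set j := k.+1.
  have [[f0 Af0]|nA] := pselect (exists f, A f); last first.
    by exists (fun=> 0%N); split => [f Af|f g Af]; case: nA; exists f.
  have AL f : A f -> L f by move=> /AB[].
  have D0 : 0 <= D by have := dA _ _ Af0 Af0; rewrite subrr (nu00 f0)//; exact: AL.
  have [s sE] : {s | s = tau j f0} by eexists.
  have tauA f : A f -> tau j f = s by move=> Af; rewrite sE /tau (pA f f0).
  have sigs f : A f -> sig j f <= s.
    by move=> Af; rewrite -(tauA _ Af); have /andP[] := tauP k f (AB _ Af).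
  have s0 : 0 <= s by apply: le_trans (sigs _ Af0); exact/sig0/AB.
  (* The near-minimality error 2^-j is written as e^theta, so that it joins the penalties inside the
     theta-th root. *)
  have [e eE] : {e : R | e = 2 `^ (- (j%:R / theta))} by eexists.
  have e0 : 0 < e by rewrite eE powR_gt0.
  have eth : e `^ theta = 2^-1 ^+ j.
    rewrite eE -powRrM mulNr divfK ?gt_eqF// powRN powR_mulrn//.
    by rewrite exprVn.
  have [r rE] : {r | r = z0 * (3 * s + 2 * (t j * D) + e)} by eexists.
  have tD0 : 0 <= t j * D by rewrite mulr_ge0// ltW.
  have r0 : 0 < r.
    by rewrite rE; apply: mulr_gt0 => //; apply: ltr_wpDl => //; apply: addr_ge0; apply: mulr_ge0.
  have key f g : A f -> A g -> N (pi j g) <= N (pi j f) -> N (pi j f - pi j g) <= r.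
    move=> Af Ag Nfg.
    have [Bf Bg] := (AB _ Af, AB _ Ag).
    have [Lf Lg] := (BL _ Bf, BL _ Bg).
    have [By Bz] := (piB j _ Bf, piB j _ Bg).
    have [Ly Lz] := (BL _ By, BL _ Bz).
    have := Ncvx _ _ Ly Lz By.2 Bz.2; rewrite (max_idPl Nfg) => Nu.
    have h := @convex_minimizers_close V L N nu theta zeta (t j) D s e f g (pi j f) (pi j g)
      th1 zeta0 (t0 j) D0 s0 (ltW e0) LB LD Lhalf N0 nu0 nuZ nuD Lf Lg Ly Lz By.2 Nfg Nu.
    rewrite rE; apply: h; [|exact: dA|exact: sigs|exact: sigs].
    by move=> u Lu Nu1; rewrite eth; apply: (piP j f Bf).2.
  have {}key f g : A f -> A g -> N (pi j f - pi j g) <= r.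
    move=> Af Ag; have [h|/ltW h] := leP (N (pi j g)) (N (pi j f)); first exact: key.
    rewrite -opprB NN; first exact: key.
    by apply: LB; apply: piL; exact: AB.
  (* Dilating by the real number r could leave [L]; a rational number between r and 2 r costs a
     factor 2. *)
  have /rat_in_itvoo[q] : r < 2 * r by rewrite ltr_pMl// ltr1n.
  rewrite in_itv/= => /andP[rq qr].
  pose rho : R := ratr q.
  have rho0 : 0 < rho by rewrite (lt_trans r0).
  have [l [l1 lE]] := ent j.
  (* The representatives of the cell lie within N-distance r of that of [f0], by uniform convexity.
     Rescaled differences lie in [B], so the entropy labels of level j apply to them. *)
  pose sc f := ratr q^-1 *: (pi j f - pi j f0).
  have scB f : A f -> B (sc f).
    move=> Af; have Lh : L (pi j f - pi j f0) by apply: LB; apply: piL; exact: AB.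
    split; first exact: LZ.
    rewrite /sc NZ// fmorphV ger0_norm ?invr_ge0 ?(ltW rho0)//.
    by rewrite ler_pdivrMl// mulr1 (le_trans (key _ _ Af Af0))// ltW.
  exists (l \o sc); split => [f Af /=|f g Af Ag /= lfg]; first exact/l1/scB.
  have [Bf Bg] := (AB _ Af, AB _ Ag).
  have [Lf Lg] := (BL _ Bf, BL _ Bg).
  have [Ly Lz] := (piL j _ Bf, piL j _ Bg).
  have h1 : nu (pi j f - pi j g) <= rho * (E / w j).
    have := lE _ _ (scB _ Af) (scB _ Ag) lfg.
    rewrite /sc -scalerBr opprB addrA subrK nuZ; last exact: LB.
    rewrite fmorphV ger0_norm ?invr_ge0 ?(ltW rho0)// powRN -/(w j).
    by rewrite ler_pdivrMl.
  have h2 : nu (f - g) <= 6 * (s / t j) + 4 * (rho * (E / w j)).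
    apply: le_trans (nu_tri f (pi j f) g Lf Ly Lg) _.
    have hf : nu (f - pi j f) <= s / t j by rewrite ler_pdivlMr// mulrC; exact: sigs.
    have hg : nu (g - pi j g) <= s / t j by rewrite ler_pdivlMr// mulrC; exact: sigs.
    have := nu_tri (pi j f) (pi j g) g Ly Lz Lg.
    rewrite (nuB (pi j g))//; move: hf hg h1; clear.
    move: (nu _) (nu _) (nu _) (nu _) (s / _) (rho * _) => *; lra.
  apply: le_trans h2 _; rewrite /= tauA// -eE.
  have EW : E / w j = a / t j by rewrite tE; field; rewrite !gt_eqF.
  rewrite EW.
  have h3 : rho * (a / t j) <= 2 * r * (a / t j).
    by rewrite ler_wpM2r ?(ltW qr)// divr_ge0// ltW.
  have h4 : r * (a / t j) = (3 * s + 2 * (t j * D) + e) * (a * z0) / t j.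
    by rewrite rE; ring.
  have h5 : (3 * s + 2 * (t j * D) + e) * (a * z0) / t j =
            2 * (a * z0) * D + (3 * s + e) * (a * z0) / t j.
    by field; rewrite gt_eqF.
  have h6 : (3 * s + e) * (a * z0) / t j <= (3 * s + e) / t j.
    rewrite ler_pM2r ?invr_gt0// ler_piMr; [| lra |].
      lra.
    by rewrite az0 invf_le1 ?mulr_gt0//; lra.
  have h7 : 16 * (a * z0) * D = (4 * T)^-1 * D.
    by rewrite az0; congr (_ * _); field; lra.
  have -> : (30 * s + 8 * e) / t j = 6 * (s / t j) + 8 * ((3 * s + e) / t j) by ring.
  lra.
have tau0 k f : 0 <= tau k f by rewrite /tau /grid_value mulr_ge0// exprn_ge0.
have T40 : 0 <= (4 * T)^-1 by rewrite invr_ge0 mulr_ge0// (le_trans _ (ltW T1)).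
have b0 k f : 0 <= b k.+1 f.
  apply: divr_ge0; last exact: ltW.
  by apply: addr_ge0; apply: mulr_ge0 => //; exact: powR_ge0.
exists c, D; split.
  split => //.
  - split=> // k f Bf; apply: leq_trans (label_prod k); exact: cP.
  - elim=> [|k ih] f Bf; first by rewrite D0 /= ltW.
    by rewrite DS; apply: addr_ge0; [apply: mulr_ge0; [exact: T40|exact: ih]|exact: b0].
move=> n f Bf.
pose e k := 2 `^ (- (k%:R / theta)) : R.
have e0 k : 0 < e k by rewrite powR_gt0.
have eth k : e k `^ theta = 2^-1 ^+ k.
  rewrite /e -powRrM mulNr divfK ?gt_eqF// powRN powR_mulrn//.
  by rewrite exprVn.
have ek k : 2^-1 ^+ k <= e k.
  rewrite -eth; have := @ger_powR R (e k) _ 1 theta th1; rewrite powRr1 ?(ltW (e0 _))//.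
  apply; rewrite e0/= /e powRN invf_le1 ?powR_gt0//.
  have := @ler_powR R 2 _ 0 (k%:R / theta); rewrite powRr0; apply; first lra.
  by rewrite divr_ge0// ltW.
(* (30 tau + 8 e) / a with tau <= sig + 2^-k <= sig + e, rounded up to the common coefficient 38. *)
pose y k := 38 / a * (sig k f + 2 * e k).
have y0 k : 0 <= y k.
  by rewrite mulr_ge0 ?divr_ge0 ?(ltW a0)// addr_ge0 ?sig0// mulr_ge0// ltW.
have D_ge0 k : 0 <= D k f.
  elim: k => [|k ih]; first by rewrite D0 /= ltW.
  by rewrite DS; apply: addr_ge0; [apply: mulr_ge0; [exact: T40|exact: ih]|exact: b0].
have x0 k : 0 <= w k * D k f / E by rewrite divr_ge0 ?mulr_ge0// ltW.
have xS k : w k.+1 * D k.+1 f / E <= w k * D k f / E / 4 + y k.+1.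
  rewrite DS /= mulrDr mulrDl lerD//.
    by rewrite wS le_eqVlt; apply/orP; left; apply/eqP; field; rewrite gt_eqF//; lra.
  have -> : w k.+1 * ((30 * tau k.+1 f + 8 * e k.+1) / t k.+1) / E = (30 * tau k.+1 f + 8 * e k.+1) / a.
    by rewrite tE; field; rewrite !gt_eqF.
  have ai : 0 < a^-1 by rewrite invr_gt0.
  rewrite /y mulrAC (ler_pM2r ai).
  have /andP[_] := tauP k f Bf; have := ek k.+1; have := sig0 k.+1 f Bf.
  have := e0 k.+1; lra.
apply: le_trans (contraction_sum th1 x0 y0 xS n) _.
rewrite /C ler_pM2l//; apply: lerD.
  by rewrite D0 /= /w mul0r powRr0 mul1r divff ?gt_eqF// powR1.
rewrite ler_pM2l ?powR_gt0//.
have h k : y k `^ theta <= (76 / a) `^ theta * (sig k f `^ theta + 2 `^ theta * 2^-1 ^+ k).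
  have e20 : 0 <= 2 * e k by rewrite mulr_ge0// ltW.
  rewrite /y powRM ?divr_ge0 ?(ltW a0) ?addr_ge0 ?sig0//.
  have -> : 76 / a = 38 / a * 2 by ring.
  rewrite [in leRHS]powRM ?divr_ge0 ?(ltW a0)// -mulrA ler_wpM2l ?powR_ge0//.
  apply: le_trans (powRD_le (sig0 _ _ Bf) e20 (ltW th0)) _.
  by rewrite powRM ?(ltW (e0 _))// eth.
apply: le_trans (ler_sum _ (fun (k : 'I_n) _ => h k)) _.
rewrite -mulr_sumr ler_wpM2l ?powR_ge0// big_split/= -mulr_sumr lerD ?sigsum//.
by rewrite ler_wpM2l ?powR_ge0 ?sum_expr2V.
Qed.

End convex_chaining.

(** * Rademacher averages *)

Section rademacher.
Context {R : realType}.

Definition sgn (b : bool) : R := (-1) ^+ b.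

Definition rad_mean (m : nat) (phi : {ffun 'I_m -> bool} -> R) : R :=
  (2 ^+ m)^-1 * \sum_e phi e.

Definition rad_sum (m : nat) (v : 'I_m -> R) (e : {ffun 'I_m -> bool}) : R :=
  \sum_j sgn (e j) * v j.

Section rad_mean_theory.
Variable m : nat.
Implicit Types phi psi : {ffun 'I_m -> bool} -> R.

Let c0 : 0 <= (2 ^+ m)^-1 :> R. Proof. by rewrite invr_ge0 exprn_ge0. Qed.

Lemma rad_mean_le phi psi : (forall e, phi e <= psi e) -> rad_mean phi <= rad_mean psi.
Proof. by move=> h; rewrite ler_wpM2l// ler_sum. Qed.

Lemma rad_mean_cst (c : R) : rad_mean (fun _ : {ffun 'I_m -> bool} => c) = c.
Proof.
rewrite /rad_mean sumr_const.
rewrite card_ffun card_bool card_ord -[c *+ _]mulr_natl natrX mulrA mulVf ?mul1r//.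
Qed.

Lemma rad_meanD phi psi : rad_mean (fun e => phi e + psi e) = rad_mean phi + rad_mean psi.
Proof. by rewrite /rad_mean big_split mulrDr. Qed.

Lemma rad_meanZ c phi : rad_mean (fun e => c * phi e) = c * rad_mean phi.
Proof. by rewrite /rad_mean -mulr_sumr mulrCA. Qed.

Lemma rad_mean_sum (I : Type) (r : seq I) (phi : I -> {ffun 'I_m -> bool} -> R) :
  rad_mean (fun e => \sum_(i <- r) phi i e) = \sum_(i <- r) rad_mean (phi i).
Proof. by rewrite /rad_mean exchange_big/= mulr_sumr. Qed.

(** Independence of the signs is the factorization of a sum over all sign patterns into a product
    over the coordinates. The absolute value costs the factor 2, by exp |z| <= exp z + exp(-z). *)
Lemma rad_mgf (v : 'I_m -> R) (lam q : R) : 0 <= lam -> 1 <= q <= 2 ->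
  rad_mean (fun e => expR (lam * `|rad_sum v e|)) <=
  2 * expR (2 * lam `^ q * \sum_j `|v j| `^ q).
Proof.
move=> lam0 q12.
have one (x : 'I_m -> R) : rad_mean (fun e => expR (rad_sum x e)) <=
    expR (2 * \sum_j `|x j| `^ q).
  have -> : rad_mean (fun e => expR (rad_sum x e)) =
      \prod_j ((expR (x j) + expR (- x j)) / 2).
    rewrite big_split/= prodr_const card_ord exprVn mulrC; congr (_ * _).
    transitivity (\prod_(j < m) \sum_(b : bool) expR (sgn b * x j)); last first.
      apply: eq_bigr => j _; rewrite big_bool/= /sgn expr1 expr0 mul1r mulN1r.
      by rewrite addrC.
    rewrite bigA_distr_bigA/=; apply: eq_bigr => e _.
    by rewrite /rad_sum expR_sum.
  rewrite mulr_sumr expR_sum; apply: ler_prod => j _.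
  by rewrite divr_ge0 ?addr_ge0 ?expR_ge0//= cosh_le.
have -> : 2 * lam `^ q * \sum_j `|v j| `^ q = 2 * \sum_j `|lam * v j| `^ q.
  rewrite -mulrA mulr_sumr; congr (_ * _); apply: eq_bigr => j _.
  by rewrite normrM (ger0_norm lam0) powRM.
apply: (@le_trans _ _ (rad_mean (fun e => expR (rad_sum (fun j => lam * v j) e) +
                                          expR (rad_sum (fun j => - (lam * v j)) e)))).
  apply: rad_mean_le => e.
  have sE : rad_sum (fun j => lam * v j) e = lam * rad_sum v e.
    by rewrite /rad_sum mulr_sumr; apply: eq_bigr => j _; rewrite mulrCA.
  have -> : rad_sum (fun j => - (lam * v j)) e = - (lam * rad_sum v e).
    by rewrite -sE /rad_sum -sumrN; apply: eq_bigr => j _; rewrite mulrN.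
  rewrite sE; have [r0|r0] := leP 0 (rad_sum v e).
    by rewrite ger0_norm// lerDl expR_ge0.
  by rewrite ltr0_norm// mulrN lerDr expR_ge0.
rewrite rad_meanD mulr2n mulrDl !mul1r lerD//.
apply: le_trans (one _) _; under eq_bigr do rewrite normrN.
by [].
Qed.

End rad_mean_theory.

(** One random variable dominates all links at once: a constant c0 = A + 2 plus an exponential sum,
    by z <= exp z. A term of level k has mean at most 2^-k * 2 exp(2^k (2 - c0)) = 2^-k * 2 exp(-A
    2^k), which beats the number 2^(A 2^k) of labels; summing over k gives A + 2 + 4. *)
Lemma rad_maximal (s : R) (A m n : nat) (v : nat -> nat -> 'I_m -> R)
    (bet : nat -> nat -> R) : 2 <= s ->
  (forall k l, 0 <= bet k l) ->
  (forall k l, \sum_j `|v k l j| `^ (s / (s - 1)) <= bet k l `^ (s / (s - 1))) ->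
  exists xi : {ffun 'I_m -> bool} -> R, [/\ forall e, 0 <= xi e,
    rad_mean xi <= (A + 6)%:R &
    forall e k l, (k < n)%N -> (l < 2 ^ (A * 2 ^ k))%N ->
      `|rad_sum (v k l) e| <= xi e * (2 `^ (k%:R / s) * bet k l)].
Proof.
move=> s2 bet0 vbet; set q := s / (s - 1) in vbet.
have q12 : 1 <= q <= 2.
  by rewrite /q ler_pdivlMr ?ler_pdivrMr; lra.
have q0 : 0 < q by lra.
pose c0 : R := (A + 2)%:R.
pose U k l e := `|rad_sum (v k l) e| / (2 `^ (k%:R / s) * bet k l).
pose N k := (2 ^ (A * 2 ^ k))%N.
pose xi e := c0 + \sum_(k < n) \sum_(l < N k) 2^-1 ^+ k * expR (2 ^+ k * (U k l e - c0)).
have term0 k l e : 0 <= 2^-1 ^+ k * expR (2 ^+ k * (U k l e - c0)).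
  by rewrite mulr_ge0 ?expR_ge0// exprn_ge0.
exists xi; split.
- move=> e; rewrite addr_ge0//.
  by apply: sumr_ge0 => k _; apply: sumr_ge0 => l _; exact: term0.
- rewrite rad_meanD rad_mean_cst.
  have -> : (A + 6)%:R = c0 + 4 :> R by rewrite /c0 !natrD; lra.
  rewrite lerD2l rad_mean_sum.
  have step k l : rad_mean (fun e => 2^-1 ^+ k * expR (2 ^+ k * (U k l e - c0))) <=
      2^-1 ^+ k * (2 * expR (2 ^+ k * (2 - c0))).
    rewrite rad_meanZ ler_wpM2l ?exprn_ge0//.
    pose w := 2 `^ (k%:R / s) * bet k l.
    have w0 : 0 <= w by rewrite mulr_ge0 ?powR_ge0.
    pose lam := 2 ^+ k / w.
    have lam0 : 0 <= lam by rewrite divr_ge0// exprn_ge0.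
    have -> : (fun e => expR (2 ^+ k * (U k l e - c0))) =
        (fun e => expR (- (2 ^+ k * c0)) * expR (lam * `|rad_sum (v k l) e|)).
      apply/funext => e; rewrite -expRD; congr expR.
      by rewrite /U -/w /lam mulrBr addrC; congr (_ + _); rewrite mulrCA mulrC mulrAC.
    rewrite rad_meanZ; apply: (@le_trans _ _ (expR (- (2 ^+ k * c0)) * (2 * expR (2 * 2 ^+ k)))).
      rewrite ler_wpM2l ?expR_ge0//; apply: le_trans (rad_mgf _ lam0 q12) _.
      rewrite ler_pM2l// ler_expR -mulrA ler_pM2l//.
      apply: le_trans (ler_wpM2l (powR_ge0 lam q) (vbet k l)) _.
      rewrite -powRM//; have [b0|bn0] := eqVneq (bet k l) 0.
        by rewrite b0 mulr0 powR0 ?gt_eqF// exprn_ge0.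
      (* Raised to the power q this is 2^k, the order of the logarithm of the number of labels: here
         the factor 2^(k/s) is matched with the l_q norm, q conjugate to s. *)
      have -> : lam * bet k l = 2 `^ (k%:R * q^-1).
        rewrite /lam /w invfM -!mulrA mulVf// mulr1.
        have -> : k%:R * q^-1 = k%:R - k%:R / s :> R by rewrite /q; field; rewrite ?gt_eqF; lra.
        by rewrite powRB ?pnatr_eq0 ?implybT// powR_mulrn.
      by rewrite -powRrM mulfVK ?gt_eqF// powR_mulrn.
    rewrite mulrCA ler_pM2l// -expRD ler_expR; lra.
  have stepk (k : 'I_n) : true -> rad_mean (fun e => \sum_(l < N k) 2^-1 ^+ k * expR (2 ^+ k * (U k l e - c0))) <=
      2^-1 ^+ k * 2.
    move=> _; rewrite rad_mean_sum.
    apply: le_trans (ler_sum _ (fun (l : 'I_(N k)) _ => step k l)) _.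
    rewrite sumr_const card_ord -mulrnAr ler_wpM2l ?exprn_ge0// -mulr_natl mulrCA ger_pMr//.
    rewrite /N /c0 natrX.
    have -> : 2 ^+ k * (2 - (A + 2)%:R) = - (A * 2 ^ k)%:R :> R by rewrite natrD natrM natrX; ring.
    rewrite expRN ler_pdivrMr ?expR_gt0// mul1r -[X in expR X]mulr1 expRM_natl.
    by rewrite lerXn2r ?nnegrE ?expR_ge0//; have := @expR_ge1Dx R 1; lra.
  apply: le_trans (ler_sum _ stepk) _.
  by rewrite -mulr_suml; have := @sum_expr2V R n; lra.
- move=> e k l kn lN.
  (* [U] is then 0 by the convention on division by 0 and bounds nothing; but a vanishing bound on
     the l_q norm forces the vector itself to vanish. *)
  have [b0|bn0] := eqVneq (bet k l) 0.
    have := vbet k l; rewrite b0 powR0 ?gt_eqF// => h.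
    rewrite /rad_sum big1 ?normr0 ?mulr0// => j _.
    have : `|v k l j| `^ q <= 0.
      by apply: le_trans h; rewrite (bigD1 j)//= lerDl sumr_ge0// => i _; exact: powR_ge0.
    rewrite le_eqVlt ltNge powR_ge0 orbF powR_eq0 => /andP[/eqP/normr0_eq0 -> _].
    by rewrite mulr0.
  have w0 : 0 < 2 `^ (k%:R / s) * bet k l.
    by rewrite mulr_gt0 ?powR_gt0// lt_neqAle eq_sym bn0 bet0.
  rewrite -ler_pdivrMr// -/(U k l e).
  apply: (@le_trans _ _ (c0 + 2^-1 ^+ k * expR (2 ^+ k * (U k l e - c0)))).
    rewrite -lerBlDl.
    have -> : U k l e - c0 = 2^-1 ^+ k * (2 ^+ k * (U k l e - c0)).
      by rewrite mulrA -exprMn mulVf ?pnatr_eq0// expr1n mul1r.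
    rewrite ler_pM2l ?exprn_gt0//; set z := 2 ^+ k * _.
    by rewrite mulrA -exprMn divff ?pnatr_eq0// expr1n mul1r; have := expR_ge1Dx z; lra.
  rewrite lerD2l (bigD1 (Ordinal kn))//= (bigD1 (Ordinal lN))//= -addrA lerDl.
  rewrite addr_ge0//; last apply: sumr_ge0 => i _.
    by apply: sumr_ge0 => i _; exact: term0.
  by apply: sumr_ge0 => j _; exact: term0.
Qed.

(** Hölder's inequality up to the factor 2, termwise from u <= 1 + u^q with u = c |x_j|; note m^(1 -
    1/q) = m^(1/s). It treats the link at which chaining stops. *)
Lemma l1_le_lq (s : R) (m : nat) (x : 'I_m -> R) (bet : R) : 2 <= s -> 0 <= bet ->
  \sum_j `|x j| `^ (s / (s - 1)) <= bet `^ (s / (s - 1)) ->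
  \sum_j `|x j| <= 2 * m%:R `^ s^-1 * bet.
Proof.
move=> s2 bet0; set q := s / (s - 1) => h.
have q1 : 1 <= q by rewrite /q ler_pdivlMr; lra.
have q0 : 0 < q by lra.
case: m x h => [x _|m x h]; first by rewrite big_ord0 !mulr_ge0 ?powR_ge0.
have m0 : 0 < m.+1%:R :> R by rewrite ltr0n.
have [b0|bn0] := eqVneq bet 0.
  rewrite b0 mulr0; move: h; rewrite b0 powR0 ?gt_eqF// => h.
  rewrite big1// => j _.
  have : `|x j| `^ q <= 0.
    by apply: le_trans h; rewrite (bigD1 j)//= lerDl sumr_ge0// => i _; exact: powR_ge0.
  by rewrite le_eqVlt ltNge powR_ge0 orbF powR_eq0 => /andP[/eqP].
have {bn0}bet0 : 0 < bet by rewrite lt_neqAle eq_sym bn0.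
pose c := m.+1%:R `^ q^-1 / bet.
have c0 : 0 < c by rewrite divr_gt0 ?powR_gt0.
have hj j : `|x j| <= c^-1 * (1 + c `^ q * `|x j| `^ q).
  rewrite ler_pdivlMl// -powRM ?(ltW c0)//.
  have := @powR_le1D R (c * `|x j|) 1 q; rewrite powRr1; last by rewrite mulr_ge0 ?(ltW c0).
  by apply; rewrite ?ler01 ?q1// mulr_ge0// ltW.
apply: le_trans (ler_sum _ (fun j _ => hj j)) _.
rewrite -mulr_sumr big_split/= -mulr_sumr sumr_const card_ord.
have cq : c `^ q = m.+1%:R / bet `^ q.
  rewrite /c powRM ?powR_ge0 ?invr_ge0 ?(ltW bet0)// powRVK ?gt_eqF ?(ltW m0)//.
  by rewrite -[bet^-1]powR_inv1 ?(ltW bet0)// -powRrM mulN1r powRN.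
apply: (@le_trans _ _ (c^-1 * (m.+1%:R + m.+1%:R))).
  rewrite ler_pM2l ?invr_gt0// lerD2l cq mulrAC ler_pdivrMr ?powR_gt0//.
  by rewrite ler_pM2l.
rewrite /c invfM invrK le_eqVlt; apply/orP; left; apply/eqP.
have -> : s^-1 = 1 - q^-1 by rewrite /q; field; rewrite ?gt_eqF; lra.
rewrite powRD ?(gt_eqF m0) ?implybT// powRr1 ?(ltW m0)// powRN.
by ring.
Qed.

Lemma rad_sumB m (v w : 'I_m -> R) e : rad_sum (fun j => v j - w j) e = rad_sum v e - rad_sum w e.
Proof. by rewrite /rad_sum -sumrB; apply: eq_bigr => j _; rewrite mulrBr. Qed.

Lemma rad_sum_le_l1 m (v : 'I_m -> R) e : `|rad_sum v e| <= \sum_j `|v j|.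
Proof.
apply: le_trans (ler_norm_sum _ _ _) _; apply: ler_sum => j _.
by rewrite normrM /sgn normrX normrN1 expr1n mul1r.
Qed.

(** Chaining stops at the level n with m <= 2^n: the l_1 norm of the remaining link is at most 2
    m^(1/s) times its l_q bound, hence comparable with the term of level n, without any probability.
    The constant is 3 (A + 6) + 2: [xi] times G for the starting point and 2 G for the links, plus 2
    G for the last link. *)
Lemma rademacher_chaining (s : R) (A m n : nat) (T : Type) (B : set T)
    (a : T -> 'I_m -> R) (c : nat -> T -> nat) (b : nat -> T -> R) (G : R) :
  2 <= s -> nested_labels B A c -> label_constant B c b ->
  (forall k f, B f -> 0 <= b k f) ->
  (forall k f g, B f -> B g -> c k f = c k g ->
    \sum_j `|a f j - a g j| `^ (s / (s - 1)) <= b k f `^ (s / (s - 1))) ->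
  (forall f, B f -> \sum_j `|a f j| `^ (s / (s - 1)) <= G `^ (s / (s - 1))) ->
  0 <= G -> (m <= 2 ^ n)%N ->
  (forall f, B f -> \sum_(k < n.+1) 2 `^ (k%:R / s) * b k f <= G) ->
  forall (r : nat) (F : 'I_r -> T), (forall i, B (F i)) ->
    rad_mean (fun e => \big[Num.max/0]_(i < r) `|rad_sum (a (F i)) e|) <=
    (3 * A + 20)%:R * G.
Proof.
move=> s2 [cA cn] cb b0 ab aG G0 mn bG [F _|r F BF].
  rewrite (_ : (fun _ => _) = fun=> 0); last by apply/funext => e; rewrite big_ord0.
  by rewrite rad_mean_cst mulr_ge0.
set q := s / (s - 1) in ab aG.
have q0 : 0 < q by rewrite divr_gt0; lra.
have [rep repP] : exists rep : nat -> nat -> T, forall k l,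
    (exists f, B f /\ c k f = l) -> B (rep k l) /\ c k (rep k l) = l.
  have /choice[rep repP] : forall kl : nat * nat, exists g, (exists f, B f /\ c kl.1 f = kl.2) -> B g /\ c kl.1 g = kl.2.
    move=> [k l]; have [[f fP]|nf] := pselect (exists f, B f /\ c k f = l); first by exists f.
    by exists (F ord0) => h; case: nf.
  by exists (fun k l => rep (k, l)) => k l; exact: (repP (k, l)).
have repf k f : B f -> B (rep k (c k f)) /\ c k (rep k (c k f)) = c k f.
  by move=> Bf; apply: repP; exists f.
pose used k l := `[< exists f, B f /\ c k f = l >].
have usedf k f : B f -> used k (c k f) by move=> Bf; apply/asboolP; exists f.
(* Labels without a point get the zero vector, so that [rad_maximal] can range over all numbers
   below the budget. The finer label alone determines a link, because labels are nested. *)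
pose v k l : 'I_m -> R := if used k l then
  (if k is k'.+1 then fun j => a (rep k l) j - a (rep k' (c k' (rep k l))) j else a (rep k l))
  else fun=> 0.
pose bet k l : R := if used k l then (if k is k'.+1 then b k' (rep k l) else G) else 0.
have bet0 k l : 0 <= bet k l.
  rewrite /bet; case: ifP => // /asboolP u; case: k u => // k u.
  by apply: b0; case: (repP _ _ u).
have vbet k l : \sum_j `|v k l j| `^ q <= bet k l `^ q.
  rewrite /v /bet; case: ifP => [/asboolP u|_]; last first.
    by rewrite big1 ?powR_ge0// => j _; rewrite normr0 powR0 ?gt_eqF.
  have [Br cr] := repP _ _ u.
  case: k {u} l Br cr => [l Br cr|k l Br cr]; first exact: aG.
  have [Br' cr'] := repf k _ Br.
  by apply: ab => //; rewrite cr'.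
have [xi [xi0 xiA xiP]] := @rad_maximal s A m n.+1 v bet s2 bet0 vbet.
apply: (@le_trans _ _ (rad_mean (fun e => xi e * (3 * G) + 2 * G))); last first.
  rewrite rad_meanD rad_mean_cst.
  rewrite (_ : (fun e => xi e * (3 * G)) = fun e => (3 * G) * xi e); last by apply/funext => e; rewrite mulrC.
  rewrite rad_meanZ natrD natrM.
  have : 3 * G * rad_mean xi <= 3 * G * (A + 6)%:R by rewrite ler_wpM2l// mulr_ge0.
  by rewrite natrD; lra.
apply: rad_mean_le => e; apply/bigmax_leP; split.
  by rewrite addr_ge0 ?mulr_ge0.
move=> i _; have Bf := BF i; set f := F i in Bf *.
pose rk k := rep k (c k f).
have lnk k : (k < n)%N -> `|rad_sum (a (rk k.+1)) e - rad_sum (a (rk k)) e| <= xi e * (2 * (2 `^ (k%:R / s) * b k f)).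
  move=> kn; have [Br cr] := repf k.+1 f Bf.
  have ck : c k (rk k.+1) = c k f by apply: cn.
  have := xiP e k.+1 (c k.+1 f) kn (cA _ _ Bf).
  rewrite /v /bet usedf// -/(rk k.+1) ck -/(rk k) rad_sumB (cb k _ f)//.
  move=> h; apply: le_trans h _; rewrite ler_wpM2l//.
  rewrite mulrA ler_wpM2r ?b0// -(natr1 k) mulrDl powRD ?pnatr_eq0 ?implybT// mulrC ler_wpM2r ?powR_ge0//.
  rewrite mul1r; have := @ler_powR R 2 _ s^-1 1; rewrite powRr1//; apply; first lra.
  by rewrite invf_le1; lra.
have first_link : `|rad_sum (a (rk 0%N)) e| <= xi e * G.
  have := xiP e 0%N (c 0%N f) erefl (cA _ _ Bf).
  by rewrite /v /bet usedf// mul0r powRr0 mul1r.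
have chain k : (k <= n)%N -> `|rad_sum (a (rk k)) e| <= xi e * G + xi e * (2 * \sum_(i < k) 2 `^ (i%:R / s) * b i f).
  elim: k => [_|k ih kn]; first by rewrite big_ord0 !mulr0 addr0.
  have := ih (ltnW kn); have := lnk k kn; rewrite big_ord_recr/= => h1 h2.
  rewrite -[rad_sum (a (rk k.+1)) e](subrK (rad_sum (a (rk k)) e)).
  apply: le_trans (ler_normD _ _) _; lra.
have [Br cr] := repf n f Bf.
have last_link : `|rad_sum (a f) e - rad_sum (a (rk n)) e| <= 2 * (2 `^ (n%:R / s) * b n f).
  rewrite -rad_sumB; apply: le_trans (rad_sum_le_l1 _ _) _.
  apply: le_trans (l1_le_lq s2 (b0 n f Bf) _) _; first by apply: ab => //; rewrite /rk cr.
  rewrite -mulrA ler_wpM2l// ler_wpM2r ?b0//.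
  rewrite powRrM powR_mulrn// -natrX; apply: ler_powR2l => //; first by rewrite ler_nat.
  by rewrite invr_ge0; lra.
have sumn : \sum_(i < n) 2 `^ (i%:R / s) * b i f + 2 `^ (n%:R / s) * b n f <= G.
  by have := bG f Bf; rewrite big_ord_recr.
have bn0 : 0 <= 2 `^ (n%:R / s) * b n f by rewrite mulr_ge0 ?powR_ge0 ?b0.
have h1 := chain n (leqnn n).
rewrite -[rad_sum (a f) e](subrK (rad_sum (a (rk n)) e)).
apply: le_trans (ler_normD _ _) _.
have h2 : xi e * (2 * \sum_(i < n) 2 `^ (i%:R / s) * b i f) <= xi e * (2 * G).
  by rewrite ler_wpM2l//; lra.
have S0 : 0 <= \sum_(i < n) 2 `^ (i%:R / s) * b i f.
  by apply: sumr_ge0 => k _; rewrite mulr_ge0 ?powR_ge0 ?b0.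
lra.
Qed.

End rademacher.

(** * Fixed samples: entropy of one or two bodies *)

Section weighted_norm.
Context {R : realType} (Omega : Type) (m : nat) (X : 'I_m -> Omega).
Variables (G : set (Omega -> R)) (r kap M : R).
Hypotheses (r1 : 1 <= r) (G0 : G !=set0)
  (GM : forall g j, G g -> `|g (X j)| `^ kap <= M).
Implicit Types f g h : Omega -> R.

Let r0 : 0 < r. Proof. exact: lt_le_trans r1. Qed.

Definition wsum h g : R := \sum_j `|h (X j)| `^ r * `|g (X j)| `^ kap.

(** A difference of |f|^p and |g|^p is controlled by |f - g| weighted with |f|^(p-1) and |g|^(p-1);
    the supremum over the weights makes this one homogeneous functional, independent of the pair.
    The bound [GM] keeps it finite, and kap = 0 turns it into the plain l_r norm. *)
Definition wnorm h : R := sup [set wsum h g `^ r^-1 | g in G].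

Lemma wsum_ge0 h g : 0 <= wsum h g.
Proof. by apply: sumr_ge0 => j _; rewrite mulr_ge0 ?powR_ge0. Qed.

Let has_sup_wsum h : has_sup [set wsum h g `^ r^-1 | g in G].
Proof.
split; first by have [g Gg] := G0; exists (wsum h g `^ r^-1), g.
exists ((\sum_j `|h (X j)| `^ r * M) `^ r^-1) => _ [g Gg <-].
apply: ler_powR2l; rewrite ?invr_ge0 ?(ltW r0) ?wsum_ge0//.
by apply: ler_sum => j _; rewrite ler_wpM2l ?powR_ge0 ?GM.
Qed.

Lemma wnorm_ge0 h : 0 <= wnorm h.
Proof.
have [g Gg] := G0; apply: le_trans (_ : wsum h g `^ r^-1 <= _); first exact: powR_ge0.
by apply: ub_le_sup; [case: (has_sup_wsum h)|exists g].
Qed.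

Lemma wsum_le h g : G g -> wsum h g <= wnorm h `^ r.
Proof.
move=> Gg; rewrite -[leLHS](powRVK (wsum_ge0 h g) (lt0r_neq0 r0)).
apply: ler_powR2l; rewrite ?powR_ge0 ?(ltW r0)//.
by apply: ub_le_sup; [case: (has_sup_wsum h)|exists g].
Qed.

Lemma wnorm_le h K : 0 <= K -> (forall g, G g -> wsum h g <= K `^ r) -> wnorm h <= K.
Proof.
move=> K0 hK; apply: ge_sup; first by case: (has_sup_wsum h).
move=> _ [g Gg <-]; rewrite -[leRHS](powRK K0 (lt0r_neq0 r0)).
by apply: ler_powR2l; rewrite ?wsum_ge0 ?invr_ge0 ?(ltW r0) ?hK.
Qed.

Lemma wnormZ a h : wnorm (a *: h) = `|a| * wnorm h.
Proof.
have wZ b f g : wsum (b *: f) g = `|b| `^ r * wsum f g.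
  by rewrite /wsum mulr_sumr; apply: eq_bigr => j _; rewrite normrM powRM// mulrA.
have le b f : wnorm (b *: f) <= `|b| * wnorm f.
  apply: wnorm_le => [|g Gg]; first by rewrite mulr_ge0 ?wnorm_ge0.
  by rewrite wZ powRM ?wnorm_ge0// ler_wpM2l ?powR_ge0 ?wsum_le.
apply/eqP; rewrite eq_le le/=.
have [->|a0] := eqVneq a 0; first by rewrite normr0 mul0r wnorm_ge0.
have a0' : 0 < `|a| by rewrite normr_gt0.
have := le a^-1 (a *: h); rewrite scalerA mulVf// scale1r normfV.
by rewrite ler_pdivlMl.
Qed.

(** The constant 2 avoids Minkowski's inequality; the chaining theorems ask for no more. *)
Lemma wnormD f h : wnorm (f + h) <= 2 * (wnorm f + wnorm h).
Proof.
apply: wnorm_le => [|g Gg]; first by rewrite mulr_ge0 ?addr_ge0 ?wnorm_ge0.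
rewrite powRM ?addr_ge0 ?wnorm_ge0//.
apply: (@le_trans _ _ (2 `^ r * (wsum f g + wsum h g))).
  rewrite /wsum -big_split/= mulr_sumr; apply: ler_sum => j _.
  rewrite -mulrDl mulrA ler_wpM2r ?powR_ge0//.
  apply: le_trans (powRD_le _ _ (ltW r0)) => //.
  by apply: ler_powR2l; rewrite ?(ltW r0)// ler_normD.
rewrite ler_wpM2l ?powR_ge0//.
apply: le_trans (powRD_ge (wnorm_ge0 _) (wnorm_ge0 _) r1).
by apply: lerD; exact: wsum_le.
Qed.

End weighted_norm.

Section entropy_labels.
Context {R : realType} {Omega : ptopologicalType} (m : nat) (X : 'I_m -> Omega).
Implicit Types (B : set (Omega -> R)) (f g : Omega -> R).

Lemma ler_norm_at f j : `|f (X j)| <= norm_at X f.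
Proof. exact: le_bigmax. Qed.

(** [W > 0] leaves room above the infimum, so a cover by balls of radius below twice the bound
    exists; two points of one ball then differ by at most 4 times the bound. *)
Lemma entropy_labels B (W alpha : R) k : 0 < W ->
  (entropy_number B (fun f g => norm_at X (f - g)%R) k
       <= (W * 2 `^ (- (k%:R / alpha)))%:E)%E ->
  exists l : (Omega -> R) -> nat, (forall f, (l f < entropy_card k)%N) /\
    forall f g, B f -> B g -> l f = l g ->
      forall j, `|(f - g) (X j)| <= 4 * W * 2 `^ (- (k%:R / alpha)).
Proof.
move=> W0; set e := W * _ => ek.
have e0 : 0 < e by rewrite mulr_gt0 ?powR_gt0.
have : (entropy_number B (fun f g => norm_at X (f - g)%R) k < (2 * e)%:E)%E.
  by apply: le_lt_trans ek _; rewrite lte_fin; lra.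
move=> /ereal_inf_lt[_ [eps [c [Bc cov] <-]]]; rewrite lte_fin => eps2.
have card0 : (0 < entropy_card k)%N by case: (k) => // k'; rewrite expn_gt0.
have [l lP] : exists l : (Omega -> R) -> 'I_(entropy_card k), forall f, B f ->
    norm_at X (c (l f) - f) < eps.
  have /choice[l lP] : forall f, exists j : 'I_(entropy_card k), B f -> norm_at X (c j - f) < eps.
    move=> f; have [Bf|nBf] := pselect (B f); last by exists (Ordinal card0).
    by have [j jP] := cov f Bf; exists j.
  by exists l.
exists (fun f => l f : nat); split => [f|f g Bf Bg /val_inj lfg j]; first exact: ltn_ord.
have hf := le_lt_trans (ler_norm_at (c (l f) - f) j) (lP f Bf).
have hg := le_lt_trans (ler_norm_at (c (l g) - g) j) (lP g Bg).
have -> : (f - g) (X j) = (c (l g) - g) (X j) - (c (l f) - f) (X j).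
  by rewrite lfg !fctE; ring.
apply: le_trans (ler_normB _ _) _.
have -> : 4 * W * 2 `^ (- (k%:R / alpha)) = 4 * e by rewrite mulrA.
move: hf hg eps2; clear; move: (`|(c (l f) - f) (X j)|) (`|(c (l g) - g) (X j)|) => *; lra.
Qed.

(** At level 0 a single ball covers [B], so its centre is close to both f and -f, whose difference
    is 2 f. *)
Lemma entropy0_sup B (W alpha : R) : (forall f, B f -> B (- f)) ->
  (entropy_number B (fun f g => norm_at X (f - g)%R) 0
       <= (W * 2 `^ (- (0%:R / alpha)))%:E)%E ->
  forall f j, B f -> `|f (X j)| <= W.
Proof.
rewrite mul0r oppr0 powRr0 mulr1 => BN eW f j Bf.
apply/ler_addgt0Pr => e e0.
have /ereal_inf_lt[_ [eps [c [Bc cov] <-]]] :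
    (entropy_number B (fun f g => norm_at X (f - g)%R) 0 < (W + e)%:E)%E.
  by apply: le_lt_trans eW _; rewrite lte_fin ltrDl.
rewrite lte_fin => epsW.
have [i iP] := cov _ Bf; have [i' i'P] := cov _ (BN _ Bf).
have ii : i = i' by apply/val_inj; case: i i' {iP i'P} => [[|//] ?] [[|//] ?].
rewrite -ii in i'P.
have h1 := le_lt_trans (ler_norm_at (c i - f) j) iP.
have h2 := le_lt_trans (ler_norm_at (c i - - f) j) i'P.
have E : 2 * f (X j) = (c i - - f) (X j) - (c i - f) (X j).
  by rewrite !fctE; ring.
have : `|2 * f (X j)| <= eps + eps.
  by rewrite E; apply: le_trans (ler_normB _ _) _; apply: lerD; exact: ltW.
rewrite normrM ger0_norm//; move: epsW; clear; move: (`|f (X j)|) => *; lra.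
Qed.

End entropy_labels.

(** Rational multiples only: such a set can be countable without being trivial, which makes suprema
    over its unit ball measurable. *)
Definition rational_subspace (R : realType) (V : lmodType R) (L : set V) :=
  [/\ L 0, forall f g, L f -> L g -> L (f - g) &
      forall (q : rat) f, L f -> L (ratr q *: f)].

Section sample_chaining.
Context {R : realType}.

Lemma linear_rational (Omega : ptopologicalType) (L : set (Omega -> R)) :
  linear_subspace L -> rational_subspace L.
Proof.
move=> [L0 LZ]; split=> // [f g Lf Lg|q f Lf].
  by rewrite addrC -scaleN1r; exact: LZ.
by rewrite -[_ *: _]addr0; exact: LZ.
Qed.

Lemma is_norm0 (Omega : ptopologicalType) (L : set (Omega -> R)) N :
  L 0 -> is_norm L N -> N 0 = 0.
Proof. by move=> L0 [_ _ NZ _]; rewrite -[X in N X](scale0r 0) NZ// normr0 mul0r. Qed.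

(** The power x of |h| goes to the sup norm [del], which has good entropy; the remaining |h|^(r-x)
    |u|^kap has degree p + y and is bounded by M^y (|h|^p + |u|^p). The equation between the
    exponents is homogeneity. *)
Lemma mixed_wsum (Omega : Type) (m : nat) (X : 'I_m -> Omega) (h u : Omega -> R)
    (r x y kap p del M H Q : R) :
  0 <= x <= r -> 0 <= y -> 0 <= kap -> 0 <= p -> r - x + kap = p + y ->
  0 <= M -> (forall j, `|h (X j)| <= del) -> (forall j, `|h (X j)| <= M) ->
  (forall j, `|u (X j)| <= M) ->
  \sum_j `|h (X j)| `^ p <= H -> \sum_j `|u (X j)| `^ p <= Q ->
  \sum_j `|h (X j)| `^ r * `|u (X j)| `^ kap <= del `^ x * M `^ y * (H + Q).
Proof.
move=> /andP[x0 xr] y0 k0 p0 e M0 hd hM uM hH uQ.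
have rx0 : 0 <= r - x by rewrite subr_ge0.
apply: (@le_trans _ _ (\sum_j del `^ x * M `^ y * (`|h (X j)| `^ p + `|u (X j)| `^ p))); last first.
  by rewrite -mulr_sumr big_split/= ler_wpM2l ?mulr_ge0 ?powR_ge0// lerD.
apply: ler_sum => j _.
have -> : r = x + (r - x) by ring.
rewrite powRD_ge0// -!mulrA; apply: ler_pM; rewrite ?mulr_ge0 ?powR_ge0//.
  exact: ler_powR2l.
apply: le_trans (powR_mul_le_add _ _ rx0 k0) _ => //.
by rewrite e !powRD_ge0// mulrDr; apply: lerD; rewrite mulrC ler_wpM2r ?powR_ge0// ler_powR2l.
Qed.

(** Only the power x of the sup norm enters the r-th power of the weighted norm, so entropy numbers
    of order 2^(-k/alpha) become 2^(-k x / (alpha r)). Differences are bounded by 2 M and have p-th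
    power sums at most 2^p (2 Q), whence the constants in [E]. *)
Lemma sample_chaining (theta zeta alpha p r x y kap : R) :
  1 <= theta -> 0 < zeta -> 0 < alpha -> 1 <= r -> 0 < x -> x <= r -> 0 <= y ->
  0 <= kap -> 0 <= p -> r - x + kap = p + y ->
  exists2 C, 0 <= C & forall (Omega : ptopologicalType) (m : nat) (X : 'I_m -> Omega)
    (L L0 : set (Omega -> R)) (N : (Omega -> R) -> R) (W M Q : R),
    is_norm L N -> q_convex_norm L N theta zeta ->
    L0 `<=` L -> rational_subspace L0 -> 0 < W -> 0 < M -> 0 < Q ->
    (forall k, (entropy_number (unit_ball L N) (fun f g => norm_at X (f - g)%R) k
       <= (W * 2 `^ (- (k%:R / alpha)))%:E)%E) ->
    let B0 := [set f | L0 f /\ N f <= 1] in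
    (forall f j, B0 f -> `|f (X j)| <= M) ->
    (forall f, B0 f -> \sum_j `|f (X j)| `^ p <= Q) ->
    let E := ((4 * W) `^ x * (2 * M) `^ y * (2 `^ p * (2 * Q) + Q)) `^ r^-1 in
    exists (c : nat -> (Omega -> R) -> nat) (D : nat -> (Omega -> R) -> R),
      chained B0 6 (wnorm X B0 r kap) D c /\
      forall n f, B0 f -> \sum_(k < n) (2 `^ (k%:R / (alpha * r / x)) * D k f / E) `^ theta <= C.
Proof.
move=> th1 zeta0 alpha0 r1 x0 xr y0 k0 p0 e.
have r0 : 0 < r by exact: lt_le_trans r1.
have gamma0 : 0 < alpha * r / x by rewrite divr_gt0 ?mulr_gt0.
have [C C0 vh] := @convex_chaining R theta zeta (alpha * r / x) th1 zeta0 gamma0.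
exists C => // Omega m X L L0 N W M Q [N0 N00 NZ ND] Ncvx L0L [L00 L0B L0Z] W0 M0 Q0 ent B0 BM BQ E.
have BL f : B0 f -> L f by move=> [/L0L].
have B00 : B0 !=set0.
  by exists 0; split => //; rewrite (is_norm0 (L0L _ L00) (And4 N0 N00 NZ ND)) ler01.
have BM' g j : B0 g -> `|g (X j)| `^ kap <= M `^ kap.
  by move=> Bg; apply: ler_powR2l => //; exact: BM.
apply: (vh (Omega -> R) L0 N (wnorm X B0 r kap) E) => //.
- by move=> f /L0L; exact: N0.
- by move=> a f /L0L; exact: NZ.
- by move=> f g /L0L Lf /L0L Lg; exact: Ncvx.
- by move=> f _; exact: wnorm_ge0 BM' _.
- by move=> a f _; exact: wnormZ BM' _ _.
- by move=> f g _ _; exact: wnormD BM' _ _.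
- by rewrite powR_gt0 ?mulr_gt0 ?powR_gt0 ?addr_gt0 ?mulr_gt0 ?powR_gt0.
move=> k; have [l [l1 lP]] := entropy_labels W0 (ent k).
exists l; split => [f _|f g Bf Bg lfg]; first exact: l1.
have hd := lP f g (conj (BL _ Bf) Bf.2) (conj (BL _ Bg) Bg.2) lfg.
apply: (wnorm_le r1 B00 BM'); first by rewrite mulr_ge0 ?powR_ge0.
move=> u Bu.
have hM j : `|(f - g) (X j)| <= 2 * M.
  apply: le_trans (ler_normB _ _) _; have := BM f j Bf; have := BM g j Bg.
  by move: (`|f (X j)|) (`|g (X j)|); clear => *; lra.
have uM j : `|u (X j)| <= 2 * M.
  by apply: le_trans (BM u j Bu) _; rewrite ler_peMl ?(ltW M0)// ler1n.
have hH : \sum_j `|(f - g) (X j)| `^ p <= 2 `^ p * (2 * Q).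
  apply: (@le_trans _ _ (\sum_j 2 `^ p * (`|f (X j)| `^ p + `|g (X j)| `^ p))).
    apply: ler_sum => j _.
    apply: le_trans (ler_powR2l _ (ler_normB _ _) p0) _ => //.
    exact: powRD_le.
  rewrite -mulr_sumr big_split/= ler_wpM2l ?powR_ge0// mulr2n mulrDl !mul1r.
  by apply: lerD; exact: BQ.
have M20 : 0 <= 2 * M by rewrite mulr_ge0// ltW.
have x0r : 0 <= x <= r by rewrite (ltW x0).
have := mixed_wsum x0r y0 k0 p0 e M20 hd hM uM hH (BQ u Bu).
move=> /le_trans; apply.
rewrite [leRHS]powRM ?powR_ge0// /E powRVK ?gt_eqF//; last first.
  by rewrite !mulr_ge0 ?powR_ge0// addr_ge0 ?mulr_ge0 ?powR_ge0// ltW.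
rewrite powRM ?powR_ge0 ?mulr_ge0 ?(ltW W0)// -!powRrM.
have -> : - (k%:R / (alpha * r / x)) * r = - (k%:R / alpha) * x.
  by field; rewrite !gt_eqF.
by rewrite le_eqVlt; apply/orP; left; apply/eqP; ring.
Qed.

(** On the outer body only the sup-norm entropy is known: [M] and [Q] bound the weights, which range
    over [B0]. So the whole power r goes into the entropy, and its rate [beta] is unchanged. *)
Lemma sample_chaining_outer (q eta beta p r y kap : R) :
  1 <= q -> 0 < eta -> 0 < beta -> 1 <= r -> 0 <= y ->
  0 <= kap -> 0 <= p -> kap = p + y ->
  exists2 C, 0 <= C & forall (Omega : ptopologicalType) (m : nat) (X : 'I_m -> Omega)
    (L B0 : set (Omega -> R)) (N : (Omega -> R) -> R) (W M Q : R),
    linear_subspace L -> is_norm L N -> q_convex_norm L N q eta ->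
    0 < W -> 0 < M -> 0 < Q ->
    (forall k, (entropy_number (unit_ball L N) (fun f g => norm_at X (f - g)%R) k
       <= (W * 2 `^ (- (k%:R / beta)))%:E)%E) ->
    B0 !=set0 ->
    (forall f j, B0 f -> `|f (X j)| <= M) ->
    (forall f, B0 f -> \sum_j `|f (X j)| `^ p <= Q) ->
    let E := ((4 * W) `^ r * M `^ y * Q) `^ r^-1 in
    exists (c : nat -> (Omega -> R) -> nat) (D : nat -> (Omega -> R) -> R),
      chained (unit_ball L N) 6 (wnorm X B0 r kap) D c /\
      forall n f, unit_ball L N f -> \sum_(k < n) (2 `^ (k%:R / beta) * D k f / E) `^ q <= C.
Proof.
move=> q1 eta0 beta0 r1 y0 k0 p0 e.
have r0 : 0 < r by exact: lt_le_trans r1.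
have [C C0 vh] := @convex_chaining R q eta beta q1 eta0 beta0.
exists C => // Omega m X L B0 N W M Q Llin [N0 N00 NZ ND] Ncvx W0 M0 Q0 ent B00 BM BQ E.
have [_ LB LZ] := linear_rational Llin.
have BM' g j : B0 g -> `|g (X j)| `^ kap <= M `^ kap.
  by move=> Bg; apply: ler_powR2l => //; exact: BM.
apply: (vh (Omega -> R) L N (wnorm X B0 r kap) E) => //.
- by move=> f _; exact: wnorm_ge0 BM' _.
- by move=> a f _; exact: wnormZ BM' _ _.
- by move=> f g _ _; exact: wnormD BM' _ _.
- by rewrite powR_gt0 ?mulr_gt0 ?powR_gt0 ?mulr_gt0.
move=> k; have [l [l1 lP]] := entropy_labels W0 (ent k).
exists l; split => [f _|f g Bf Bg lfg]; first exact: l1.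
have hd := lP f g Bf Bg lfg.
apply: (wnorm_le r1 B00 BM'); first by rewrite mulr_ge0 ?powR_ge0.
move=> u Bu.
rewrite [leRHS]powRM ?powR_ge0// /E powRVK ?gt_eqF//; last first.
  by rewrite !mulr_ge0 ?powR_ge0// ltW.
pose del := 4 * W * 2 `^ (- (k%:R / beta)).
apply: (@le_trans _ _ (\sum_j del `^ r * M `^ y * `|u (X j)| `^ p)).
  apply: ler_sum => j _; rewrite -mulrA ler_pM ?powR_ge0//.
    by apply: ler_powR2l; rewrite ?hd ?(ltW r0).
  by rewrite e powRD_ge0// mulrC ler_wpM2r ?powR_ge0// ler_powR2l ?BM.
rewrite -mulr_sumr; apply: (@le_trans _ _ (del `^ r * M `^ y * Q)).
  by rewrite ler_wpM2l ?mulr_ge0 ?powR_ge0 ?BQ.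
rewrite /del powRM ?powR_ge0 ?mulr_ge0 ?(ltW W0)//.
by rewrite le_eqVlt; apply/orP; left; apply/eqP; ring.
Qed.

End sample_chaining.

(** * One body: chaining in a single weighted norm *)

Section sample_bounds.
Context {R : realType}.

Lemma ln2_ge_half : 2^-1 <= ln 2 :> R.
Proof.
rewrite -ler_expR lnK ?posrE//.
have h := @expR_ge1Dx R (- 2^-1); have e0 := expR_gt0 (2^-1 : R).
rewrite -[expR _]invrK -expRN invf_ple ?posrE ?expR_gt0//.
by apply: le_trans h; lra.
Qed.

(** With [up_log 2 m] = u + 1 and 2^u <= m, the bound ln 2 >= 1/2 gives u <= 2 ln m and 2 <= 4 ln m,
    whence 6. *)
Lemma dyadic_levels (m : nat) : (2 <= m)%N ->
  exists n, (m <= 2 ^ n)%N /\ n.+1%:R <= 6 * ln m%:R :> R.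
Proof.
move=> m2; exists (up_log 2 m); split; first exact: up_logP.
have [u u0] : exists u, up_log 2 m = u.+1.
  by exists (up_log 2 m).-1; rewrite prednK// up_log_gt0.
have um : (2 ^ u <= m)%N by apply: ltnW; have := @up_log_gtn 2 m isT m2; rewrite u0.
have m0 : 0 < m%:R :> R by rewrite ltr0n; lia.
have h1 : u%:R * ln 2 <= ln m%:R :> R.
  rewrite -ln_powR ler_ln ?posrE ?powR_gt0// powR_mulrn// -natrX ler_nat//.
have h2 : ln 2 <= ln m%:R :> R by rewrite ler_ln ?posrE// ler_nat.
have h3 := ln2_ge_half; rewrite u0 -!natr1.
have : u%:R * 2^-1 <= u%:R * ln 2 :> R by rewrite ler_wpM2l.
lra.
Qed.

Lemma powR_le_level (m n : nat) (t : R) : (2 <= m)%N -> n.+1%:R <= 6 * ln m%:R :> R ->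
  0 <= t <= 1 -> 1 <= n.+1%:R `^ t /\ n.+1%:R `^ t <= 6 * ln m%:R `^ t.
Proof.
move=> m2 nm /andP[t0 t1]; split.
  by have := @ler_powR2l R 1 n.+1%:R t; rewrite powR1; apply; rewrite // ler1n.
have l0 : 0 <= ln m%:R :> R by rewrite ln_ge0// ler1n; lia.
apply: le_trans (ler_powR2l _ nm t0) _ => //.
rewrite powRM// ler_wpM2r ?powR_ge0//.
by have := @ler_powR R 6 _ t 1; rewrite powRr1//; apply; lra.
Qed.

Variables (p : R).
Hypothesis p1 : 1 < p.

Definition sample_pow (Omega : Type) m (X : 'I_m -> Omega) (f : Omega -> R) j :=
  `|f (X j)| `^ p.

(** Size of a single function, needed at the start of the chain: |f|^(p (r-1)) is split between W
    and M so that it has the form of the scale [E] of the metric. *)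
Lemma sample_pow_sup (Omega : Type) m (X : 'I_m -> Omega) (f : Omega -> R) (W M Q al r : R) :
  1 <= r -> 0 <= al <= p -> 0 <= M <= W -> (forall j, `|f (X j)| <= M) ->
  \sum_j sample_pow X f j <= Q ->
  \sum_j `|sample_pow X f j| `^ r <=
    W `^ (al * (r - 1)) * M `^ ((p - al) * (r - 1)) * Q.
Proof.
move=> r1 /andP[al0 alp] /andP[M0 MW] fM fQ.
have r10 : 0 <= r - 1 by rewrite subr_ge0.
apply: (@le_trans _ _ (\sum_j W `^ (al * (r - 1)) * M `^ ((p - al) * (r - 1)) * sample_pow X f j)).
  apply: ler_sum => j _; rewrite ger0_norm ?powR_ge0//.
  have -> : r = (r - 1) + 1 by ring.
  rewrite powRD_ge0 ?powR_ge0// powRr1 ?powR_ge0// addrK ler_wpM2r ?powR_ge0//.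
  rewrite /sample_pow -powRrM.
  have -> : p * (r - 1) = al * (r - 1) + (p - al) * (r - 1) by ring.
  rewrite powRD_ge0 ?mulr_ge0 ?subr_ge0//; apply: ler_pM; rewrite ?powR_ge0//.
    by apply: ler_powR2l; rewrite ?mulr_ge0// (le_trans (fM j)).
  by apply: ler_powR2l; rewrite ?mulr_ge0 ?subr_ge0.
by rewrite -mulr_sumr ler_wpM2l ?mulr_ge0 ?powR_ge0.
Qed.

Lemma sample_pow_dist (Omega : Type) m (X : 'I_m -> Omega) (f g : Omega -> R) (r S : R) :
  1 <= r -> 0 <= S ->
  \sum_j `|(f - g) (X j)| `^ r * `|f (X j)| `^ ((p - 1) * r) <= S `^ r ->
  \sum_j `|(f - g) (X j)| `^ r * `|g (X j)| `^ ((p - 1) * r) <= S `^ r ->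
  \sum_j `|sample_pow X f j - sample_pow X g j| `^ r <= (4 * p * S) `^ r.
Proof.
move=> r1 S0 fS gS; have r0 : 0 <= r by apply: le_trans r1.
have p0 : 0 < p by exact: lt_trans p1.
have pr0 : 0 <= 2 * p by rewrite mulr_ge0// ltW.
apply: (@le_trans _ _ (\sum_j (2 * p) `^ r * (`|(f - g) (X j)| `^ r * `|f (X j)| `^ ((p - 1) * r) +
    `|(f - g) (X j)| `^ r * `|g (X j)| `^ ((p - 1) * r)))).
  apply: ler_sum => j _; rewrite -mulrDr !powRrM mulrA.
  apply: le_trans (ler_powR2l _ (abs_powR_dist _ _ p1) r0) _ => //.
  rewrite powRM ?addr_ge0 ?mulr_ge0 ?powR_ge0 ?(ltW p0)//.
  rewrite (powRM _ (ltW p0))// [(2 * p) `^ r]powRM ?(ltW p0)//.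
  rewrite -[leLHS]mulrA [2 `^ r * p `^ r]mulrC -[leRHS]mulrA -[leRHS]mulrA.
  rewrite ler_wpM2l ?powR_ge0// [leRHS]mulrCA ler_wpM2l ?powR_ge0//.
  by rewrite powRD_le ?powR_ge0.
rewrite -mulr_sumr big_split/=.
have -> : 4 * p * S = 2 * p * (2 * S) by ring.
rewrite [leRHS]powRM ?mulr_ge0 ?(ltW p0)//.
rewrite ler_wpM2l ?powR_ge0//.
rewrite powRM//; apply: (@le_trans _ _ (2 * S `^ r)).
  by rewrite mulr_natl mulr2n lerD.
rewrite ler_wpM2r ?powR_ge0//.
by have := @ler_powR R 2 _ 1 r r1; rewrite powRr1//; apply; lra.
Qed.

(** The parameters of [sample_chaining] are forced: r is conjugate to s, as in
    [rademacher_chaining]; the weight (p-1) r comes from differentiating |f|^p; x = alpha / (s - 1)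
    makes the rate alpha r / x equal to s, and x <= r because s >= alpha; y follows by homogeneity.
    Hölder's inequality over the levels, exponent 1 against theta, yields (ln m)^(1 - 1/theta). *)
Lemma sample_bound1 (theta zeta alpha : R) :
  1 <= theta -> 0 < zeta -> 0 < alpha -> alpha <= p ->
  let s := Num.max alpha 2 in
  exists2 C, 0 <= C & forall (Omega : ptopologicalType) (m : nat) (X : 'I_m -> Omega)
    (L L0 : set (Omega -> R)) (N : (Omega -> R) -> R) (W M Q : R), (2 <= m)%N ->
    is_norm L N -> q_convex_norm L N theta zeta ->
    L0 `<=` L -> rational_subspace L0 -> 0 < M -> M <= W -> 0 < Q ->
    (forall k, (entropy_number (unit_ball L N) (fun f g => norm_at X (f - g)%R) k
       <= (W * 2 `^ (- (k%:R / alpha)))%:E)%E) ->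
    let B0 := [set f | L0 f /\ N f <= 1] in
    (forall f j, B0 f -> `|f (X j)| <= M) ->
    (forall f, B0 f -> \sum_j `|f (X j)| `^ p <= Q) ->
    forall n (F : 'I_n -> Omega -> R), (forall i, B0 (F i)) ->
    rad_mean (fun e => \big[Num.max/0]_(i < n) `|rad_sum (sample_pow X (F i)) e|) <=
    C * (ln m%:R `^ (1 - theta^-1) * (W `^ alpha * M `^ (p - alpha)) `^ s^-1 * Q `^ (1 - s^-1)).
Proof.
move=> th1 zeta0 alpha0 alphap s.
have th0 : 0 < theta by exact: lt_le_trans th1.
have p0 : 0 < p by exact: lt_trans p1.
have s2 : 2 <= s by rewrite /s le_max lexx orbT.
have als : alpha <= s by rewrite /s le_max lexx.
clearbody s.
have s10 : 0 < s - 1 by lra.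
have s0 : 0 < s by lra.
pose r := s / (s - 1).
pose x := alpha / (s - 1).
pose y := (p - alpha) / (s - 1).
pose kap := (p - 1) * r.
have r1 : 1 <= r by rewrite /r ler_pdivlMr//; lra.
have r0 : 0 < r by exact: lt_le_trans r1.
have x0 : 0 < x by rewrite divr_gt0.
have xr : x <= r by rewrite ler_pM2r ?invr_gt0.
have y0 : 0 <= y by apply: divr_ge0; [rewrite subr_ge0|exact: ltW].
have k0 : 0 <= kap by apply: mulr_ge0; [rewrite subr_ge0|]; exact: ltW.
have s1n : s - 1 != 0 by rewrite gt_eqF.
have e : r - x + kap = p + y by rewrite /r /x /kap /y /r; field.
have [C C0 ch] := @sample_chaining R theta zeta alpha p r x y kap th1 zeta0 alpha0 r1 x0 xr y0 k0 (ltW p0) e.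
pose C1 := 1 + C + C `^ theta^-1.
have C10 : 0 <= C1 by rewrite /C1 addr_ge0 ?powR_ge0// addr_ge0.
pose c1 := (4 `^ x * 2 `^ y * (2 `^ p * 2 + 1)) `^ r^-1.
have c10 : 0 <= c1 by exact: powR_ge0.
exists (38 * (c1 * (1 + 4 * p * C1) * 6)).
  have ? : 0 <= 1 + 4 * p * C1.
    by apply: addr_ge0 => //; apply: mulr_ge0 => //; apply: mulr_ge0 => //; exact: ltW.
  by apply: mulr_ge0 => //; apply: mulr_ge0 => //; exact: mulr_ge0.
move=> Omega m X L L0 N W M Q m2 HN Ncvx L0L L0r M0 MW Q0 ent B0 BM BQ n F BF.
have W0 : 0 < W by exact: lt_le_trans MW.
have [c [D [cD sumD]]] := ch Omega m X L L0 N W M Q HN Ncvx L0L L0r W0 M0 Q0 ent BM BQ.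
move: sumD; set E := (_ `^ r^-1 in X in X -> _) => sumD.
have EE : E = c1 * ((W `^ alpha * M `^ (p - alpha)) `^ s^-1 * Q `^ (1 - s^-1)).
  have -> : s^-1 = (s - 1)^-1 * r^-1 by rewrite /r; field; rewrite s1n gt_eqF.
  have -> : 1 - (s - 1)^-1 * r^-1 = r^-1 by rewrite /r; field; rewrite s1n gt_eqF.
  rewrite powRrM -powRM ?powR_ge0 ?(ltW Q0)// -powRM; last 2 first.
  - by rewrite !mulr_ge0 ?powR_ge0// addr_ge0 ?mulr_ge0 ?powR_ge0.
  - by rewrite mulr_ge0 ?powR_ge0// ltW.
  rewrite /E; congr (_ `^ _).
  rewrite powRM ?(ltW W0)// powRM ?(ltW M0)// powRM ?powR_ge0// -!powRrM -/x -/y.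
  by ring.
have B00 : B0 !=set0.
  have [L00 _ _] := L0r.
  by exists 0; split => //; rewrite (is_norm0 (L0L _ L00) HN) ler01.
have BMk g j : B0 g -> `|g (X j)| `^ kap <= M `^ kap.
  by move=> Bg; apply: ler_powR2l => //; exact: BM.
have E0 : 0 < E.
  by rewrite powR_gt0 ?mulr_gt0 ?powR_gt0 ?addr_gt0 ?mulr_gt0 ?powR_gt0.
have [K [mK KN]] := dyadic_levels m2.
have [cn cc D0 Dle] := cD.
pose t := 1 - theta^-1.
have t01 : 0 <= t <= 1.
  by rewrite /t subr_ge0 invf_le1// th1/= gerBl invr_ge0 ltW.
have [K1 K6] := powR_le_level m2 KN t01.
(* The summand 1 makes [G] at least [E], the size of single functions; the second summand bounds the
   sum over the levels. *)
pose G := E * (1 + 4 * p * C1) * K.+1%:R `^ t.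
have p40 : 0 <= 4 * p by rewrite mulr_ge0// ltW.
have EG : E <= G.
  rewrite /G -mulrA -[leLHS]mulr1 ler_wpM2l ?(ltW E0)//.
  apply: le_trans (_ : 1 * 1 <= _); first by rewrite mulr1.
  by apply: ler_pM => //; rewrite lerDl mulr_ge0.
have G0 : 0 <= G by apply: le_trans EG; exact: ltW.
have := @rademacher_chaining R s 6 m K _ B0 (sample_pow X) c (fun k f => 4 * p * D k f) G s2.
rewrite -/r => /(_ cn).
move=> /(_ _ _ _ _ G0 mK _ n F BF)/le_trans; apply.
- by move=> k f g Bf Bg cfg; rewrite (cc k f g).
- by move=> k f Bf; rewrite mulr_ge0 ?D0.
- move=> k f g Bf Bg cfg.
  have fgD := Dle k f g Bf Bg cfg.
  apply: sample_pow_dist => //; first exact: D0.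
  + have := wsum_le r1 B00 BMk (f - g) Bf; rewrite /wsum => /le_trans; apply.
    by apply: ler_powR2l; rewrite ?(ltW r0)//; exact: wnorm_ge0 BMk _.
  + have := wsum_le r1 B00 BMk (f - g) Bg; rewrite /wsum => /le_trans; apply.
    by apply: ler_powR2l; rewrite ?(ltW r0)//; exact: wnorm_ge0 BMk _.
- move=> f Bf; have al0p : 0 <= alpha <= p by rewrite (ltW alpha0).
  have M0W : 0 <= M <= W by rewrite (ltW M0).
  apply: le_trans (sample_pow_sup r1 al0p M0W (fun j => BM f j Bf) (BQ f Bf)) _.
  apply: le_trans (_ : E `^ r <= _); last by apply: ler_powR2l; rewrite ?(ltW r0)// ltW.
  rewrite powRVK ?gt_eqF//; last first.
    by rewrite !mulr_ge0 ?powR_ge0// addr_ge0 ?mulr_ge0 ?powR_ge0// ltW.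
  have -> : r - 1 = (s - 1)^-1 by rewrite /r; field.
  rewrite -/x -/y; apply: ler_pM; rewrite ?mulr_ge0 ?powR_ge0 ?(ltW Q0)//.
    apply: ler_pM; rewrite ?powR_ge0//; apply: ler_powR2l; rewrite ?(ltW W0) ?(ltW M0) ?(ltW x0)//.
      by rewrite ler_peMl ?(ltW W0)// ler1n.
    by rewrite ler_peMl ?(ltW M0)// ler1n.
  by rewrite lerDr mulr_ge0 ?powR_ge0// mulr_ge0// ltW.
- move=> f Bf.
  have sE : alpha * r / x = s by rewrite /r /x; field; rewrite s1n gt_eqF.
  have := sumD K.+1 f Bf; rewrite sE => sumDf.
  pose z k := 2 `^ (k%:R / s) * D k f / E.
  have z0 k : 0 <= z k by rewrite divr_ge0 ?(ltW E0)// mulr_ge0 ?powR_ge0 ?D0.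
  have := @sum_powR_le R nat (index_iota 0 K.+1) z K.+1 1 theta C ltr01 th0 C0 isT.
  rewrite size_iota subn0 leqnn => /(_ isT z0).
  rewrite !big_mkord => /(_ sumDf); rewrite div1r -/C1.
  have -> : Num.max (1 - theta^-1) 0 = t by apply/max_idPl; case/andP: t01.
  move=> h; have -> : \sum_(k < K.+1) 2 `^ (k%:R / s) * (4 * p * D k f) =
      4 * p * E * \sum_(i < K.+1) z i `^ 1.
    rewrite mulr_sumr; apply: eq_bigr => k _; rewrite powRr1// /z.
    by field; rewrite gt_eqF.
  apply: le_trans (ler_wpM2l _ h) _; first by rewrite mulr_ge0 ?(ltW E0).
  have -> : 4 * p * E * (C1 * K.+1%:R `^ t) = E * K.+1%:R `^ t * (4 * p * C1) by ring.
  have -> : G = E * K.+1%:R `^ t * (1 + 4 * p * C1) by rewrite /G; ring.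
  by rewrite ler_wpM2l ?lerDr// mulr_ge0 ?powR_ge0// ltW.
have -> : (3 * 6 + 20)%:R = 38 :> R by [].
rewrite -!mulrA ler_pM2l// /G EE.
set Y := W `^ alpha * _; set Z := Q `^ _.
have YZ : 0 <= c1 * (Y `^ s^-1 * Z) * (1 + 4 * p * C1).
  by rewrite -EE mulr_ge0 ?(ltW E0)// addr_ge0// mulr_ge0.
apply: le_trans (ler_wpM2l YZ K6) _.
by rewrite le_eqVlt; apply/orP; left; apply/eqP; rewrite /t; ring.
Qed.

End sample_bounds.

(** * Two bodies: common refinement of two chainings *)

Section two_bodies.
Context {R : realType}.
Variable p : R.
Hypothesis p1 : 1 < p.

Let p0 : 0 < p. Proof. exact: lt_trans p1. Qed.

(** The metric is the plain l_(p r) norm, with rate p beta, so that the p-th powers of its diameters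
    have rate beta. Summing p-th powers of a sequence in l_theta costs only the power max(1 -
    p/theta, 0) of the number of levels: this is the improved logarithm of the second and third
    bounds. *)
Lemma sample_chaining_pow (theta zeta alpha beta : R) :
  1 <= theta -> 0 < zeta -> 0 < alpha -> alpha <= p -> 2 <= beta ->
  let r := beta / (beta - 1) in
  exists2 Cc : R * R, 0 <= Cc.1 /\ 0 < Cc.2 &
  forall (Omega : ptopologicalType) (m : nat) (X : 'I_m -> Omega)
    (L L0 : set (Omega -> R)) (N : (Omega -> R) -> R) (W M Q : R),
    is_norm L N -> q_convex_norm L N theta zeta ->
    L0 `<=` L -> rational_subspace L0 -> 0 < M -> M <= W -> 0 < Q ->
    (forall k, (entropy_number (unit_ball L N) (fun f g => norm_at X (f - g)%R) k
       <= (W * 2 `^ (- (k%:R / alpha)))%:E)%E) ->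
    let B0 := [set f | L0 f /\ N f <= 1] in
    (forall f j, B0 f -> `|f (X j)| <= M) ->
    (forall f, B0 f -> \sum_j `|f (X j)| `^ p <= Q) ->
    exists (E : R) (c : nat -> (Omega -> R) -> nat) (D : nat -> (Omega -> R) -> R),
    [/\ 0 < E,
        E `^ p = Cc.2 * ((W `^ alpha * M `^ (p - alpha)) `^ beta^-1 * Q `^ (1 - beta^-1)),
        chained B0 6 (wnorm X B0 (p * r) 0) D c,
        forall n f, B0 f -> \sum_(k < n) (2 `^ (k%:R / (p * beta)) * D k f / E) `^ theta <= Cc.1 &
        forall f, B0 f -> \sum_j `|sample_pow p X f j| `^ r <= (E `^ p) `^ r].
Proof.
move=> th1 zeta0 alpha0 alphap b2 r.
have th0 : 0 < theta by exact: lt_le_trans th1.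
have b10 : 0 < beta - 1 by lra.
have b0 : 0 < beta by lra.
have b1n : beta - 1 != 0 by rewrite gt_eqF.
pose x := alpha / (beta - 1).
pose y := (p - alpha) / (beta - 1).
have r1 : 1 <= r by rewrite /r ler_pdivlMr//; lra.
have r0 : 0 < r by exact: lt_le_trans r1.
have pr1 : 1 <= p * r by rewrite -[1]mulr1; apply: ler_pM => //; exact: ltW.
have pr0 : 0 < p * r by exact: mulr_gt0.
have x0 : 0 < x by rewrite divr_gt0.
have xpr : x <= p * r.
  rewrite /r mulrA ler_pM2r ?invr_gt0//; apply: le_trans alphap _.
  by rewrite ler_peMr ?(ltW p0)//; lra.
have y0 : 0 <= y by apply: divr_ge0; [rewrite subr_ge0|exact: ltW].
have e : p * r - x + 0 = p + y by rewrite /r /x /y; field.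
have [C C0 ch] := @sample_chaining R theta zeta alpha p (p * r) x y 0 th1 zeta0 alpha0 pr1 x0 xpr y0 (lexx 0) (ltW p0) e.
pose c1 := (4 `^ x * 2 `^ y * (2 `^ p * 2 + 1)) `^ r^-1.
have c10 : 0 < c1.
  by rewrite powR_gt0// mulr_gt0 ?addr_gt0 ?mulr_gt0 ?powR_gt0.
exists (C, c1) => // Omega m X L L0 N W M Q HN Ncvx L0L L0r M0 MW Q0 ent B0 BM BQ.
have W0 : 0 < W by exact: lt_le_trans MW.
have [c [D [cD sumD]]] := ch Omega m X L L0 N W M Q HN Ncvx L0L L0r W0 M0 Q0 ent BM BQ.
move: sumD; set E0 := ((4 * W) `^ x * _ * _); set E := (E0 `^ _) => sumD.
have E00 : 0 < E0 by rewrite /E0 !mulr_gt0 ?powR_gt0 ?addr_gt0 ?mulr_gt0 ?powR_gt0.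
have Ep : E `^ p = E0 `^ r^-1.
  by rewrite /E -powRrM; congr (_ `^ _); field; rewrite !gt_eqF.
have rE : r - 1 = (beta - 1)^-1 by rewrite /r; field.
exists E, c, D; split.
- by rewrite powR_gt0.
- rewrite Ep /=.
  have -> : beta^-1 = (beta - 1)^-1 * r^-1 by rewrite /r; field; rewrite b1n gt_eqF.
  have -> : 1 - (beta - 1)^-1 * r^-1 = r^-1 by rewrite /r; field; rewrite b1n gt_eqF.
  rewrite powRrM -powRM ?powR_ge0 ?(ltW Q0)// -powRM; last 2 first.
  - by rewrite !mulr_ge0 ?powR_ge0// addr_ge0 ?mulr_ge0 ?powR_ge0.
  - by rewrite mulr_ge0 ?powR_ge0// ltW.
  congr (_ `^ _).
  rewrite /E0 powRM ?(ltW W0)// powRM ?(ltW M0)// powRM ?powR_ge0// -!powRrM -/x -/y.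
  by ring.
- exact: cD.
- move=> n f Bf; have := sumD n f Bf.
  have -> : alpha * (p * r) / x = p * beta; last by [].
  by rewrite /r /x; field; rewrite b1n gt_eqF.
- move=> f Bf; have al0p : 0 <= alpha <= p by rewrite (ltW alpha0).
  have M0W : 0 <= M <= W by rewrite (ltW M0).
  apply: le_trans (sample_pow_sup r1 al0p M0W (fun j => BM f j Bf) (BQ f Bf)) _.
  rewrite Ep powRVK ?gt_eqF ?(ltW E00)// rE -/x -/y /E0.
  apply: ler_pM; rewrite ?mulr_ge0 ?powR_ge0 ?(ltW Q0)//.
    apply: ler_pM; rewrite ?powR_ge0//; apply: ler_powR2l; rewrite ?(ltW W0) ?(ltW M0) ?(ltW x0)//.
      by rewrite ler_peMl ?(ltW W0)// ler1n.
    by rewrite ler_peMl ?(ltW M0)// ler1n.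
  by rewrite lerDr mulr_ge0 ?powR_ge0// mulr_ge0// ltW.
Qed.

Lemma pow_chain_sum (theta beta C E : R) (K : nat) (D : nat -> R) :
  0 < theta -> 0 < beta -> 0 < E -> 0 <= C -> (forall k, 0 <= D k) ->
  \sum_(k < K.+1) (2 `^ (k%:R / (p * beta)) * D k / E) `^ theta <= C ->
  \sum_(k < K.+1) 2 `^ (k%:R / beta) * D k `^ p <=
    E `^ p * ((1 + C + C `^ (p / theta)) * K.+1%:R `^ Num.max (1 - p / theta) 0).
Proof.
move=> th0 b0 E0 C0 D0 h.
pose z k := 2 `^ (k%:R / (p * beta)) * D k / E.
have z0 k : 0 <= z k by rewrite divr_ge0 ?(ltW E0)// mulr_ge0 ?powR_ge0 ?D0.
have := @sum_powR_le R nat (index_iota 0 K.+1) z K.+1 p theta C p0 th0 C0 isT.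
rewrite size_iota subn0 leqnn => /(_ isT z0); rewrite !big_mkord => /(_ h) {}h.
apply: le_trans (ler_wpM2l (powR_ge0 E p) h).
rewrite mulr_sumr le_eqVlt; apply/orP; left; apply/eqP; apply: eq_bigr => k _.
rewrite -powRM ?(ltW E0)//.
have -> : E * z k = 2 `^ (k%:R / (p * beta)) * D k by rewrite /z; field; rewrite gt_eqF.
rewrite powRM ?powR_ge0// -powRrM.
by congr (_ `^ _ * _); field; rewrite !gt_eqF.
Qed.

(** Only the weight at one of the points is used: |g| <= |f| + |f - g| trades the other one for the
    term |f - g|^p. That term is measured in the l_(p r) norm by the chaining of the inner body, the
    weighted one by a separate chaining. *)
Lemma sample_pow_dist2 (Omega : Type) m (X : 'I_m -> Omega) (f g : Omega -> R) (r S1 S2 : R) :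
  1 <= r -> 0 <= S1 -> 0 <= S2 ->
  \sum_j `|(f - g) (X j)| `^ (p * r) <= S1 `^ (p * r) ->
  \sum_j `|(f - g) (X j)| `^ r * `|f (X j)| `^ ((p - 1) * r) <= S2 `^ r ->
  \sum_j `|sample_pow p X f j - sample_pow p X g j| `^ r <=
    (p * (2 * 2 `^ p) * (S1 `^ p + S2)) `^ r.
Proof.
move=> r1 S10 S20 h1 h2; have r0 : 0 <= r by apply: le_trans r1.
have pm1 : 0 <= p - 1 by rewrite subr_ge0 ltW.
have c0 : 0 <= p * 2 `^ p by rewrite mulr_ge0 ?powR_ge0// ltW.
have key j : `|sample_pow p X f j - sample_pow p X g j| <=
    p * 2 `^ p * (`|(f - g) (X j)| `^ p + `|(f - g) (X j)| * `|f (X j)| `^ (p - 1)).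
  apply: le_trans (abs_powR_dist _ _ p1) _.
  rewrite -!mulrA ler_wpM2l ?(ltW p0)//.
  have hE : (f - g) (X j) = f (X j) - g (X j) by [].
  rewrite hE; set h := `|f (X j) - g (X j)|; set a := `|f (X j)|; set b := `|g (X j)|.
  have h0 : 0 <= h by exact: normr_ge0.
  have a0 : 0 <= a by exact: normr_ge0.
  have b0 : 0 <= b by exact: normr_ge0.
  have bah : b <= a + h.
    by have := ler_normB (f (X j)) (f (X j) - g (X j)); rewrite subKr.
  have hp : h * h `^ (p - 1) = h `^ p by rewrite mulr_powRB1.
  have h3 : b `^ (p - 1) <= 2 `^ (p - 1) * (a `^ (p - 1) + h `^ (p - 1)).
    apply: le_trans (ler_powR2l b0 bah pm1) _; exact: powRD_le.
  have e2 : 2 `^ p = 2 * 2 `^ (p - 1) :> R by rewrite mulr_powRB1.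
  have t1 : 1 <= 2 `^ (p - 1) :> R.
    by have := @ler_powR R 2 _ 0 (p - 1) pm1; rewrite powRr0; apply; lra.
  apply: (@le_trans _ _ (h * (2 `^ p * (a `^ (p - 1) + h `^ (p - 1))))).
    rewrite ler_wpM2l//.
    have := powR_ge0 a (p - 1); have := powR_ge0 h (p - 1).
    move: h3 t1; rewrite e2; clear.
    move: (b `^ _) (a `^ _) (h `^ _) (2 `^ _) => B A H T h3 t1 H0 A0.
    by nra.
  by rewrite -hp le_eqVlt; apply/orP; left; apply/eqP; ring.
apply: (@le_trans _ _ (\sum_j (p * 2 `^ p) `^ r * (2 `^ r * (`|(f - g) (X j)| `^ (p * r) +
    `|(f - g) (X j)| `^ r * `|f (X j)| `^ ((p - 1) * r))))).
  apply: ler_sum => j _.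
  apply: le_trans (ler_powR2l _ (key j) r0) _ => //.
  rewrite [leLHS]powRM ?addr_ge0 ?mulr_ge0 ?powR_ge0//; last by rewrite ltW.
  rewrite ler_wpM2l ?powR_ge0//.
  apply: le_trans (powRD_le _ _ r0) _; rewrite ?mulr_ge0 ?powR_ge0//.
  by rewrite -powRrM [in leLHS]powRM ?powR_ge0// -powRrM.
rewrite -!mulr_sumr big_split/=.
have -> : p * (2 * 2 `^ p) * (S1 `^ p + S2) = (p * 2 `^ p) * (2 * (S1 `^ p + S2)) by ring.
rewrite [leRHS]powRM ?mulr_ge0 ?addr_ge0 ?powR_ge0 ?(ltW p0)// ler_wpM2l ?powR_ge0//.
rewrite [leRHS]powRM ?addr_ge0 ?powR_ge0// ler_wpM2l ?powR_ge0//.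
apply: le_trans (powRD_ge _ _ r1); rewrite ?powR_ge0//.
by rewrite -powRrM lerD.
Qed.

(** The common refinement multiplies the numbers of cells, hence the budget 6 + A, and the diameters
    add. The second chaining is given by its properties only, as it comes from a convex body in one
    case and from ellipsoids depending on f in the other. *)
Lemma two_chain_bound (beta : R) (A : nat) (Omega : Type) (m K : nat) (X : 'I_m -> Omega)
    (B0 : set (Omega -> R)) (c1 c2 : nat -> (Omega -> R) -> nat)
    (D1 D2 : nat -> (Omega -> R) -> R) (G1 G2 M : R) :
  2 <= beta -> let r := beta / (beta - 1) in
  (forall g j, B0 g -> `|g (X j)| <= M) ->
  chained B0 6 (wnorm X B0 (p * r) 0) D1 c1 ->
  nested_labels B0 A c2 -> label_constant B0 c2 D2 -> (forall k f, B0 f -> 0 <= D2 k f) ->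
  (forall k f g, B0 f -> B0 g -> c2 k f = c2 k g ->
    \sum_j `|(f - g) (X j)| `^ r * `|f (X j)| `^ ((p - 1) * r) <= D2 k f `^ r) ->
  0 <= G1 -> 0 <= G2 -> (m <= 2 ^ K)%N ->
  (forall f, B0 f -> \sum_j `|sample_pow p X f j| `^ r <= G1 `^ r) ->
  (forall f, B0 f -> \sum_(k < K.+1) 2 `^ (k%:R / beta) * D1 k f `^ p <= G1) ->
  (forall f, B0 f -> \sum_(k < K.+1) 2 `^ (k%:R / beta) * D2 k f <= G2) ->
  forall n (F : 'I_n -> Omega -> R), (forall i, B0 (F i)) ->
    rad_mean (fun e => \big[Num.max/0]_(i < n) `|rad_sum (sample_pow p X (F i)) e|) <=
    (3 * (6 + A) + 20)%:R * (p * (2 * 2 `^ p) * (G1 + G2)).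
Proof.
move=> b2 r BM [[c1A c1n] c1c D10 D1le] [c2A c2n] c2c D20 D2le G10 G20 mK aG sG1 sG2 n F BF.
have r1 : 1 <= r by rewrite /r ler_pdivlMr; lra.
have r0 : 0 < r by exact: lt_le_trans r1.
have pr1 : 1 <= p * r by rewrite -[1]mulr1; apply: ler_pM => //; exact: ltW.
have pr0 : 0 < p * r by exact: mulr_gt0.
case: n F BF => [F _|n F BF].
  rewrite (_ : (fun _ => _) = fun=> 0); last by apply/funext => e; rewrite big_ord0.
  rewrite rad_mean_cst; apply: mulr_ge0 => //; apply: mulr_ge0; last exact: addr_ge0.
  by apply: mulr_ge0; [exact: ltW|apply: mulr_ge0 => //; exact: powR_ge0].
have B00 : B0 !=set0 by exists (F ord0).
have BM0 g j : B0 g -> `|g (X j)| `^ 0 <= 1 by rewrite powRr0.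
pose cst := p * (2 * 2 `^ p).
have cst1 : 1 <= cst.
  apply: mulr_ege1; [exact: ltW|apply: mulr_ege1; rewrite ?ler1n//].
  have := @ler_powR R 2 _ 0 p (ltW p0); rewrite powRr0; apply; exact: ler1n.
have cst0 : 0 <= cst by apply: le_trans cst1.
pose c k f := (c1 k f * 2 ^ (A * 2 ^ k) + c2 k f)%N.
have cE k f g : B0 f -> B0 g -> c k f = c k g -> c1 k f = c1 k g /\ c2 k f = c2 k g.
  by move=> Bf Bg; apply: mulnD_inj; exact: c2A.
apply: (@rademacher_chaining R beta (6 + A) m K _ B0 (sample_pow p X) c
  (fun k f => cst * (D1 k f `^ p + D2 k f)) (cst * (G1 + G2)) b2).
- split=> [k f Bf|k f g Bf Bg cfg].
    by rewrite mulnDl expnD; apply: mulnD_lt; [exact: c1A|exact: c2A].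
  have [h1 h2] := cE _ _ _ Bf Bg cfg.
  by rewrite /c (c1n k f g)// (c2n k f g).
- by move=> k f g Bf Bg /(cE _ _ _ Bf Bg)[h1 h2]; rewrite (c1c k f g)// (c2c k f g).
- by move=> k f Bf; rewrite mulr_ge0// addr_ge0 ?powR_ge0 ?D20.
- move=> k f g Bf Bg /(cE _ _ _ Bf Bg)[h1 h2].
  apply: sample_pow_dist2; rewrite ?D10 ?D20 ?D2le//.
  have := wsum_le pr1 B00 BM0 (f - g) Bf; rewrite /wsum.
  under eq_bigr do rewrite powRr0 mulr1.
  move=> /le_trans; apply; apply: ler_powR2l; rewrite ?(ltW pr0) ?D1le//.
  exact: wnorm_ge0 BM0 _.
- move=> f Bf; apply: le_trans (aG f Bf) _; apply: ler_powR2l; rewrite ?(ltW r0)//.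
  by rewrite -[leLHS]mul1r ler_pM ?lerDl.
- by rewrite mulr_ge0 ?addr_ge0.
- exact: mK.
- move=> f Bf.
  have -> : \sum_(k < K.+1) 2 `^ (k%:R / beta) * (cst * (D1 k f `^ p + D2 k f)) =
      cst * (\sum_(k < K.+1) 2 `^ (k%:R / beta) * D1 k f `^ p + \sum_(k < K.+1) 2 `^ (k%:R / beta) * D2 k f).
    by rewrite -big_split/= mulr_sumr; apply: eq_bigr => k _; ring.
  by rewrite ler_wpM2l// lerD ?sG1 ?sG2.
- exact: BF.
Qed.

End two_bodies.

Section sample_bound2.
Context {R : realType}.
Variable p : R.
Hypothesis p1 : 1 < p.

Let p0 : 0 < p. Proof. exact: lt_trans p1. Qed.

Lemma max_sub_div01 (theta : R) : 0 < theta -> 0 <= Num.max (1 - p / theta) 0 <= 1.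
Proof.
move=> th0; rewrite le_max lexx orbT/= ge_max ler01 andbT gerBl.
by rewrite divr_ge0// ltW.
Qed.

Lemma level_sum_le (m K : nat) (t C Z : R) : (2 <= m)%N -> K.+1%:R <= 6 * ln m%:R :> R ->
  0 <= t <= 1 -> 0 <= C -> 0 <= Z ->
  Z <= Z * ((1 + C) * K.+1%:R `^ t) /\
  Z * (C * K.+1%:R `^ t) <= Z * ((1 + C) * K.+1%:R `^ t) /\
  Z * ((1 + C) * K.+1%:R `^ t) <= 6 * (1 + C) * (ln m%:R `^ t * Z).
Proof.
move=> m2 KN t01 C0 Z0; have [K1 K6] := powR_le_level m2 KN t01.
split; last split.
- by rewrite ler_peMr// mulr_ege1// lerDl.
- by rewrite ler_wpM2l// ler_wpM2r ?powR_ge0// lerDr.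
- have -> : 6 * (1 + C) * (ln m%:R `^ t * Z) = Z * ((1 + C) * (6 * ln m%:R `^ t)) by ring.
  by rewrite ler_wpM2l// ler_wpM2l// addr_ge0.
Qed.

(** The weighted term is estimated through the entropy of the outer body alone; the exponent y = (p
    - beta)/(beta - 1) is nonnegative by beta <= p. The labels of the outer chaining are restricted
    to [B0], over which the weights range. *)
Lemma sample_bound2 (theta zeta alpha q eta beta : R) :
  1 <= theta -> 0 < zeta -> 0 < alpha -> alpha <= p -> 1 <= q -> 0 < eta ->
  2 <= beta -> beta <= p ->
  exists2 C, 0 <= C & forall (Omega : ptopologicalType) (m : nat) (X : 'I_m -> Omega)
    (L L0 : set (Omega -> R)) (N ND : (Omega -> R) -> R) (W WD M Q : R), (2 <= m)%N ->
    is_norm L N -> q_convex_norm L N theta zeta ->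
    linear_subspace L -> is_norm L ND -> q_convex_norm L ND q eta ->
    unit_ball L N `<=` unit_ball L ND ->
    L0 `<=` L -> rational_subspace L0 -> 0 < M -> M <= W -> M <= WD -> 0 < Q ->
    (forall k, (entropy_number (unit_ball L N) (fun f g => norm_at X (f - g)%R) k
       <= (W * 2 `^ (- (k%:R / alpha)))%:E)%E) ->
    (forall k, (entropy_number (unit_ball L ND) (fun f g => norm_at X (f - g)%R) k
       <= (WD * 2 `^ (- (k%:R / beta)))%:E)%E) ->
    let B0 := [set f | L0 f /\ N f <= 1] in
    (forall f j, B0 f -> `|f (X j)| <= M) ->
    (forall f, B0 f -> \sum_j `|f (X j)| `^ p <= Q) ->
    forall n (F : 'I_n -> Omega -> R), (forall i, B0 (F i)) ->
    rad_mean (fun e => \big[Num.max/0]_(i < n) `|rad_sum (sample_pow p X (F i)) e|) <=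
    C * ((ln m%:R `^ Num.max (1 - p / theta) 0 * (W `^ alpha * M `^ (p - alpha)) `^ beta^-1 +
          ln m%:R `^ (1 - q^-1) * (WD `^ beta * M `^ (p - beta)) `^ beta^-1)
         * Q `^ (1 - beta^-1)).
Proof.
move=> th1 zeta0 alpha0 alphap q1 eta0 b2 bp.
have th0 : 0 < theta by exact: lt_le_trans th1.
have q0 : 0 < q by exact: lt_le_trans q1.
have b10 : 0 < beta - 1 by lra.
have b0 : 0 < beta by lra.
have b1n : beta - 1 != 0 by rewrite gt_eqF.
pose r := beta / (beta - 1).
have r1 : 1 <= r by rewrite /r ler_pdivlMr//; lra.
have r0 : 0 < r by exact: lt_le_trans r1.
have pm1 : 0 <= p - 1 by rewrite subr_ge0 ltW.
pose y := (p - beta) / (beta - 1).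
have y0 : 0 <= y by apply: divr_ge0; [rewrite subr_ge0|exact: ltW].
have kap0 : 0 <= (p - 1) * r by apply: mulr_ge0 => //; exact: ltW.
have e : (p - 1) * r = p + y by rewrite /r /y; field.
have [[C c1] /= [C0 c10] ch] := sample_chaining_pow p1 th1 zeta0 alpha0 alphap b2.
have [C' C'0 ch'] := @sample_chaining_outer R q eta beta p r y ((p - 1) * r) q1 eta0 b0 r1 y0 kap0 (ltW p0) e.
pose C1 := 1 + C + C `^ (p / theta).
pose C2 := 1 + C' + C' `^ (1 / q).
have C10 : 0 <= C1 by rewrite /C1 addr_ge0 ?powR_ge0// addr_ge0.
have C20 : 0 <= C2 by rewrite /C2 addr_ge0 ?powR_ge0// addr_ge0.
pose cc := (3 * (6 + 6) + 20)%:R * (p * (2 * 2 `^ p)) : R.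
have cc0 : 0 <= cc.
  by apply: mulr_ge0 => //; apply: mulr_ge0; [exact: ltW|apply: mulr_ge0 => //; exact: powR_ge0].
pose a1 := 6 * (1 + C1) * c1.
pose a2 := 6 * (1 + C2) * 4.
have a10 : 0 <= a1 by apply: mulr_ge0; [apply: mulr_ge0 => //; exact: addr_ge0|exact: ltW].
have a20 : 0 <= a2 by apply: mulr_ge0 => //; apply: mulr_ge0 => //; exact: addr_ge0.
exists (cc * (a1 + a2)); first by apply: mulr_ge0 => //; exact: addr_ge0.
move=> Omega m X L L0 N ND W WD M Q m2 HN Ncvx Llin HND NDcvx BD L0L L0r M0 MW MWD Q0 ent entD BM BQ n F BF.
pose B0 := [set f | L0 f /\ N f <= 1].
have {}BM : forall f j, B0 f -> `|f (X j)| <= M by exact: BM.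
have {}BQ : forall f, B0 f -> \sum_j `|f (X j)| `^ p <= Q by exact: BQ.
have {}BF : forall i, B0 (F i) by exact: BF.
have W0 : 0 < W by exact: lt_le_trans MW.
have WD0 : 0 < WD by exact: lt_le_trans MWD.
have B00 : B0 !=set0.
  have [L00 _ _] := L0r.
  by exists 0; split => //; rewrite (is_norm0 (L0L _ L00) HN) ler01.
have B0D : B0 `<=` unit_ball L ND by move=> f [/L0L Lf Nf]; apply: BD.
have [E [c [D [E0 Ep cD sumD supD]]]] := ch Omega m X L L0 N W M Q HN Ncvx L0L L0r M0 MW Q0 ent BM BQ.
have [c' [D' [[[c'A c'n] c'c D'0 D'le] sumD']]] :=
  ch' Omega m X L B0 ND WD M Q Llin HND NDcvx WD0 M0 Q0 entD B00 BM BQ.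
move: sumD'; set E' := (_ `^ r^-1) => sumD'.
have E'0 : 0 < E' by rewrite powR_gt0 ?mulr_gt0 ?powR_gt0 ?mulr_gt0.
have E'E : E' = 4 * ((WD `^ beta * M `^ (p - beta)) `^ beta^-1 * Q `^ (1 - beta^-1)).
  rewrite /E' -[X in X^-1]/r.
  have -> : 1 - beta^-1 = r^-1 by rewrite /r; field; rewrite b1n gt_eqF.
  rewrite powRM ?mulr_ge0 ?powR_ge0 ?(ltW Q0)// mulrA; congr (_ * _).
  rewrite powRM ?powR_ge0// powRK ?mulr_ge0 ?(ltW WD0) ?gt_eqF//.
  rewrite [in RHS]powRM ?powR_ge0// powRK ?(ltW WD0) ?gt_eqF// mulrA; congr (_ * _).
  by rewrite -!powRrM; congr (_ `^ _); rewrite /y /r; field; rewrite b1n gt_eqF.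
have [K [mK KN]] := @dyadic_levels R m m2.
have t1 := max_sub_div01 th0; set tt1 := Num.max _ _ in t1 *.
have t2 : 0 <= 1 - q^-1 <= 1.
  by rewrite subr_ge0 invf_le1// q1/= gerBl invr_ge0 ltW.
have [h1 [h2 h3]] := level_sum_le m2 KN t1 C10 (powR_ge0 E p).
have [h1' [h2' h3']] := level_sum_le m2 KN t2 C20 (ltW E'0).
set G1 := E `^ p * _ in h1 h2 h3; set G2 := E' * _ in h1' h2' h3'.
have BMk g j : B0 g -> `|g (X j)| `^ ((p - 1) * r) <= M `^ ((p - 1) * r).
  by move=> Bg; apply: ler_powR2l => //; exact: BM.
have G10 : 0 <= G1 by apply: le_trans h1; exact: powR_ge0.
have G20 : 0 <= G2 by apply: le_trans h1'; exact: ltW.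
have := @two_chain_bound R p p1 beta 6 Omega m K X B0 c c' D D' G1 G2 M b2 BM cD.
move=> /(_ _ _ _ _ G10 G20 mK _ _ _ n F BF)/le_trans; apply.
- by split=> [k f /B0D|k f g /B0D Bf /B0D]; [exact: c'A|exact: c'n].
- by move=> k f g /B0D Bf /B0D Bg; exact: c'c.
- by move=> k f /B0D; exact: D'0.
- move=> k f g Bf Bg cfg.
  have := wsum_le r1 B00 BMk (f - g) Bf; rewrite /wsum => /le_trans; apply.
  apply: ler_powR2l; rewrite ?(ltW r0)//; first exact: wnorm_ge0 BMk _.
  by apply: D'le => //; exact: B0D.
- move=> f Bf; apply: le_trans (supD f Bf) _.
  by apply: ler_powR2l; rewrite ?powR_ge0 ?(ltW r0).
- move=> f Bf; apply: le_trans h2; apply: (@pow_chain_sum R p p1 theta beta C E K (fun k => D k f) th0 b0 E0 C0).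
  + by move=> k; apply: (chained_ge0 cD).
  + exact: sumD.
- move=> f Bf; apply: le_trans h2'.
  pose z k := 2 `^ (k%:R / beta) * D' k f / E'.
  have z0 k : 0 <= z k by rewrite divr_ge0 ?(ltW E'0)// mulr_ge0 ?powR_ge0 ?D'0//; exact: B0D.
  (* Hölder's inequality with exponent 1 against q: the levels of the outer chaining cost (ln m)^(1
     - 1/q). *)
  have := @sum_powR_le R nat (index_iota 0 K.+1) z K.+1 1 q C' ltr01 q0 C'0 isT.
  rewrite size_iota subn0 leqnn => /(_ isT z0).
  rewrite !big_mkord => /(_ (sumD' K.+1 f (B0D _ Bf))).
  have -> : Num.max (1 - 1 / q) 0 = 1 - q^-1.
    by rewrite div1r; apply/max_idPl; case/andP: t2.
  rewrite -/C2 => h; apply: le_trans (ler_wpM2l (ltW E'0) h).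
  rewrite mulr_sumr le_eqVlt; apply/orP; left; apply/eqP; apply: eq_bigr => k _.
  by rewrite powRr1// /z; field; rewrite gt_eqF.
have -> : (3 * (6 + 6) + 20)%:R * (p * (2 * 2 `^ p) * (G1 + G2)) = cc * (G1 + G2) by rewrite mulrA.
rewrite -[leRHS]mulrA ler_wpM2l//.
apply: le_trans (lerD h3 h3') _.
rewrite Ep E'E; set Y1 := _ `^ beta^-1; set Y2 := (_ `^ beta^-1); set Z := Q `^ _.
set l1 := ln _ `^ _; set l2 := ln _ `^ _.
have Y10 : 0 <= l1 * Y1 * Z by rewrite !mulr_ge0 ?powR_ge0.
have Y20 : 0 <= l2 * Y2 * Z by rewrite !mulr_ge0 ?powR_ge0.
have -> : 6 * (1 + C1) * (l1 * (c1 * (Y1 * Z))) = a1 * (l1 * Y1 * Z) by rewrite /a1; ring.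
have -> : 6 * (1 + C2) * (l2 * (4 * (Y2 * Z))) = a2 * (l2 * Y2 * Z) by rewrite /a2; ring.
rewrite [(l1 * Y1 + _) * Z]mulrDl [leRHS]mulrDl.
apply: lerD; [apply: (ler_wpM2l a10); rewrite lerDl; exact: Y20|].
by apply: (ler_wpM2l a20); rewrite lerDr; exact: Y10.
Qed.

End sample_bound2.

(** * Entropy of ellipsoids *)

(** The number of binary digits of a code is at most the number of entries plus their sum. Counting
    rounding patterns thus reduces to bounding a sum, without counting lattice points. *)
Lemma code_lt (s : seq nat) : (CodeSeq.code s < 2 ^ (size s + sumn s))%N.
Proof.
elim: s => [//|v s ih] /=.
have e : (2 ^ ((size s).+1 + (v + sumn s)) = 2 ^ v * (2 ^ (size s + sumn s)).*2)%N.
  by rewrite -mul2n mulnCA -!expnD -expnS; congr (2 ^ _)%N; lia.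
rewrite e ltn_pmul2l ?expn_gt0//.
by rewrite ltn_Sdouble.
Qed.

Definition int_code (z : int) : nat := (`|z|.*2 + (z < 0)%R)%N.

Lemma int_code_inj : injective int_code.
Proof.
move=> [a|a] [b|b]; rewrite /int_code /=.
- by rewrite !addn0 => /double_inj ->.
- by move=> /(congr1 odd); rewrite addn0 addn1 /= !odd_double.
- by move=> /(congr1 odd); rewrite addn0 addn1 /= !odd_double.
- by rewrite !addn1 => -[] /double_inj [->].
Qed.

Lemma sum_dyadic_blocks (V : nmodType) (F : nat -> V) k :
  \sum_(0 <= i < 2 ^ k - 1) F i =
  \sum_(l < k) \sum_(2 ^ l - 1 <= i < 2 ^ l.+1 - 1) F i.
Proof.
elim: k => [|k ih]; first by rewrite big_ord0 big_geq.
rewrite big_ord_recr/= -ih -big_cat_nat//=.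
by rewrite leq_sub2r// leq_exp2l.
Qed.

Section ellipsoid.
Context {R : realType} {Omega : ptopologicalType}.
Variables (L : set (Omega -> R)) (ip : (Omega -> R) -> (Omega -> R) -> R).
Hypotheses (Llin : linear_subspace L) (Hip : is_inner_product L ip).
Implicit Types f g h : Omega -> R.

Let L0 : L 0. Proof. by case: Llin. Qed.
Lemma subspaceZ a f : L f -> L (a *: f).
Proof. by move=> Lf; rewrite -[_ *: _]addr0; apply: (proj2 Llin). Qed.
Lemma subspaceD f g : L f -> L g -> L (f + g).
Proof. by move=> Lf Lg; rewrite -[f]scale1r; apply: (proj2 Llin). Qed.
Lemma subspaceB f g : L f -> L g -> L (f - g).
Proof. by move=> Lf Lg; rewrite -scaleN1r; apply: subspaceD => //; exact: subspaceZ. Qed.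
Lemma subspace_sum (I : Type) (s : seq I) (u : I -> Omega -> R) :
  (forall i, L (u i)) -> L (\sum_(i <- s) u i).
Proof.
move=> Lu; elim: s => [|i s ih]; first by rewrite big_nil.
by rewrite big_cons; exact: subspaceD.
Qed.

Lemma ipC f g : L f -> L g -> ip f g = ip g f.
Proof. by case: Hip => + _ _ _; exact. Qed.
Lemma ip_ge0 f : L f -> 0 <= ip f f.
Proof. by case: Hip => _ _ + _; exact. Qed.
Lemma ip_eq0 f : L f -> ip f f = 0 -> f = 0.
Proof. by case: Hip => _ _ _; exact. Qed.
Lemma ip0l f : L f -> ip 0 f = 0.
Proof.
move=> Lf; case: Hip => _ /(_ 1 0 0 f L0 L0 Lf) + _ _.
by rewrite scale1r addr0 mul1r => e; lra.
Qed.
Lemma ipDl f g h : L f -> L g -> L h -> ip (f + g) h = ip f h + ip g h.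
Proof.
by move=> Lf Lg Lh; case: Hip => _ /(_ 1 f g h Lf Lg Lh) + _ _; rewrite scale1r mul1r.
Qed.
Lemma ipZl a f h : L f -> L h -> ip (a *: f) h = a * ip f h.
Proof.
by move=> Lf Lh; case: Hip => _ /(_ a f 0 h Lf L0 Lh) + _ _; rewrite addr0 ip0l// addr0.
Qed.
Lemma ipBl f g h : L f -> L g -> L h -> ip (f - g) h = ip f h - ip g h.
Proof.
move=> Lf Lg Lh; rewrite -scaleN1r ipDl//; last exact: subspaceZ.
by rewrite ipZl// mulN1r.
Qed.
Lemma ipZ a f : L f -> ip (a *: f) (a *: f) = a ^+ 2 * ip f f.
Proof.
by move=> Lf; rewrite ipZl//; [rewrite ipC// ?ipZl//; [ring|exact: subspaceZ]|exact: subspaceZ].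
Qed.
Lemma ip_suml (I : Type) (s : seq I) (c : I -> R) (u : I -> Omega -> R) h :
  (forall i, L (u i)) -> L h ->
  ip (\sum_(i <- s) c i *: u i) h = \sum_(i <- s) c i * ip (u i) h.
Proof.
move=> Lu Lh; elim: s => [|i s ih]; first by rewrite !big_nil ip0l.
rewrite !big_cons ipDl ?ih ?ipZl//; first exact: subspaceZ.
by apply: subspace_sum => j; exact: subspaceZ.
Qed.

Lemma ip_midpoint f g : L f -> L g ->
  ip (2^-1 *: (f + g)) (2^-1 *: (f + g)) = (ip f f + ip g g) / 2 - ip (f - g) (f - g) / 4.
Proof.
move=> Lf Lg; have Lfg := subspaceD Lf Lg; have Lfg' := subspaceB Lf Lg.
rewrite ipZ// [ip (f + g) _]ipDl// [ip (f - g) _]ipBl//.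
rewrite (ipC Lf Lfg) (ipC Lg Lfg) (ipC Lf Lfg') (ipC Lg Lfg') !ipBl// !ipDl// (ipC Lg Lf).
by field.
Qed.

Section orthonormal.
Variable u : nat -> Omega -> R.
Hypotheses (Lu : forall i, L (u i)) (u_orth : forall i j, i != j -> ip (u i) (u j) = 0)
  (u_norm : forall i, ip (u i) (u i) = 1 \/ u i = 0).

Let Pr (s : seq nat) (c : nat -> R) := \sum_(i <- s) c i *: u i.

Lemma span_subspace s c : L (Pr s c).
Proof. by apply: subspace_sum => i; exact: subspaceZ. Qed.

Lemma ip_span_notin s c j : j \notin s -> ip (Pr s c) (u j) = 0.
Proof.
move=> js; rewrite ip_suml// big_seq big1// => i is_.
by rewrite u_orth ?mulr0//; apply: contraNneq js => <-.
Qed.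

Lemma ip_span s c j : uniq s -> j \in s -> ip (Pr s c) (u j) = c j * ip (u j) (u j).
Proof.
move=> us js; rewrite ip_suml// (bigD1_seq j)//= big1 ?addr0// => i ij.
by rewrite u_orth ?mulr0.
Qed.

Lemma ip_span_span s c : uniq s ->
  ip (Pr s c) (Pr s c) = \sum_(i <- s) c i ^+ 2 * ip (u i) (u i).
Proof.
move=> us; rewrite {1}/Pr ip_suml//; last exact: span_subspace.
apply: eq_big_seq => i is_; rewrite ipC//; last exact: span_subspace.
by rewrite ip_span// expr2 mulrA.
Qed.

Lemma ip_u_le1 i : 0 <= ip (u i) (u i) <= 1.
Proof.
by rewrite ip_ge0//=; case: (u_norm i) => [->//|->]; rewrite ip0l// ler01.
Qed.

Lemma ip_span_le s c : uniq s -> ip (Pr s c) (Pr s c) <= \sum_(i <- s) c i ^+ 2.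
Proof.
move=> us; rewrite ip_span_span//; apply: ler_sum => i _.
by rewrite ler_piMr ?sqr_ge0//; case/andP: (ip_u_le1 i).
Qed.

Let coef h i := ip h (u i).

(** The vectors [u i] may be 0, as a greedy sequence exhausts a finite-dimensional space; this
    identity lets both cases be treated as orthonormal. *)
Lemma coef_norm h i : L h -> coef h i * ip (u i) (u i) = coef h i.
Proof.
move=> Lh; rewrite /coef; case: (u_norm i) => [->|->]; first by rewrite mulr1.
by rewrite ipC// ip0l// mul0r.
Qed.

Lemma ip_remainder s h j : uniq s -> j \in s -> L h -> ip (h - Pr s (coef h)) (u j) = 0.
Proof.
move=> us js Lh; rewrite ipBl//; last exact: span_subspace.
by rewrite ip_span// coef_norm// subrr.
Qed.

Lemma bessel s h : uniq s -> L h ->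
  ip (h - Pr s (coef h)) (h - Pr s (coef h)) = ip h h - \sum_(i <- s) coef h i ^+ 2.
Proof.
move=> us Lh; set P := Pr s _.
have LP : L P by exact: span_subspace.
have LhP : L (h - P) by exact: subspaceB.
have PhP : ip P (h - P) = 0.
  rewrite /P ip_suml// big_seq big1// => i is_.
  by rewrite ipC// ip_remainder// mulr0.
rewrite ipBl// PhP subr0 ipC// ipBl//; congr (_ - _).
by rewrite /P ip_suml//; apply: eq_bigr => i _; rewrite ipC// expr2.
Qed.

Lemma bessel_le s h : uniq s -> L h -> \sum_(i <- s) coef h i ^+ 2 <= ip h h.
Proof.
move=> us Lh; rewrite -subr_ge0 -bessel//; apply: ip_ge0.
by apply: subspaceB => //; exact: span_subspace.
Qed.

(** Test function: the combination of the u_i with coefficients u_i(x). Its value at x is the sum S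
    itself and its square norm is at most S, so S^2 <= kap S. The sum is the diagonal of a
    reproducing kernel. *)
Lemma bessel_eval s (kap : R) (x : Omega) : uniq s -> 0 <= kap ->
  (forall h, L h -> h x ^+ 2 <= kap * ip h h) -> \sum_(i <- s) u i x ^+ 2 <= kap.
Proof.
move=> us kap0 hx; pose c i := u i x.
have := hx _ (span_subspace s c); have := ip_span_le c us.
have -> : Pr s c x = \sum_(i <- s) u i x ^+ 2.
  rewrite /Pr; elim: (s) => [|i s' ih]; first by rewrite !big_nil.
  by rewrite !big_cons -ih.
set S := \sum_(i <- s) _; set I := ip _ _ => IS h.
have S0 : 0 <= S by apply: sumr_ge0 => i _; exact: sqr_ge0.
have [->//|Sn0] := eqVneq S 0.
have {Sn0}S0 : 0 < S by rewrite lt_neqAle eq_sym Sn0.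
have : S ^+ 2 <= kap * S by apply: le_trans h _; rewrite ler_wpM2l.
by rewrite expr2 ler_pM2r.
Qed.

End orthonormal.

Section quadratic.
Variables (m : nat) (X : 'I_m -> Omega) (w : 'I_m -> R) (kap : R).
Hypotheses (w0 : forall j, 0 <= w j) (kap0 : 0 <= kap)
  (HX : forall h j, L h -> h (X j) ^+ 2 <= kap * ip h h).

Definition qform h : R := \sum_j w j * h (X j) ^+ 2.

Lemma qform_ge0 h : 0 <= qform h.
Proof. by apply: sumr_ge0 => j _; rewrite mulr_ge0 ?sqr_ge0. Qed.

Lemma qformZ a h : qform (a *: h) = a ^+ 2 * qform h.
Proof. by rewrite /qform mulr_sumr; apply: eq_bigr => j _; rewrite !fctE/= exprMn; ring. Qed.

Lemma qform0 : qform 0 = 0.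
Proof. by rewrite -(scale0r 0) qformZ expr0n mul0r. Qed.

Lemma qform_le h : L h -> qform h <= kap * (\sum_j w j) * ip h h.
Proof.
move=> Lh; rewrite /qform mulrAC mulr_sumr; apply: ler_sum => j _.
by rewrite mulrC ler_wpM2r// HX.
Qed.

(** [qform_le] bounds the form on unit vectors, but its supremum over those orthogonal to [s] need
    not be attained: a vector beyond half of it is taken, any vector if the supremum is 0, and 0 if
    no unit vector is left. *)
Lemma greedy_next (s : seq (Omega -> R)) : (forall g, g \in s -> L g) ->
  exists v, [/\ L v, forall g, g \in s -> ip v g = 0, ip v v = 1 \/ v = 0 &
    forall h, L h -> (forall g, g \in s -> ip h g = 0) -> qform h <= 4 * qform v * ip h h].
Proof.
move=> Ls; pose A := [set h | [/\ L h, ip h h = 1 & forall g, g \in s -> ip h g = 0]].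
have scaleA h : L h -> (forall g, g \in s -> ip h g = 0) -> h != 0 ->
    A ((Num.sqrt (ip h h))^-1 *: h) /\ 0 < ip h h.
  move=> Lh hs hn0.
  have ip0 : 0 < ip h h.
    rewrite lt_neqAle ip_ge0// andbT eq_sym.
    by apply: contraNneq hn0 => /(ip_eq0 Lh) ->.
  split=> //; split; [exact: subspaceZ| |].
    by rewrite ipZ// exprVn sqr_sqrtr ?(ltW ip0)// mulVf ?gt_eqF.
  by move=> g gs; rewrite (ipZl _ Lh (Ls g gs)) (hs g gs) mulr0.
have [[a Aa]|nA] := pselect (exists a, A a); last first.
  exists 0; split=> //; first by move=> g /Ls Lg; rewrite ip0l.
    by right.
  move=> h Lh hs; have [->|hn0] := eqVneq h 0; last first.
    by case: nA; have [Ah _] := scaleA h Lh hs hn0; eexists; exact: Ah.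
  by rewrite qform0 ip0l// mulr0.
have hsup : has_sup (qform @` A).
  split; first by exists (qform a), a.
  by exists (kap * (\sum_j w j)) => _ [h [Lh h1 _] <-]; have := qform_le Lh; rewrite h1 mulr1.
pose S := sup (qform @` A).
have leS h : A h -> qform h <= S by move=> Ah; apply: ub_le_sup; [case: hsup|exists h].
have fin v : A v -> S <= 4 * qform v ->
    [/\ L v, forall g, g \in s -> ip v g = 0, ip v v = 1 \/ v = 0 &
    forall h, L h -> (forall g, g \in s -> ip h g = 0) -> qform h <= 4 * qform v * ip h h].
  move=> [Lv v1 vs] Sv; split=> //; first by left.
  move=> h Lh hs; have [->|hn0] := eqVneq h 0.
    by rewrite qform0 ip0l// mulr0.
  have [Ah ip0] := scaleA h Lh hs hn0.
  have := le_trans (leS _ Ah) Sv; rewrite qformZ exprVn sqr_sqrtr ?(ltW ip0)//.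
  by rewrite ler_pdivrMl// mulrC.
have S0 : 0 <= S by apply: le_trans (leS a Aa); exact: qform_ge0.
have [S00|Sn0] := eqVneq S 0.
  by exists a; apply: fin => //; rewrite S00 mulr_ge0 ?qform_ge0.
have S4 : 0 < S / 2 by rewrite divr_gt0// lt_neqAle eq_sym Sn0.
have [_ [v Av <-] vS] := sup_adherent S4 hsup.
exists v; apply: fin => //; rewrite -/S in vS.
have := qform_ge0 v; lra.
Qed.

(* Substitute for the diagonalization of [qform] in a space of arbitrary dimension: [u n]
   maximizes [qform], up to a constant, on the unit vectors orthogonal to its predecessors.
   Bessel's inequality then plays the role of the trace formula. *)
Lemma greedy_basis : exists u : nat -> Omega -> R,
  [/\ forall i, L (u i), forall i j, i != j -> ip (u i) (u j) = 0,
      forall i, ip (u i) (u i) = 1 \/ u i = 0 &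
      forall n h, L h -> (forall i, (i < n)%N -> ip h (u i) = 0) ->
        qform h <= 4 * qform (u n) * ip h h].
Proof.
have /choice[nxt nxtP] : forall s : seq (Omega -> R), exists v, (forall g, g \in s -> L g) ->
   [/\ L v, forall g, g \in s -> ip v g = 0, ip v v = 1 \/ v = 0 &
    forall h, L h -> (forall g, g \in s -> ip h g = 0) -> qform h <= 4 * qform v * ip h h].
  move=> s; have [Ls|nL] := pselect (forall g, g \in s -> L g).
    by have [v vP] := greedy_next Ls; exists v.
  by exists 0.
pose pre := fix pre n := if n is n'.+1 then rcons (pre n') (nxt (pre n')) else [::].
pose u n := nxt (pre n).
have preL n : forall g, g \in pre n -> L g.
  elim: n => [//|n ih] g /=; rewrite mem_rcons inE => /orP[/eqP->|]; last exact: ih.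
  by have [] := nxtP _ ih.
have uin n i : (i < n)%N -> u i \in pre n.
  elim: n => [//|n ih]; rewrite ltnS leq_eqVlt => /orP[/eqP->|/ih] /=.
    by rewrite mem_rcons mem_head.
  by rewrite mem_rcons inE orbC => ->.
have inu n g : g \in pre n -> exists2 i, (i < n)%N & g = u i.
  elim: n => [//|n ih] /=; rewrite mem_rcons inE => /orP[/eqP->|/ih[i i_n ->]].
    by exists n.
  by exists i => //; exact: ltnW.
have Lu i : L (u i) by have [] := nxtP _ (preL i).
have orth i j : (i < j)%N -> ip (u j) (u i) = 0.
  by move=> ij; have [_ + _ _] := nxtP _ (preL j); apply; exact: uin.
exists u; split => //.
- move=> i j; rewrite neq_ltn => /orP[ij|ji]; last exact: orth.
  by rewrite ipC// orth.
- by move=> i; have [] := nxtP _ (preL i).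
- move=> n h Lh hu; have [_ _ _] := nxtP _ (preL n); apply => // g /inu[i i_n ->].
  exact: hu.
Qed.

(** Cauchy-Schwarz with the weights (4/5)^j, of total less than 5. In the application the terms with
    small l are geometrically small themselves, which beats the factor (5/4)^(n-1-l). *)
Lemma sum_sqr_weighted n (x : nat -> R) :
  (\sum_(l < n) x l) ^+ 2 <= 5 * \sum_(l < n) (5 / 4) ^+ (n.-1 - l) * x l ^+ 2.
Proof.
elim: n => [|n ih]; first by rewrite !big_ord0 expr0n mulr0.
rewrite !big_ord_recr/= subnn expr0 mul1r.
set S := \sum_(l < n) _ in ih *; set y := x n.
have -> : \sum_(l < n) (5 / 4) ^+ (n - l) * x l ^+ 2 =
    5 / 4 * \sum_(l < n) (5 / 4) ^+ (n.-1 - l) * x l ^+ 2.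
  rewrite mulr_sumr; apply: eq_bigr => l _; rewrite mulrA -exprS; congr (_ ^+ _ * _).
  by case: (n) l => [[]//|n' l] /=; rewrite subSn// -ltnS.
set Z := \sum_(l < n) _ in ih *.
have := sqr_ge0 (S / 2 - 2 * y); rewrite !sqrrB !sqrrD exprMn exprVn; lra.
Qed.

Section entropy.
Variable u : nat -> Omega -> R.
Hypotheses (Lu : forall i, L (u i)) (u_orth : forall i j, i != j -> ip (u i) (u j) = 0)
  (u_norm : forall i, ip (u i) (u i) = 1 \/ u i = 0)
  (u_greedy : forall n h, L h -> (forall i, (i < n)%N -> ip h (u i) = 0) ->
        qform h <= 4 * qform (u n) * ip h h).

Let lam i := qform (u i).
Let T := kap * \sum_j w j.
Let A l := 4 * lam (2 ^ l - 1).

Let lam_ge0 i : 0 <= lam i. Proof. exact: qform_ge0. Qed.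
Let A_ge0 l : 0 <= A l. Proof. by rewrite mulr_ge0. Qed.

(** The vector of index n is orthogonal to the predecessors of that of index i and hence competed
    with it: [lam] is decreasing up to the factor 4. *)
Let lam_le i n : (i <= n)%N -> lam n <= 4 * lam i.
Proof.
move=> i_n; apply: le_trans (u_greedy (Lu n) (_ : forall i', (i' < i)%N -> _)) _.
  by move=> i' i'i; apply: u_orth; rewrite gtn_eqF// (leq_trans i'i).
rewrite ler_piMr//; first by apply: mulr_ge0 => //; exact: qform_ge0.
by case/andP: (ip_u_le1 Lu u_norm n).
Qed.

(** Trace bound: after exchanging the sums, [bessel_eval] bounds the sum over i at each sample point
    by [kap], uniformly in n. *)
Let lam_sum n : \sum_(0 <= i < n) lam i <= T.
Proof.
rewrite /lam /qform exchange_big/= /T mulr_sumr; apply: ler_sum => j _.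
rewrite -mulr_sumr mulrC ler_wpM2r//.
apply: (bessel_eval Lu u_orth u_norm) => //; first exact: iota_uniq.
by move=> h; exact: HX.
Qed.

(** Cauchy condensation for the almost decreasing [lam]. *)
Let lam_blocks n :
  \sum_(l < n.+1) 2 ^+ l * lam (2 ^ l - 1) <= lam 0%N + 8 * \sum_(0 <= i < 2 ^ n - 1) lam i.
Proof.
elim: n => [|n ih].
  by rewrite big_ord_recl big_ord0 addr0 expr0 mul1r big_geq// mulr0 addr0.
rewrite big_ord_recr/=; apply: le_trans (lerD ih (lexx _)) _; rewrite -addrA lerD2l.
have nn1 : (2 ^ n - 1 <= 2 ^ n.+1 - 1)%N by rewrite leq_sub2r// leq_exp2l.
rewrite (big_cat_nat (leq0n _) nn1)/= mulrDr lerD2l.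
apply: (@le_trans _ _ (8 * \sum_(2 ^ n - 1 <= i < 2 ^ n.+1 - 1) lam (2 ^ n.+1 - 1) / 4)).
  rewrite sumr_const_nat.
  have -> : (2 ^ n.+1 - 1 - (2 ^ n - 1) = 2 ^ n)%N.
    by rewrite expnS; have : (0 < 2 ^ n)%N := expn_gt0 2 n; lia.
  by rewrite -[X in _ <= 8 * X]mulr_natr natrX exprS; lra.
rewrite ler_pM2l// !big_nat; apply: ler_sum => i /andP[_ i_n].
by rewrite ler_pdivrMr// mulrC lam_le// ltnW.
Qed.

(** 20 = 5 * 4, from [sum_sqr_weighted] and the square diameter of the ball; 20/49 = 5/4 * (4/7)^2,
    from its weights and the rounding steps. The ratio lies below 1/2, so the sum of 2^k [e2 k]
    still converges. *)
Let e2 k := 20 * \sum_(l < k.+1) (20 / 49) ^+ (k - l) * A l.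

Let e2_ge0 k : 0 <= e2 k.
Proof.
rewrite mulr_ge0//; apply: sumr_ge0 => l _; rewrite mulr_ge0// exprn_ge0//.
Qed.

Let e2S k : e2 k.+1 = 20 / 49 * e2 k + 20 * A k.+1.
Proof.
rewrite /e2 big_ord_recr/= subnn expr0 mul1r mulrDr; congr (_ + _).
rewrite [RHS]mulrCA; congr (_ * _); rewrite [RHS]mulr_sumr; apply: eq_bigr => l _.
by rewrite subSn ?exprS -?mulrA// -ltnS.
Qed.

Let A_sum n : \sum_(l < n) 2 ^+ l * A l <= 36 * T.
Proof.
have T0 : 0 <= T by rewrite mulr_ge0 ?sumr_ge0.
case: n => [|n]; first by rewrite big_ord0 mulr_ge0.
have -> : \sum_(l < n.+1) 2 ^+ l * A l = 4 * \sum_(l < n.+1) 2 ^+ l * lam (2 ^ l - 1).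
  by rewrite mulr_sumr; apply: eq_bigr => l _; rewrite mulrCA.
have := lam_blocks n; have := lam_sum (2 ^ n - 1); have := lam_sum 1.
rewrite big_nat1; lra.
Qed.

(** The recursion gives S <= (40/49) S + 20 * 36 T for the sum S, hence S <= (49/9) * 720 T = 98 *
    40 T. *)
Let e2_sum n : \sum_(k < n) 2 ^+ k * e2 k <= 98 * (40 * T).
Proof.
have T0 : 0 <= T by rewrite mulr_ge0 ?sumr_ge0.
case: n => [|n]; first by rewrite big_ord0; apply: mulr_ge0 => //; exact: mulr_ge0.
have h : \sum_(k < n.+1) 2 ^+ k * e2 k =
    40 / 49 * \sum_(k < n) 2 ^+ k * e2 k + 20 * \sum_(l < n.+1) 2 ^+ l * A l.
  elim: n => [|n ih].
    rewrite !big_ord_recl !big_ord0 /= /e2 big_ord_recl big_ord0 /= subnn !expr0.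
    by ring.
  have -> : \sum_(k < n.+2) 2 ^+ k * e2 k = \sum_(k < n.+1) 2 ^+ k * e2 k + 2 ^+ n.+1 * e2 n.+1.
    by rewrite big_ord_recr.
  have -> : \sum_(l < n.+2) 2 ^+ l * A l = \sum_(l < n.+1) 2 ^+ l * A l + 2 ^+ n.+1 * A n.+1.
    by rewrite big_ord_recr.
  have hS : \sum_(k < n.+1) 2 ^+ k * e2 k = \sum_(k < n) 2 ^+ k * e2 k + 2 ^+ n * e2 n.
    by rewrite big_ord_recr.
  rewrite {1}ih hS e2S exprS; move: (\sum_(k < n) _) (\sum_(l < n.+1) _) => S S'.
  by field.
have := A_sum n.+1; have : \sum_(k < n) 2 ^+ k * e2 k <= \sum_(k < n.+1) 2 ^+ k * e2 k.
  by rewrite big_ord_recr/= lerDl mulr_ge0// exprn_ge0.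
lra.
Qed.

(* The coordinates of the block [2^l - 1, 2^(l+1) - 1), [l < k], are rounded with the step
   [(4/7)^(k-l) / sqrt (2^l)], which keeps the number of labels doubly exponential in [k];
   the coordinates of the blocks above are dropped. *)
Let blk i := trunc_log 2 i.+1.
Let step k i : R := (4 / 7) ^+ (k - blk i) / Num.sqrt (2 ^+ blk i).
Let z k f i : int := Num.floor (ip f (u i) / step k i).
Let lbl k f := CodeSeq.code [seq int_code (z k f i) | i <- iota 0 (2 ^ k - 1)].

Let step_gt0 k i : 0 < step k i.
Proof. by rewrite divr_gt0 ?exprn_gt0 ?sqrtr_gt0 ?exprn_gt0. Qed.

Let blkE l i : (2 ^ l - 1 <= i < 2 ^ l.+1 - 1)%N -> blk i = l.
Proof.
move=> /andP[li il]; apply: trunc_log_eq => //.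
have : (0 < 2 ^ l)%N := expn_gt0 2 l.
have : (0 < 2 ^ l.+1)%N := expn_gt0 2 l.+1.
by move: li il; move: (2 ^ l)%N (2 ^ l.+1)%N => a b; lia.
Qed.

Let int_code_le (x : R) : (int_code (Num.floor x))%:R <= 2 * `|x| + 3.
Proof.
have /andP[fx xf] := floor_itv x.
have h : (int_code (Num.floor x))%:R <= 2 * `|(Num.floor x)%:~R| + 1 :> R.
  rewrite natrD -mul2n natrM natr_absz intr_norm lerD2l.
  by case: (_ < _)%R.
apply: le_trans h _; rewrite intrD in xf.
have : `|(Num.floor x)%:~R| <= `|x| + 1 :> R.
  rewrite ler_norml; have := ler_norm x; have := ler_norm (- x); rewrite normrN.
  by move: fx xf; move: (_%:~R) (`|x|) => a b; rewrite mulr1z => *; apply/andP; split; lra.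
lra.
Qed.

Let block_size l : (2 ^ l.+1 - 1 - (2 ^ l - 1) = 2 ^ l)%N.
Proof. by rewrite expnS; have : (0 < 2 ^ l)%N := expn_gt0 2 l; lia. Qed.

Let sum_block l (x : R) : \sum_(2 ^ l - 1 <= i < 2 ^ l.+1 - 1) x = x * 2 ^+ l.
Proof. by rewrite sumr_const_nat block_size -[x *+ _]mulr_natr natrX. Qed.

Let coef_block f l : L f -> ip f f <= 1 ->
  \sum_(2 ^ l - 1 <= i < 2 ^ l.+1 - 1) ip f (u i) ^+ 2 <= 1.
Proof.
by move=> Lf; apply: le_trans; apply: (bessel_le Lu u_orth u_norm) => //; exact: iota_uniq.
Qed.

(** 7/4 < 2 keeps the sum of order 2^k. Together with 5/4 * (4/7)^2 < 1/2, needed for [e2], this is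
    what the ratio 4/7 of the rounding steps has to satisfy. *)
Let geo k : \sum_(l < k) 2 ^+ l * (7 / 4) ^+ (k - l) <= 7 * 2 ^+ k :> R.
Proof.
elim: k => [|k ih]; first by rewrite big_ord0 mulr_ge0.
rewrite big_ord_recr/= subSnn expr1.
have -> : \sum_(l < k) 2 ^+ l * (7 / 4) ^+ (k.+1 - l) = 7 / 4 * \sum_(l < k) 2 ^+ l * (7 / 4) ^+ (k - l) :> R.
  by rewrite mulr_sumr; apply: eq_bigr => l _; rewrite subSn ?exprS 1?mulrCA// ltnW.
rewrite exprS; move: ih; move: (\sum_(l < k) _) (2 ^+ k) => *; lra.
Qed.

(** In block l, 2 * 2^(l/2) |c_i| <= 1 + 2^l c_i^2, and Bessel's inequality bounds the sum of the
    c_i^2 by 1: large coefficients are few. The entries sum to at most 3 * 2^k + 2 * 7 * 2^k, and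
    their number adds at most 2^k, whence 18. *)
Let lbl_lt k f : L f -> ip f f <= 1 -> (lbl k f < 2 ^ (18 * 2 ^ k))%N.
Proof.
move=> Lf f1; apply: leq_trans (code_lt _) _; rewrite leq_exp2l//.
rewrite size_map size_iota.
suff h : (sumn [seq int_code (z k f i) | i <- iota 0 (2 ^ k - 1)] <= 17 * 2 ^ k)%N.
  by apply: leq_trans (leq_add (leq_subr _ _) h) _; rewrite -mulSn.
rewrite -(ler_nat R) sumnE big_map natr_sum.
apply: (@le_trans _ _ (\sum_(0 <= i < 2 ^ k - 1) (2 * `|ip f (u i) / step k i| + 3))).
  by rewrite /index_iota subn0; apply: ler_sum => i _; exact: int_code_le.
rewrite sum_dyadic_blocks.
have hb l : (l < k)%N -> \sum_(2 ^ l - 1 <= i < 2 ^ l.+1 - 1) (2 * `|ip f (u i) / step k i| + 3) <=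
    3 * 2 ^+ l + 2 * (2 ^+ l * (7 / 4) ^+ (k - l)).
  move=> lk; pose g : R := (7 / 4) ^+ (k - l).
  have g0 : 0 < g by rewrite exprn_gt0.
  apply: (@le_trans _ _ (\sum_(2 ^ l - 1 <= i < 2 ^ l.+1 - 1) (3 + g * (1 + 2 ^+ l * ip f (u i) ^+ 2)))).
    rewrite !big_nat; apply: ler_sum => i il.
    rewrite /step (blkE il) addrC lerD2l normrM (ger0_norm (x := _^-1)); last first.
      by rewrite invr_ge0 divr_ge0 ?sqrtr_ge0// exprn_ge0.
    rewrite invfM invrK -exprVn.
    have -> : (4 / 7)^-1 = 7 / 4 :> R by field.
    rewrite -/g; set s := Num.sqrt _; set c := `|_|.
    have s2 : s ^+ 2 = 2 ^+ l by rewrite sqr_sqrtr// exprn_ge0.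
    have c2 : c ^+ 2 = ip f (u i) ^+ 2 by rewrite real_normK// num_real.
    rewrite -s2 -c2 -exprMn.
    have -> : 2 * (c * (g * s)) = g * (2 * (s * c)) by ring.
    rewrite ler_pM2l//; have := sqr_ge0 (1 - s * c); rewrite sqrrB; lra.
  rewrite big_split/= sum_block -mulr_sumr big_split/= sum_block mul1r -mulr_sumr.
  rewrite lerD2l [2 ^+ l * (7 / 4) ^+ _]mulrC -/g.
  have c1 := coef_block l Lf f1.
  have := ler_wpM2l (exprn_ge0 l (ler0n R 2)) c1.
  rewrite mulr1; set Y := 2 ^+ l * _; set Z := 2 ^+ l => YZ.
  have : g * (Z + Y) <= g * (Z + Z) by rewrite ler_pM2l// lerD2l.
  lra.
apply: (@le_trans _ _ (\sum_(l < k) (3 * 2 ^+ l + 2 * (2 ^+ l * (7 / 4) ^+ (k - l))))).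
  by apply: ler_sum => l _; exact: hb.
rewrite big_split/= -!mulr_sumr natrM natrX.
have : \sum_(l < k) 2 ^+ l <= 2 ^+ k :> R.
  elim: (k) => [|k' ih]; first by rewrite big_ord0.
  rewrite big_ord_recr/= exprS; move: ih; move: (\sum_(_ < _) _) (_ ^+ _) => *; lra.
have := geo k; move: (\sum_(l < k) _) (\sum_(l < k) _) (2 ^+ k) => *; lra.
Qed.

(** The difference is cut into its blocks and a remainder. The piece of index l is orthogonal to the
    first 2^l - 1 vectors, so the greedy property bounds its form by [A l] times its square norm,
    which is at most (16/49)^(k-l) for a rounded block and 4 for the remainder. *)
Let lbl_dist k f g : L f -> L g -> ip f f <= 1 -> ip g g <= 1 -> lbl k f = lbl k g ->
  qform (f - g) <= e2 k.
Proof.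
move=> Lf Lg f1 g1 fg.
pose n := (2 ^ k - 1)%N.
have Lfg : L (f - g) by exact: subspaceB.
have zE i : (i < n)%N -> z k f i = z k g i.
  move=> i_n; have /(congr1 (fun s => nth 0%N s i)) := can_inj CodeSeq.codeK fg.
  rewrite !(nth_map 0%N) ?size_iota// !nth_iota// !add0n; exact: int_code_inj.
pose d i := ip (f - g) (u i).
have dle i : (i < n)%N -> d i ^+ 2 <= step k i ^+ 2.
  move=> i_n; have s0 := step_gt0 k i.
  have dE : d i = (ip f (u i) / step k i - ip g (u i) / step k i) * step k i.
    by rewrite /d ipBl//; field; rewrite gt_eqF.
  rewrite dE exprMn ler_piMl ?sqr_ge0// -real_normK ?num_real// expr_le1// ltW// ltr_norml.
  have /andP[h1 h2] := floor_itv (ip f (u i) / step k i).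
  have /andP[h3 h4] := floor_itv (ip g (u i) / step k i).
  have e := zE i i_n; rewrite /z in e; rewrite e in h1 h2.
  rewrite intrD in h2; rewrite intrD in h4; apply/andP; split.
    by move: h1 h4; rewrite mulr1z; move: (_ / _) (_ / _) (_%:~R) => *; lra.
  by move: h2 h3; rewrite mulr1z; move: (_ / _) (_ / _) (_%:~R) => *; lra.
pose v l := if (l < k)%N then \sum_(2 ^ l - 1 <= i < 2 ^ l.+1 - 1) d i *: u i
  else f - g - \sum_(0 <= i < n) d i *: u i.
have fgE : f - g = \sum_(l < k.+1) v l.
  rewrite big_ord_recr/= {2}/v ltnn /n sum_dyadic_blocks.
  rewrite (eq_bigr (fun l : 'I_k => \sum_(2 ^ l - 1 <= i < 2 ^ l.+1 - 1) d i *: u i)).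
    by rewrite addrC subrK.
  by move=> l _; rewrite /v ltn_ord.
have qv : qform (f - g) <= 5 * \sum_(l < k.+1) (5 / 4) ^+ (k - l) * qform (v l).
  rewrite /qform mulr_sumr.
  under [leRHS]eq_bigr do rewrite mulr_sumr mulr_sumr.
  rewrite exchange_big/=; apply: ler_sum => j _.
  have -> : (f - g) (X j) = \sum_(l < k.+1) v l (X j).
    by rewrite fgE fct_sumE.
  apply: le_trans (ler_wpM2l (w0 j) (sum_sqr_weighted k.+1 (fun l => v l (X j)))) _.
  rewrite mulrCA !mulr_sumr le_eqVlt; apply/orP; left; apply/eqP; apply: eq_bigr => l _.
  by rewrite /=; ring.
apply: le_trans qv _; rewrite /e2.
have split20 (S : R) : 20 * S = 5 * (4 * S) by ring.
rewrite split20 ler_pM2l// mulr_sumr; apply: ler_sum => l _.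
have -> : 4 * ((20 / 49) ^+ (k - l) * A l) = (5 / 4) ^+ (k - l) * (4 * ((16 / 49) ^+ (k - l) * A l)).
  have -> : 20 / 49 = 5 / 4 * (16 / 49) :> R by field.
  by rewrite exprMn; ring.
rewrite ler_wpM2l ?exprn_ge0//.
have lk : (l <= k)%N by rewrite -ltnS.
have [lk'|kl] := ltnP l k; last first.
  have {lk kl}-> : (l : nat) = k by apply/eqP; rewrite eqn_leq lk.
  rewrite subnn expr0 mul1r /v ltnn.
  set h := f - g - _.
  have Lh : L h by apply: subspaceB => //; exact: span_subspace.
  have hu i : (i < n)%N -> ip h (u i) = 0.
    move=> i_n; apply: (ip_remainder Lu u_orth u_norm) => //; first exact: iota_uniq.
    by rewrite mem_iota subn0.
  apply: le_trans (u_greedy Lh hu) _; rewrite mulrC ler_wpM2r ?A_ge0//.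
  rewrite /h (bessel Lu u_orth u_norm)//; last exact: iota_uniq.
  apply: (@le_trans _ _ (ip (f - g) (f - g))).
    by rewrite gerBl; apply: sumr_ge0 => i _; exact: sqr_ge0.
  have := ip_ge0 (subspaceZ 2^-1 (subspaceD Lf Lg)); rewrite ip_midpoint//; lra.
rewrite /v lk'; set h := \sum_(_ <= i < _) _.
have Lh : L h by exact: span_subspace.
have hu i : (i < 2 ^ l - 1)%N -> ip h (u i) = 0.
  move=> il; apply: (ip_span_notin Lu u_orth).
  by rewrite mem_index_iota leqNgt il.
apply: le_trans (u_greedy Lh hu) _; rewrite -/(A l).
have hh : ip h h <= (16 / 49) ^+ (k - l).
  apply: le_trans (ip_span_le Lu u_orth u_norm _ _) _; first exact: iota_uniq.
  apply: (@le_trans _ _ (\sum_(2 ^ l - 1 <= i < 2 ^ l.+1 - 1) (16 / 49) ^+ (k - l) / 2 ^+ l)).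
    rewrite !big_nat; apply: ler_sum => i il.
    apply: le_trans (dle i _) _.
      case/andP: il => _ il; apply: leq_trans il _.
      by rewrite leq_sub2r// leq_exp2l.
    rewrite /step (blkE il) exprMn exprVn sqr_sqrtr ?exprn_ge0//.
    rewrite -exprM mulnC exprM.
    by have -> : (4 / 7) ^+ 2 = 16 / 49 :> R by field.
  by rewrite sum_block mulfVK// gt_eqF ?exprn_gt0.
apply: le_trans (ler_wpM2l (A_ge0 l) hh) _.
by rewrite mulrC ler_peMl ?mulr_ge0 ?exprn_ge0// ler1n.
Qed.

Lemma ellipsoid_entropy_basis : exists e : nat -> R,
  [/\ forall k, 0 <= e k, forall n, \sum_(k < n) 2 ^+ k * e k <= 98 * (40 * T) &
      forall k, exists l : (Omega -> R) -> nat,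
        (forall f, L f -> ip f f <= 1 -> (l f < 2 ^ (18 * 2 ^ k))%N) /\
        forall f g, L f -> L g -> ip f f <= 1 -> ip g g <= 1 -> l f = l g ->
          qform (f - g) <= e k].
Proof.
exists e2; split => // k; exists (lbl k); split => [f|f g]; [exact: lbl_lt|exact: lbl_dist].
Qed.

End entropy.

Lemma ellipsoid_entropy : exists e : nat -> R,
  [/\ forall k, 0 <= e k,
      forall n, \sum_(k < n) 2 ^+ k * e k <= 98 * (40 * (kap * \sum_j w j)) &
      forall k, exists l : (Omega -> R) -> nat,
        (forall f, L f -> ip f f <= 1 -> (l f < 2 ^ (18 * 2 ^ k))%N) /\
        forall f g, L f -> L g -> ip f f <= 1 -> ip g g <= 1 -> l f = l g ->
          qform (f - g) <= e k].
Proof.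
have [u [Lu u_orth u_norm u_greedy]] := greedy_basis.
exact: ellipsoid_entropy_basis.
Qed.

End quadratic.
End ellipsoid.

(** * Fixed samples: a Euclidean ball *)

Section regularized_entropy.
Context {R : realType}.

Lemma sum_shifted_powers n i :
  \sum_(k < n) (if (k <= i)%N then 2 ^+ k * (3 / 2) ^+ (i - k) else 0) <= 4 * 2 ^+ i :> R.
Proof.
have delta j : \sum_(k < n) (if (k == j :> nat) then 2 ^+ k else 0) <= 2 ^+ j :> R.
  have [jn|nj] := ltnP j n.
    rewrite (bigD1 (Ordinal jn))//= eqxx big1 ?addr0// => k kj.
    by case: eqP => // e; case/eqP: kj; exact/val_inj.
  by rewrite big1 ?exprn_ge0// => k _; rewrite ltn_eqF// (leq_trans (ltn_ord k)).
elim: i => [|i ih].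
  apply: le_trans (ler_sum _ (_ : forall k : 'I_n, true -> _ <= (if (k == 0 :> nat)%N then 2 ^+ k else 0))) _.
    by move=> k _; rewrite leqn0; case: eqP => // ->; rewrite subn0 !expr0 mulr1.
  by apply: le_trans (delta 0%N) _; rewrite expr0; lra.
have -> : \sum_(k < n) (if (k <= i.+1)%N then 2 ^+ k * (3 / 2) ^+ (i.+1 - k) else 0) =
    3 / 2 * \sum_(k < n) (if (k <= i)%N then 2 ^+ k * (3 / 2) ^+ (i - k) else 0) +
    \sum_(k < n) (if (k == i.+1 :> nat) then 2 ^+ k else 0) :> R.
  rewrite mulr_sumr -big_split/=; apply: eq_bigr => k _.
  have [ki|ik] := leqP k i.
    rewrite (leq_trans ki (leqnSn i)) (ltn_eqF (ki : (k < i.+1)%N)) addr0 subSn// exprS.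
    by ring.
  rewrite mulr0 add0r eqn_leq ik andbT; case: ifP => // ki.
  have -> : (i.+1 - k = 0)%N by apply/eqP; rewrite subn_eq0.
  by rewrite expr0 mulr1.
by have := delta i.+1; rewrite exprS; move: ih; lra.
Qed.

(** The chaining functional needs entropies that drop by at least 2/3 per level, for its
    telescoping, and stay above V2 4^-k, for storage in labels. Tails summed with the weights
    (3/2)^(i-k), plus V2 4^-k, have both properties; as 3/2 < 2, the sum with weights 2^k grows only
    by the factor 4. *)
Lemma regularize (e : nat -> R) (V2 C : R) (K : nat) : 0 < V2 -> (forall k, 0 <= e k) ->
  (forall n, \sum_(k < n) 2 ^+ k * e k <= C * V2) ->
  exists E : nat -> R, [/\ forall k, V2 * 4^-1 ^+ k <= E k,
    forall k, E k.+1 <= 2 / 3 * E k,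
    forall n, \sum_(k < n) 2 ^+ k * E k <= (4 * C + 2) * V2 &
    forall k, (k <= K)%N -> e k <= E k].
Proof.
move=> V20 e0 eC.
pose a i k := if (k <= i)%N then (3 / 2) ^+ (i - k) else 0 : R.
have a0 i k : 0 <= a i k by rewrite /a; case: ifP => // _; rewrite exprn_ge0.
pose E k := \sum_(i < K.+1) a i k * e i + V2 * 4^-1 ^+ k.
have S0 k : 0 <= \sum_(i < K.+1) a i k * e i by apply: sumr_ge0 => i _; rewrite mulr_ge0.
have q0 k : 0 < V2 * 4^-1 ^+ k by rewrite mulr_gt0// exprn_gt0.
exists E; split.
- by move=> k; rewrite /E lerDr.
- move=> k; rewrite /E mulrDr; apply: lerD.
    rewrite mulr_sumr; apply: ler_sum => i _; rewrite mulrA ler_wpM2r// /a.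
    case: ifP => [ki|_]; last by apply: mulr_ge0 => //; case: ifP => // _; rewrite exprn_ge0.
    by rewrite (ltnW ki) -[(i - k)%N](subnSK ki) exprS mulrA; have -> : 2 / 3 * (3 / 2) = 1 :> R; [field|rewrite mul1r].
  by have := q0 k; rewrite exprS; lra.
- move=> n; under eq_bigr do rewrite /E mulrDr.
  rewrite big_split/= mulrDl; apply: lerD.
    under eq_bigr do rewrite mulr_sumr.
    rewrite exchange_big/= -mulrA.
    apply: le_trans (_ : _ <= 4 * \sum_(i < K.+1) 2 ^+ i * e i) _; last by rewrite ler_pM2l.
    rewrite mulr_sumr; apply: ler_sum => i _.
    have -> : \sum_(k < n) 2 ^+ k * (a i k * e i) =
        (\sum_(k < n) (if (k <= i)%N then 2 ^+ k * (3 / 2) ^+ (i - k) else 0)) * e i.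
      rewrite mulr_suml; apply: eq_bigr => k _; rewrite mulrA /a.
      by case: ifP => // _; rewrite mulr0 mul0r.
    by rewrite mulrA ler_wpM2r// sum_shifted_powers.
  have -> : \sum_(k < n) 2 ^+ k * (V2 * 4^-1 ^+ k) = V2 * \sum_(k < n) 2^-1 ^+ k.
    rewrite mulr_sumr; apply: eq_bigr => k _; rewrite mulrCA -exprMn.
    by have -> : 2 * 4^-1 = 2^-1 :> R by field.
  by rewrite mulrC ler_pM2r// sum_expr2V.
- move=> k kK; have kK' : (k < K.+1)%N by [].
  rewrite /E (bigD1 (Ordinal kK'))//= /a leqnn subnn expr0 mul1r -addrA lerDl addr_ge0 ?(ltW (q0 k))//.
  by apply: sumr_ge0 => i _; rewrite mulr_ge0 ?a0.
Qed.

Lemma sqrtrD_le (x y : R) : 0 <= x -> 0 <= y -> Num.sqrt (x + y) <= Num.sqrt x + Num.sqrt y.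
Proof.
move=> x0 y0; rewrite -[leRHS]ger0_norm ?addr_ge0 ?sqrtr_ge0// -sqrtr_sqr ler_wsqrtr//.
rewrite sqrrD !sqr_sqrtr// -addrA [_ *+ 2 + _]addrC addrA lerDl.
by rewrite mulrn_wge0// mulr_ge0 ?sqrtr_ge0.
Qed.

(** A level stores a label of the [n]-chaining (6 * 2^i bits), a rounded entropy (2 i + 2 + J bits),
    two rounded penalties and an ellipsoid label (18 * 2^(i+1) bits). *)
Lemma euclid_label_prod (J k : nat) :
  (1 * \prod_(i < k) (2 ^ (6 * 2 ^ i) * 2 ^ (2 * i.+1 + J) * 2 ^ (i.+1 + 2) * 2 ^ (i.+1 + 2) *
     2 ^ (18 * 2 ^ i.+1)) <= 2 ^ ((60 + J) * 2 ^ k))%N.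
Proof.
rewrite mul1n; suff [e -> h] : exists2 e,
  (\prod_(i < k) (2 ^ (6 * 2 ^ i) * 2 ^ (2 * i.+1 + J) * 2 ^ (i.+1 + 2) * 2 ^ (i.+1 + 2) *
     2 ^ (18 * 2 ^ i.+1)) = 2 ^ e)%N & (e + 4 * k + J + 16 <= (60 + J) * 2 ^ k)%N.
  by rewrite leq_exp2l//; lia.
elim: k => [|k [e eq h]]; first by exists 0%N; rewrite ?big_ord0//; lia.
exists (e + (6 * 2 ^ k + (2 * k.+1 + J) + (k.+1 + 2) + (k.+1 + 2) + 18 * 2 ^ k.+1))%N.
  by rewrite big_ord_recr/= eq -!expnD.
rewrite expnS.
have : (k < 2 ^ k)%N by rewrite ltn_expl.
nia.
Qed.

End regularized_entropy.

Section euclid_minimizers.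
Context {R : realType}.

(* Counterpart of [convex_minimizers_close] for a point-dependent quadratic form [q]. *)
Lemma euclid_minimizers_close (V : lmodType R) (L : set V) (e n : V -> R) (q : V -> V -> R)
    (theta P G tb tf tg tau D S sig del eps : R) (f g y z : V) :
  1 <= theta -> 0 <= P -> 1 <= G -> 0 < tb -> tb <= tf <= 2 * tb -> tb <= tg -> 0 < tau ->
  0 <= D -> 0 <= S -> 0 <= sig -> 0 <= del -> 0 <= eps ->
  (forall f g, L f -> L g -> L (f - g)) -> (forall f g, L f -> L g -> L (f + g)) ->
  (forall a f, L f -> L (a *: f)) ->
  (forall f g, L f -> L g -> e (2^-1 *: (f + g)) = (e f + e g) / 2 - e (f - g) / 4) ->
  (forall f, L f -> 0 <= e f) ->
  (forall f a h, q f (a *: h) = a ^+ 2 * q f h) ->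
  (forall f h h', q f (h + h') <= 2 * q f h + 2 * q f h') ->
  (forall f h, 0 <= q f h) ->
  (forall h, 0 <= n h) ->
  (forall a h, n (a *: h) = `|a| * n h) ->
  (forall h h', n (h + h') <= 2 * (n h + n h')) ->
  L f -> L g -> L y -> L z -> e y <= 1 -> e z <= e y ->
  (forall u, L u -> e u <= 1 ->
     e y + tf * q f (f - y) + (tau * n (f - y)) `^ theta <=
     e u + tf * q f (f - u) + (tau * n (f - u)) `^ theta + eps) ->
  q f (g - z) <= G * (q g (g - z) + n (g - z) `^ P + n (f - g) `^ P) ->
  q f (f - g) <= D -> n (f - g) <= del ->
  tf * q f (f - y) <= S -> tg * q g (g - z) <= S -> n (f - y) <= sig -> n (g - z) <= sig ->
  e (y - z) <= 4 * (3 * G * S + 2 * tb * D + 2 * tb * G * (sig `^ P + del `^ P) +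
    6 `^ theta * ((tau * sig) `^ theta + (tau * del) `^ theta) + eps).
Proof.
move=> th1 P0 G1 tb0 /andP[tbf tfb] tbg tau0 D0 S0 sig0 del0 eps0 LB LD LZ emid e0 qZ qD q0 n0 nZ nD
  Lf Lg Ly Lz ey1 ezy ymin pert fgD fgdel fyS gzS fysig gzsig.
have th0 : 0 <= theta by lra.
have tf0 : 0 < tf by lra.
pose u := 2^-1 *: (y + z).
have Lu : L u by apply: LZ; exact: LD.
have eu : e u = (e y + e z) / 2 - e (y - z) / 4 by exact: emid.
have eyz0 : 0 <= e (y - z) by apply: e0; exact: LB.
have eu1 : e u <= 1 by rewrite eu; lra.
have {}ymin := ymin u Lu eu1.
have a0 := mulr_ge0 (ltW tf0) (q0 f (f - y)).
have b0 := powR_ge0 (tau * n (f - y)) theta.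
have h1 : e (y - z) / 4 <= tf * q f (f - u) + (tau * n (f - u)) `^ theta + eps.
  by move: ymin a0 b0 ezy; rewrite eu; clear; move: (tf * _) (tf * _) (_ `^ _) (_ `^ _) => *; lra.
have quE : q f (f - u) <= (q f (f - y) + q f (f - z)) / 2.
  rewrite /u midpointB qZ; have := qD f (f - y) (f - z).
  by clear; rewrite exprVn; move: (q f _) (q f _) (q f _) => *; lra.
have qfz : q f (f - z) <= 2 * D + 2 * (G * (q g (g - z) + sig `^ P + del `^ P)).
  have -> : f - z = (f - g) + (g - z) by rewrite addrA subrK.
  apply: le_trans (qD _ _ _) _; apply: lerD; first by rewrite ler_pM2l.
  rewrite ler_pM2l//; apply: le_trans pert _; rewrite ler_wpM2l ?(le_trans _ G1)//.
  by apply: lerD; [rewrite lerD2l|]; apply: ler_powR2l.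
have hS : sig `^ P + del `^ P >= 0 by rewrite addr_ge0 ?powR_ge0.
have tqu : tf * q f (f - u) <= 3 * G * S + 2 * tb * D + 2 * tb * G * (sig `^ P + del `^ P).
  have t1 : tf * q f (f - u) <= tf * ((q f (f - y) + (2 * D + 2 * (G * (q g (g - z) + sig `^ P + del `^ P)))) / 2).
    by rewrite ler_pM2l//; move: quE qfz; clear; move: (q f _) (q f _) (q f _) (2 * D + _) => *; lra.
  apply: le_trans t1 _.
  have t2 : tf * D <= 2 * tb * D by rewrite ler_wpM2r.
  have t3 : tf * q g (g - z) <= 2 * S.
    have : tf * q g (g - z) <= 2 * tg * q g (g - z) by rewrite ler_wpM2r//; lra.
    by move: gzS; clear; rewrite -mulrA; lra.
  have t4 : G * (tf * q g (g - z)) <= G * (2 * S) by rewrite ler_wpM2l//; lra.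
  have t5 : tf * (G * (sig `^ P + del `^ P)) <= 2 * tb * (G * (sig `^ P + del `^ P)).
    by rewrite ler_wpM2r// mulr_ge0//; lra.
  have t6 : S <= G * S by rewrite ler_peMl.
  have -> : tf * ((q f (f - y) + (2 * D + 2 * (G * (q g (g - z) + sig `^ P + del `^ P)))) / 2) =
     tf * q f (f - y) / 2 + tf * D + G * (tf * q g (g - z)) + tf * (G * (sig `^ P + del `^ P)) by field.
  move: fyS t2 t4 t5 t6 S0; clear; rewrite -[2 * tb * G * _]mulrA -[3 * G * S]mulrA.
  rewrite [G * (2 * S)]mulrCA.
  by move: (tf * _) (tf * _) (G * (tf * _)) (tf * _) (G * S) (2 * tb * _) (2 * tb * _) => *; lra.
have nu : n (f - u) <= 3 * sig + 2 * del.
  rewrite /u midpointB nZ ger0_norm ?invr_ge0//.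
  have := nD (f - y) (f - z).
  have nfz : n (f - z) <= 2 * (del + sig).
    have -> : f - z = (f - g) + (g - z) by rewrite addrA subrK.
    by apply: le_trans (nD _ _) _; rewrite ler_pM2l// lerD.
  move: fysig nfz; clear; move: (n _) (n _) (n _) => *; lra.
have tau0' := ltW tau0.
have tn : (tau * n (f - u)) `^ theta <= 6 `^ theta * ((tau * sig) `^ theta + (tau * del) `^ theta).
  have ts0 : 0 <= tau * sig by exact: mulr_ge0.
  have td0 : 0 <= tau * del by exact: mulr_ge0.
  have : (tau * n (f - u)) `^ theta <= (3 * (tau * sig) + 3 * (tau * del)) `^ theta.
    apply: ler_powR2l => //; first exact: mulr_ge0.
    have : tau * n (f - u) <= tau * (3 * sig + 2 * del) by rewrite ler_wpM2l.
    by move: td0; rewrite mulrDr ![tau * (_ * _)]mulrCA; clear; move: (tau * _) (tau * _) (tau * _) => *; lra.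
  move=> /le_trans; apply; apply: le_trans (powRD_le _ _ th0) _; rewrite ?mulr_ge0//.
  rewrite ![(3 * _) `^ _]powRM// -mulrDr mulrA -powRM//.
  by have -> : 2 * 3 = 6 :> R by ring.
move: h1 tqu tn; clear; move: (tf * _) (_ `^ theta) => A B.
move: (3 * G * S + _ + _) (6 `^ _ * _) => *; lra.
Qed.

(** The ellipsoid labels compare y and z in the form of one point [f0] of the cell, whereas the
    penalties are given at f and g and the diameter is wanted at f. Each of the three changes of
    base point costs the factor G and P-th powers of n-distances. *)
Lemma euclid_cell_diameter (V : lmodType R) (n : V -> R) (q : V -> V -> R)
    (P G tb tf tg S sig del r : R) (f g f0 y z : V) :
  0 <= P -> 1 <= G -> 0 < tb -> tb <= tf -> tb <= tg ->
  0 <= S -> 0 <= sig -> 0 <= del ->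
  (forall f a h, q f (a *: h) = a ^+ 2 * q f h) ->
  (forall f h h', q f (h + h') <= 2 * q f h + 2 * q f h') ->
  (forall f h, 0 <= q f h) -> (forall h, 0 <= n h) ->
  q f (f - g) <= G * (q f0 (f - g) + n (f - g) `^ P + n (f - f0) `^ P) ->
  q f0 (f - y) <= G * (q f (f - y) + n (f - y) `^ P + n (f0 - f) `^ P) ->
  q f0 (g - z) <= G * (q g (g - z) + n (g - z) `^ P + n (f0 - g) `^ P) ->
  n (f - g) <= del -> n (f - f0) <= del -> n (f0 - f) <= del -> n (f0 - g) <= del ->
  tf * q f (f - y) <= S -> tg * q g (g - z) <= S -> n (f - y) <= sig -> n (g - z) <= sig ->
  q f0 (y - z) <= r ->
  q f (f - g) <= 6 * (G * G) * (S / tb + sig `^ P + del `^ P) + 4 * G * r + 2 * G * del `^ P.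
Proof.
move=> P0 G1 tb0 tbf tbg S0 sig0 del0 qZ qD q0 n0 p1 p2 p3 fg ff0 f0f f0g fyS gzS fysig gzsig yz.
have G0 : 0 <= G by lra.
have np h c : n h <= c -> n h `^ P <= c `^ P by move=> hc; apply: ler_powR2l.
have div t h f' : tb <= t -> t * q f' h <= S -> q f' h <= S / tb.
  move=> tbt hS; rewrite ler_pdivlMr// mulrC; apply: le_trans hS.
  by rewrite ler_wpM2r.
have h2 : q f0 (f - y) <= G * (S / tb + sig `^ P + del `^ P).
  by apply: le_trans p2 _; rewrite ler_wpM2l// !lerD ?np//; exact: div tbf fyS.
have h3 : q f0 (g - z) <= G * (S / tb + sig `^ P + del `^ P).
  by apply: le_trans p3 _; rewrite ler_wpM2l// !lerD ?np//; exact: div tbg gzS.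
have qN h : q f0 (- h) = q f0 h by rewrite -scaleN1r qZ sqrrN expr1n mul1r.
have h1 : q f0 (f - g) <= 6 * (G * (S / tb + sig `^ P + del `^ P)) + 4 * r.
  have -> : f - g = (f - y) + ((y - z) + - (g - z)).
    by rewrite opprB addrA (addrA (f - y)) subrK addrA subrK.
  apply: le_trans (qD _ _ _) _.
  have := qD f0 (y - z) (- (g - z)); rewrite qN.
  by move: h2 h3 yz; clear; move: (q f0 _) (q f0 _) (q f0 _) (q f0 _) (G * _) => *; lra.
apply: le_trans p1 _.
apply: (@le_trans _ _ (G * (6 * (G * (S / tb + sig `^ P + del `^ P)) + 4 * r + del `^ P + del `^ P))).
  by rewrite ler_wpM2l// !lerD ?np.
by rewrite le_eqVlt; apply/orP; left; apply/eqP; ring.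
Qed.

End euclid_minimizers.

Section euclid_sums.
Context {R : realType}.

(** As tb H = a2, the old diameter enters with 4 G * 4 * 2 a2 = 32 G a2, which the equation for [a2]
    makes 1/64. *)
Lemma euclid_step_arith (G a2 H X D S Tq Td eps s d tb : R) :
  1 <= G -> 0 < a2 <= 1 -> 32 * (G * a2) = 64^-1 -> 0 < H -> tb = a2 / H -> 0 <= X ->
  0 <= S -> 0 <= Tq -> 0 <= Td -> 0 <= eps -> 0 <= s -> 0 <= d ->
  6 * (G * G) * (S / tb + s + d) +
    4 * G * (4 * (3 * G * S + 2 * tb * D + 2 * tb * G * (s + d) + X * (Tq + Td) + eps) * H) +
    2 * G * d <=
  64^-1 * D + (6 * (G * G) / a2 + (60 * (G * G) + 16 * (G * X))) * (H * (S + Tq + Td + eps) + s + d).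
Proof.
move=> G1 /andP[a20 a21] Ga H0 tbE X0 S0 Tq0 Td0 eps0 s0 d0.
have G0 : 0 <= G by apply: le_trans G1.
pose W := G * G; have GW : G <= W by rewrite ler_peMr.
have W0 : 0 <= W by exact: le_trans GW.
pose U := 6 * W / a2; have U0 : 0 <= U by rewrite divr_ge0 ?(ltW a20)// mulr_ge0.
pose Z := G * X; have Z0 : 0 <= Z by exact: mulr_ge0.
have e1 : 6 * W * (S / tb + s + d) = U * (H * S) + 6 * W * (s + d).
  by rewrite tbE /U; field; rewrite !gt_eqF.
have e2 : 4 * G * (4 * (3 * G * S + 2 * tb * D + 2 * tb * G * (s + d) + X * (Tq + Td) + eps) * H) =
    48 * (W * (H * S)) + 32 * (G * a2) * D + 32 * (W * a2) * (s + d) +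
    16 * (Z * (H * Tq + H * Td)) + 16 * (G * (H * eps)).
  by rewrite tbE /W /Z; field; rewrite gt_eqF.
rewrite -/W e1 e2 Ga -/U -/Z.
have hS : 0 <= H * S by rewrite mulr_ge0// ltW.
have hq : 0 <= H * Tq by rewrite mulr_ge0// ltW.
have hd : 0 <= H * Td by rewrite mulr_ge0// ltW.
have he : 0 <= H * eps by rewrite mulr_ge0// ltW.
have wa : 32 * (W * a2) * (s + d) <= 32 * W * (s + d).
  rewrite ler_wpM2r ?addr_ge0// ler_pM2l//.
  by rewrite ler_piMr.
rewrite !mulrDr.
move: wa hS hq hd he; move: (H * S) (H * Tq) (H * Td) (H * eps) => hs hq hd he.
move=> wa hs0 hq0 hd0 he0.
have p1 := mulr_ge0 U0 (addr_ge0 hq0 (addr_ge0 hd0 (addr_ge0 he0 (addr_ge0 s0 d0)))).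
have p2 := mulr_ge0 W0 (addr_ge0 hs0 (addr_ge0 hq0 (addr_ge0 hd0 (addr_ge0 he0 (addr_ge0 s0 d0))))).
have p2s := mulr_ge0 W0 s0.
have p2d := mulr_ge0 W0 d0.
have p2e := mulr_ge0 W0 he0.
have p2hs := mulr_ge0 W0 hs0.
have p2q := mulr_ge0 W0 (addr_ge0 hq0 hd0).
have p3 := mulr_ge0 Z0 (addr_ge0 hs0 (addr_ge0 he0 (addr_ge0 s0 d0))).
have p4 : G * d <= W * d by rewrite ler_wpM2r.
have p5 : G * he <= W * he by rewrite ler_wpM2r.
clearbody U Z; clearbody W.
move: wa p1 p2 p2s p2d p2e p2hs p2q p3 p4 p5; clear; lra.
Qed.

Lemma sqrt_pow2_powR (p X : R) (k : nat) : 0 < p -> 0 <= X ->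
  Num.sqrt (2 ^+ k * X `^ (p * 2)) = (2 `^ (k%:R / (p * 2)) * X) `^ p.
Proof.
move=> p0 X0; rewrite powRM ?powR_ge0// -powRrM.
have -> : k%:R / (p * 2) * p = k%:R / 2 by field; rewrite gt_eqF.
rewrite sqrtrM ?exprn_ge0// [2 `^ (_ / 2)]powRrM powR12_sqrt ?powR_ge0// powR_mulrn//.
by congr (_ * _); rewrite powRrM powR_mulrn ?powR_ge0// sqrtr_sqr ger0_norm ?powR_ge0.
Qed.

(** Separates entropies, whose weighted sum is of order V2, from penalties, whose sum is bounded:
    with the weight sqrt V2 both halves sum to a multiple of sqrt V2. *)
Lemma sqrt_amgm (V2 x y : R) : 0 < V2 -> 0 <= x -> 0 <= y ->
  Num.sqrt (x * y) <= (x / Num.sqrt V2 + Num.sqrt V2 * y) / 2.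
Proof.
move=> V20 x0 y0; set v := Num.sqrt V2.
have v0 : 0 < v by rewrite sqrtr_gt0.
have -> : x * y = (x / v) * (v * y) by field; rewrite gt_eqF.
have a0 : 0 <= x / v by rewrite divr_ge0// ltW.
have b0 : 0 <= v * y by rewrite mulr_ge0// ltW.
rewrite sqrtrM// -{2}(sqr_sqrtr a0) -{2}(sqr_sqrtr b0).
move: (Num.sqrt _) (Num.sqrt _) => s t; have := sqr_ge0 (s - t); rewrite sqrrB; lra.
Qed.

(** The ratio 1/64 is made for square roots: sqrt(2/64) <= 1/4, so [contraction_sum] applies with
    exponent 1. Products of entropy and penalties are split by [sqrt_amgm]; the terms with [Tq] or
    [del] alone become p-th powers of sequences in l_theta and produce the logarithm. *)
Lemma euclid_sum (theta p C1 CB ce C3 : R) : 1 <= theta -> 0 < p -> 0 <= C1 -> 0 <= CB ->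
  0 <= ce -> 0 <= C3 ->
  exists2 C, 0 <= C & forall (V2 E : R) (K : nat) (D b ent S2 T del H S Tq : nat -> R),
  0 < V2 -> 0 < E ->
  (forall k, 0 <= D k) -> (forall k, 0 <= b k) -> D 0%N = 4 * V2 ->
  (forall k, D k.+1 = 64^-1 * D k + b k.+1) ->
  let tau k := 2 `^ (k%:R / (p * 2)) / E in
  (forall k, (k < K)%N -> b k.+1 = C3 * (H k * (S k + Tq k + (tau k.+1 * del k) `^ theta + 2^-1 ^+ k.+1)
     + (Tq k `^ theta^-1 / tau k.+1) `^ (p * 2) + del k `^ (p * 2))) ->
  (forall k, 0 <= H k <= 2 * ent k.+1) ->
  (forall k, 0 <= S k <= S2 k.+1 + 2^-1 ^+ k.+1) ->
  (forall k, 0 <= Tq k <= T k.+1 + 2^-1 ^+ k.+1) ->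
  (forall k, 0 <= del k) -> (forall k, 0 <= S2 k) -> (forall k, 0 <= T k) -> (forall k, 0 <= ent k) ->
  (forall n, \sum_(k < n) (S2 k + T k) <= C1) ->
  (forall n, \sum_(k < n) 2 ^+ k * ent k <= ce * V2) ->
  (forall n, \sum_(k < n) (tau k * del k) `^ theta <= CB) ->
  \sum_(k < K.+1) Num.sqrt (2 ^+ k * D k) <=
    C * (Num.sqrt V2 + E `^ p * K.+1%:R `^ Num.max (1 - p / theta) 0).
Proof.
move=> th1 p0 C10 CB0 ce0 C30.
have th0 : 0 < theta by apply: lt_le_trans th1.
pose om : R := 2 `^ (p * 2)^-1.
have om0 : 0 <= om by exact: powR_ge0.
pose CY := C1 + 6 + om `^ theta * CB.
have CY0 : 0 <= CY by apply: addr_ge0; [exact: addr_ge0|apply: mulr_ge0 => //; exact: powR_ge0].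
pose CT := 1 + (C1 + 2) + (C1 + 2) `^ (p / theta).
have CT0 : 0 <= CT by apply: addr_ge0; [apply: addr_ge0 => //; exact: addr_ge0|exact: powR_ge0].
pose CD := om `^ p * (1 + CB + CB `^ (p / theta)).
have CD0 : 0 <= CD.
  by apply: mulr_ge0; [exact: powR_ge0|apply: addr_ge0; [exact: addr_ge0|exact: powR_ge0]].
pose CS := 4 * (Num.sqrt C3 * (ce + CY + CT + CD)) + 4.
have s30 := sqrtr_ge0 C3.
exists CS.
  by apply: addr_ge0 => //; do 2![apply: mulr_ge0 => //]; do 3![apply: addr_ge0 => //].
move=> V2 E K D b ent S2 T del H S Tq V20 E0 D0 b0 D00 DS tau bE HE SE TE del0 S20 T0 ent0 sumST sument sumdel.
have Ei0 : 0 <= E^-1 by rewrite invr_ge0 ltW.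
have tau0 k : 0 < tau k by rewrite divr_gt0 ?powR_gt0.
have tauS k : tau k.+1 = om * tau k.
  rewrite /tau /om mulrA -powRD ?pnatr_eq0 ?implybT//; congr (_ `^ _ / _).
  by rewrite -(natr1 k); field; rewrite gt_eqF.
pose M := E `^ p * K.+1%:R `^ Num.max (1 - p / theta) 0.
have M0 : 0 <= M by rewrite mulr_ge0 ?powR_ge0.
pose v := Num.sqrt V2; have v0 : 0 < v by rewrite sqrtr_gt0.
have vv : V2 / v = v by rewrite -{1}(sqr_sqrtr (ltW V20)) expr2 mulfK// gt_eqF.
pose x k := Num.sqrt (2 ^+ k * D k).
pose y k := if k is 0%N then 0 else Num.sqrt (2 ^+ k * b k).
have x0 k : 0 <= x k by exact: sqrtr_ge0.
have y0 k : 0 <= y k by case: k => [|k]; [exact: lexx|exact: sqrtr_ge0].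
have xy k : x k.+1 <= x k / 4 + y k.+1.
  rewrite /x DS mulrDr.
  apply: le_trans (sqrtrD_le _ _) _; rewrite ?mulr_ge0 ?exprn_ge0 ?invr_ge0 ?D0 ?b0//.
  rewrite lerD2r.
  have -> : 2 ^+ k.+1 * (64^-1 * D k) = 32^-1 * (2 ^+ k * D k) by rewrite exprS; field.
  rewrite sqrtrM ?invr_ge0// mulrC ler_wpM2l ?sqrtr_ge0//.
  rewrite -[leRHS]ger0_norm ?invr_ge0// -sqrtr_sqr ler_wsqrtr// exprVn.
  by rewrite lef_pV2 ?posrE ?exprn_gt0// expr2; lra.
have pw1 (F : nat -> R) : (forall k, 0 <= F k) ->
    \sum_(k < K.+1) F k `^ 1 = \sum_(k < K.+1) F k.
  by move=> F0; apply: eq_bigr => k _; rewrite powRr1.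
have := contraction_sum (lexx 1) x0 y0 xy K.+1.
rewrite (pw1 x x0) (pw1 y y0) !powRr1//; move=> /le_trans; apply.
have x00 : x 0%N = 2 * v.
  rewrite /x D00 expr0 mul1r sqrtrM//; congr (_ * _).
  by rewrite (_ : 4 = 2 ^+ 2) ?sqrtr_sqr ?ger0_norm// expr2; ring.
rewrite x00 big_ord_recl/= add0r.
have [Y YE] : {Y : nat -> R | forall k, Y k = S k + Tq k + (tau k.+1 * del k) `^ theta + 2^-1 ^+ k.+1}.
  by eexists.
have Y0 k : 0 <= Y k.
  have /andP[h1 _] := SE k; have /andP[h2 _] := TE k.
  by rewrite YE addr_ge0 ?exprn_ge0// addr_ge0 ?powR_ge0// addr_ge0.
pose zT k := Tq k `^ theta^-1.
pose zd k := tau k * del k.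
have yk k : (k < K)%N -> y k.+1 <= Num.sqrt C3 *
    ((2 ^+ k.+1 * H k / v + v * Y k) / 2 + E `^ p * zT k `^ p + E `^ p * (om `^ p * zd k `^ p)).
  move=> kK; rewrite /y.
  have -> : 2 ^+ k.+1 * b k.+1 = C3 * (2 ^+ k.+1 * (H k * Y k) +
      2 ^+ k.+1 * (zT k / tau k.+1) `^ (p * 2) + 2 ^+ k.+1 * del k `^ (p * 2)).
    by rewrite bE// -YE mulrCA; congr (_ * _); rewrite !(mulrDr (2 ^+ k.+1)).
  rewrite sqrtrM// ler_wpM2l//.
  have H0 : 0 <= H k by case/andP: (HE k).
  have w0 : 0 <= 2 ^+ k.+1 :> R by rewrite exprn_ge0.
  have tq0 : 0 <= zT k / tau k.+1 by rewrite divr_ge0 ?powR_ge0// ltW.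
  have hHY : 0 <= 2 ^+ k.+1 * (H k * Y k) by rewrite mulr_ge0// mulr_ge0.
  have hq : 0 <= 2 ^+ k.+1 * (zT k / tau k.+1) `^ (p * 2) by rewrite mulr_ge0 ?powR_ge0.
  have hd : 0 <= 2 ^+ k.+1 * del k `^ (p * 2) by rewrite mulr_ge0 ?powR_ge0.
  apply: le_trans (sqrtrD_le (addr_ge0 hHY hq) hd) _.
  apply: lerD; last first.
    rewrite sqrt_pow2_powR// -!powRM ?mulr_ge0 ?(ltW (tau0 _)) ?(ltW E0)//.
    apply: ler_powR2l; rewrite ?mulr_ge0 ?powR_ge0 ?(ltW p0)//.
    rewrite /zd (mulrA om) -tauS /tau le_eqVlt; apply/orP; left; apply/eqP.
    by field; rewrite gt_eqF.
  apply: le_trans (sqrtrD_le hHY hq) _; apply: lerD.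
    by rewrite mulrA; apply: sqrt_amgm => //; exact: mulr_ge0.
  rewrite sqrt_pow2_powR// -powRM ?powR_ge0 ?(ltW E0)//.
  apply: ler_powR2l; [exact: (mulr_ge0 (powR_ge0 _ _) tq0)| |exact: ltW].
  have -> : 2 `^ (k.+1%:R / (p * 2)) = E * tau k.+1.
    by rewrite /tau [RHS]mulrC divfK// gt_eqF.
  by rewrite -mulrA [tau _ * _]mulrC divfK// gt_eqF.
have sum2 n : \sum_(k < n) 2^-1 ^+ k.+1 <= 1 :> R.
  have := @sum_expr2V R n.+1; rewrite big_ord_recl expr0; lra.
have shift (F : nat -> R) (c : R) n : (forall k, 0 <= F k) -> (forall n, \sum_(k < n) F k <= c) ->
    \sum_(k < n) F k.+1 <= c.
  move=> F0 Fc; apply: le_trans (Fc n.+1); rewrite big_ord_recl lerDr; exact: F0.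
have sumT : \sum_(k < K) Tq k <= C1 + 2.
  apply: (@le_trans _ _ (\sum_(k < K) ((S2 k.+1 + T k.+1) + 2^-1 ^+ k.+1))).
    by apply: ler_sum => k _; have /andP[_] := TE k; have := S20 k.+1; lra.
  rewrite big_split/=; have := shift (fun k => S2 k + T k) C1 K (fun k => addr_ge0 (S20 k) (T0 k)) sumST.
  have := sum2 K; lra.
have sumzd n : \sum_(k < n) (tau k.+1 * del k) `^ theta <= om `^ theta * CB.
  apply: le_trans (_ : om `^ theta * \sum_(k < n) zd k `^ theta <= _); last by rewrite ler_wpM2l ?powR_ge0.
  rewrite mulr_sumr; apply: ler_sum => k _.
  by rewrite tauS -mulrA powRM// mulr_ge0// ltW.
have sumY : \sum_(k < K) Y k <= CY.
  apply: (@le_trans _ _ (\sum_(k < K) ((S2 k.+1 + T k.+1) + 3 * 2^-1 ^+ k.+1 + (tau k.+1 * del k) `^ theta))).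
    apply: ler_sum => k _; rewrite YE; have /andP[_] := TE k; have /andP[_] := SE k; lra.
  rewrite !big_split/= -mulr_sumr; have := sumzd K.
  have := shift (fun k => S2 k + T k) C1 K (fun k => addr_ge0 (S20 k) (T0 k)) sumST.
  rewrite big_split/=; have := sum2 K; rewrite /CY; lra.
have sumH : \sum_(k < K) 2 ^+ k.+1 * H k <= 2 * (ce * V2).
  apply: (@le_trans _ _ (\sum_(k < K) 2 * (2 ^+ k.+1 * ent k.+1))).
    by apply: ler_sum => k _; rewrite mulrCA ler_wpM2l ?exprn_ge0//; case/andP: (HE k).
  rewrite -mulr_sumr ler_pM2l//.
  apply: (shift (fun k => 2 ^+ k * ent k)) => // k.
  by rewrite mulr_ge0 ?exprn_ge0.
have K0 : (0 < K.+1)%N by [].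
have szK : (size (index_iota 0 K) <= K.+1)%N by rewrite size_iota subn0.
have sumzT : \sum_(k < K) zT k `^ p <= CT * K.+1%:R `^ Num.max (1 - p / theta) 0.
  have := @sum_powR_le R nat (index_iota 0 K) zT K.+1 p theta (C1 + 2) p0 th0 (addr_ge0 C10 (ler0n _ 2)) K0 szK.
  rewrite !big_mkord; apply; first by move=> k; exact: powR_ge0.
  apply: le_trans sumT; apply: ler_sum => k _; rewrite /zT powRVK ?gt_eqF//.
  by case/andP: (TE k).
have sumzdp : \sum_(k < K) zd k `^ p <= (1 + CB + CB `^ (p / theta)) * K.+1%:R `^ Num.max (1 - p / theta) 0.
  have := @sum_powR_le R nat (index_iota 0 K) zd K.+1 p theta CB p0 th0 CB0 K0 szK.
  rewrite !big_mkord; apply => // k.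
  by rewrite mulr_ge0// ltW.
have sumy : \sum_(k < K) y k.+1 <= Num.sqrt C3 * ((ce + CY) * v + (CT + CD) * M).
  apply: le_trans (ler_sum _ (fun (k : 'I_K) _ => yk k (ltn_ord k))) _.
  rewrite -mulr_sumr ler_wpM2l// !big_split/=.
  have -> : (ce + CY) * v + (CT + CD) * M = (ce + CY) * v + CT * M + CD * M by ring.
  apply: lerD; first apply: lerD.
  - rewrite -mulr_suml big_split/= -mulr_suml -mulr_sumr.
    have h1 : (\sum_(k < K) 2 ^+ k.+1 * H k) / v <= 2 * (ce * v).
      apply: (@le_trans _ _ (2 * (ce * V2) / v)); first by rewrite ler_pM2r ?invr_gt0.
      by rewrite -!mulrA vv.
    have h2 : v * (\sum_(k < K) Y k) <= v * CY by rewrite ler_pM2l.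
    have h3 : 0 <= v * CY by rewrite mulr_ge0// ltW.
    move: h1 h2 h3; clear; rewrite mulrDl; move: (_ / v) (v * _) => *; lra.
  - rewrite -mulr_sumr /M [leRHS]mulrCA ler_wpM2l ?powR_ge0//.
  - rewrite -!mulr_sumr /M [leRHS]mulrCA ler_wpM2l ?powR_ge0// /CD -mulrA ler_wpM2l ?powR_ge0//.
apply: (@le_trans _ _ (2 * (2 * v + 2 * (Num.sqrt C3 * ((ce + CY) * v + (CT + CD) * M))))).
  by rewrite ler_pM2l// lerD2l ler_pM2l.
rewrite -/v -/M /CS.
have q1 : 0 <= Num.sqrt C3 * ((ce + CY) * M) by do 2![apply: mulr_ge0 => //]; exact: addr_ge0.
have q2 : 0 <= Num.sqrt C3 * ((CT + CD) * v).
  by do 2![apply: mulr_ge0 => //]; [exact: addr_ge0|exact: ltW].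
move: q1 q2 M0; clear; move: (Num.sqrt C3) M v => a M v q1 q2 M0.
have -> : (4 * (a * (ce + CY + CT + CD)) + 4) * (v + M) =
  4 * (a * ((ce + CY) * v)) + 4 * (a * ((ce + CY) * M)) + 4 * (a * ((CT + CD) * v)) +
  4 * (a * ((CT + CD) * M)) + 4 * v + 4 * M by ring.
rewrite [a * (_ * v + _ * M)]mulrDr; move: q1 q2.
move: (a * _) (a * _) (a * _) (a * _) => *; lra.
Qed.

End euclid_sums.

Section euclid_chaining.
Context {R : realType}.

(* As in [convex_chaining], with the functional
   [e y + a2 * q f (f - y) / ent k f + (tau_k * n (f - y)) ^ theta], where [e] is the square
   of a Euclidean norm.  The quadratic form [q f] depends on [f]; its variation is controlled
   by the [n]-distance, hence the last term and the labels [c1]. *)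
Theorem euclid_chaining (theta p G CB ce : R) (J : nat) :
  1 <= theta -> 0 < p -> 1 <= G -> 0 <= CB -> 0 <= ce -> ce < 2 ^+ J ->
  exists2 C, 0 <= C & forall (V : lmodType R) (L B0 : set V) (e n : V -> R) (q : V -> V -> R)
    (ent : nat -> V -> R) (V2 E : R) (c1 : nat -> V -> nat) (del : nat -> V -> R) (K : nat),
  let P := p * 2 in
  (forall f g, L f -> L g -> L (f - g)) -> (forall f g, L f -> L g -> L (f + g)) ->
  (forall a f, L f -> L (a *: f)) ->
  (forall f g, L f -> L g -> e (2^-1 *: (f + g)) = (e f + e g) / 2 - e (f - g) / 4) ->
  (forall f, L f -> 0 <= e f) ->
  (forall a f, L f -> e (a *: f) = a ^+ 2 * e f) ->
  (forall f a h, q f (a *: h) = a ^+ 2 * q f h) ->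
  (forall f h h', q f (h + h') <= 2 * q f h + 2 * q f h') ->
  (forall f h, 0 <= q f h) ->
  (forall h, 0 <= n h) ->
  (forall a h, n (a *: h) = `|a| * n h) ->
  (forall h h', n (h + h') <= 2 * (n h + n h')) ->
  B0 `<=` L -> (forall f, B0 f -> e f <= 1) ->
  (forall f g h, B0 f -> B0 g -> q f h <= G * (q g h + n h `^ P + n (f - g) `^ P)) ->
  chained B0 6 n del c1 ->
  0 < E -> (forall N f, B0 f -> \sum_(k < N) (2 `^ (k%:R / P) * del k f / E) `^ theta <= CB) ->
  0 < V2 -> (forall k f, B0 f -> V2 * 4^-1 ^+ k <= ent k f) ->
  (forall k f, B0 f -> ent k.+1 f <= 2 / 3 * ent k f) ->
  (forall N f, B0 f -> \sum_(k < N) 2 ^+ k * ent k f <= ce * V2) ->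
  (forall k f, B0 f -> (k <= K)%N -> exists l : V -> nat,
     (forall h, L h -> e h <= 1 -> (l h < 2 ^ (18 * 2 ^ k))%N) /\
     forall h h', L h -> L h' -> e h <= 1 -> e h' <= 1 -> l h = l h' -> q f (h - h') <= ent k f) ->
  (forall f g, B0 f -> B0 g -> q f (f - g) <= 4 * V2) ->
  exists (c : nat -> V -> nat) (D : nat -> V -> R),
    [/\ nested_labels B0 (60 + J) c, label_constant B0 c D,
        forall k f, B0 f -> 0 <= D k f,
        forall k f g, B0 f -> B0 g -> c k f = c k g -> q f (f - g) <= D k f &
        forall f, B0 f -> \sum_(k < K.+1) Num.sqrt (2 ^+ k * D k f) <=
          C * (Num.sqrt V2 + E `^ p * K.+1%:R `^ Num.max (1 - p / theta) 0)].
Proof.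
move=> th1 p0 G1 CB0 ce0 ceJ.
have th0 : 0 < theta by exact: lt_le_trans th1.
have G0 : 0 < G by exact: lt_le_trans G1.
have P0 : 0 < p * 2 by rewrite mulr_gt0.
pose om : R := 2 `^ (p * 2)^-1.
have om1 : 1 < om.
  have := @gt0_ltr_powR R (p * 2)^-1; rewrite invr_gt0 => /(_ P0 1 2).
  by rewrite powR1; apply; rewrite ?nnegrE//; lra.
have omth : 0 < om `^ (- theta) < 1.
  have om0 : 0 < om by exact: lt_trans om1.
  rewrite powR_gt0//= powRN invf_lt1 ?powR_gt0//.
  by have := @gt0_ltr_powR R theta th0 1 om; rewrite powR1; apply; rewrite ?nnegrE// ltW.
have [a2 a2E] : {a2 : R | a2 = (32 * (64 * G))^-1} by eexists.
have a20 : 0 < a2 by rewrite a2E invr_gt0; do 2![apply: mulr_gt0 => //].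
have Ga : 32 * (G * a2) = 64^-1 by rewrite a2E; field; rewrite gt_eqF.
have a21 : a2 <= 1.
  rewrite a2E invf_le1; last by do 2![apply: mulr_gt0 => //].
  by apply: mulr_ege1; [lra|apply: mulr_ege1; [lra|]].
(* Two penalties of different growth: going down from level k + 1 to k keeps at most 2/3 of the
   quadratic one, as [ent] drops by 2/3, and om^-theta of the other. *)
pose kap := Num.min 3^-1 (1 - om `^ (- theta)).
have kap01 : 0 < kap <= 1.
  rewrite /kap lt_min ge_min invr_gt0 ltr0n/= subr_gt0; case/andP: omth => _ ->/=.
  by apply/orP; left; lra.
pose C3 := 6 * (G * G) / a2 + (60 * (G * G) + 16 * (G * 6 `^ theta)).
have GG0 : 0 <= G * G by apply: mulr_ge0; exact: ltW.
have C30 : 0 <= C3.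
  apply: addr_ge0; first by apply: divr_ge0; [exact: mulr_ge0|exact: ltW].
  apply: addr_ge0; first exact: mulr_ge0.
  by apply: mulr_ge0 => //; apply: mulr_ge0; [exact: ltW|exact: powR_ge0].
have C10 : 0 <= 6 / kap by rewrite divr_ge0// ltW//; case/andP: kap01.
have [C C0 esum] := @euclid_sum R theta p (6 / kap) CB ce C3 th1 p0 C10 CB0 ce0 C30.
exists C => // V L B0 e n q ent V2 E c1 del K P LB LD LZ emid e0 eZ qZ qD q0 n0 nZ nD B0L Be pert
  [[c1A c1n] del_const del0 c1del] E0 sumdel V20 entlo entS sument entlab qdiam.
have [tau tauE] : {tau : nat -> R | forall k, tau k = 2 `^ (k%:R / P) / E} by eexists.
have tau0 k : 0 < tau k by rewrite tauE divr_gt0 ?powR_gt0.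
have tauS k : tau k.+1 = om * tau k.
  rewrite !tauE /om mulrA -powRD ?pnatr_eq0 ?implybT//; congr (_ `^ _ / _).
  by rewrite -(natr1 k) /P; field; rewrite gt_eqF.
have ent0 k f : B0 f -> 0 < ent k f.
  by move=> Bf; apply: lt_le_trans (entlo k f Bf); rewrite mulr_gt0// exprn_gt0.
pose Phi k f y := e y + a2 / ent k f * q f (f - y) + (tau k * n (f - y)) `^ theta.
pose D0 := [set y | L y /\ e y <= 1].
have B0D f : B0 f -> D0 f by move=> Bf; split; [exact: B0L|exact: Be].
have Phi_ge0 k f y : B0 f -> L y -> 0 <= Phi k f y.
  move=> Bf Ly; rewrite /Phi addr_ge0 ?powR_ge0// addr_ge0 ?e0// mulr_ge0// divr_ge0 ?(ltW a20)//.
  by rewrite ltW// ent0.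
have [pi piP] : exists pi : nat -> V -> V, forall k f, B0 f ->
    D0 (pi k f) /\ forall z, D0 z -> Phi k f (pi k f) <= Phi k f z + 2^-1 ^+ k.
  have /choice[pi piP] : forall kf : nat * V, exists y, B0 kf.2 ->
      D0 y /\ forall z, D0 z -> Phi kf.1 kf.2 y <= Phi kf.1 kf.2 z + 2^-1 ^+ kf.1.
    move=> [k f]/=; have [Bf|nBf] := pselect (B0 f); last by exists f.
    have [|||y Dy yP] := @approx_min R V D0 (Phi k f) (2^-1 ^+ k).
    - by exists f; exact: B0D.
    - by move=> y [Ly _]; exact: Phi_ge0.
    - by rewrite exprn_gt0.
    by exists y.
  by exists (fun k f => pi (k, f)) => k f Bf; exact: (piP (k, f) Bf).
have piL k f : B0 f -> L (pi k f) by move=> /(piP k)[[]].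
have pi1 k f : B0 f -> e (pi k f) <= 1 by move=> /(piP k)[[]].
pose S2 k f := a2 / ent k f * q f (f - pi k f).
pose T k f := (tau k * n (f - pi k f)) `^ theta.
have S20 k f : B0 f -> 0 <= S2 k f.
  by move=> Bf; rewrite /S2 mulr_ge0// divr_ge0 ?(ltW a20)// ltW// ent0.
have T0 k f : 0 <= T k f by exact: powR_ge0.
have n00 : n 0 = 0 by rewrite -(scale0r 0) nZ normr0 mul0r.
have q00 f : q f 0 = 0 by rewrite -(scale0r 0) qZ expr0n mul0r.
have K2 k f : B0 f -> 0 <= Phi k f (pi k f) <= 2.
  move=> Bf; apply/andP; split; first by apply: Phi_ge0 => //; exact: piL.
  have PhiE : Phi k f f = e f.
    by rewrite /Phi subrr n00 q00 !mulr0 powR0 ?addr0// gt_eqF.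
  have [_ /(_ f (B0D f Bf))] := piP k f Bf; rewrite PhiE => h; apply: le_trans h _.
  have h : 2^-1 ^+ k <= 1 :> R by rewrite exprn_ile1//; lra.
  by rewrite (_ : 2 = 1 + 1)// lerD// Be.
have ST2 k f : B0 f -> S2 k f + T k f <= 2.
  move=> Bf; have /andP[_] := K2 k f Bf; apply: le_trans.
  by rewrite /Phi -addrA lerDr; apply: e0; exact: piL.
have S2le k f : B0 f -> S2 k f <= 2.
  by move=> Bf; apply: le_trans (ST2 k f Bf); rewrite lerDl.
have Tle k f : B0 f -> T k f <= 2.
  by move=> Bf; apply: le_trans (ST2 k f Bf); rewrite lerDr S20.
have STsum N f : B0 f -> \sum_(k < N) (S2 k f + T k f) <= 6 / kap.
  move=> Bf; apply: (@telescope_bound R (fun k => Phi k f (pi k f)) (fun k => S2 k f + T k f) kap) => //.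
  - by move=> k; exact: K2.
  - exact: ST2.
  - move=> k; have [_ /(_ (pi k.+1 f) (piP k.+1 f Bf).1)] := piP k f Bf.
    set y := pi k.+1 f.
    have hq : a2 / ent k f * q f (f - y) <= 2 / 3 * S2 k.+1 f.
      rewrite /S2 -/y mulrA ler_wpM2r// mulrA [2 / 3 * a2]mulrC -mulrA ler_pM2l//.
      have h1 := ent0 k f Bf; have h2 := ent0 k.+1 f Bf.
      rewrite -[leLHS]mul1r ler_pdivrMr// mulrAC ler_pdivlMr// mul1r.
      exact: entS.
    have hn : (tau k * n (f - y)) `^ theta = om `^ (- theta) * T k.+1 f.
      have om0 : 0 < om by exact: lt_trans om1.
      have hh : 0 <= tau k * n (f - y) := mulr_ge0 (ltW (tau0 k)) (n0 _).
      rewrite /T tauS -/y -mulrA (powRM _ (ltW om0) hh).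
      by rewrite powRN mulKf// gt_eqF// powR_gt0.
    have k1 : kap <= 3^-1 by rewrite /kap ge_min lexx.
    have k2 : kap <= 1 - om `^ (- theta) by rewrite /kap ge_min lexx orbT.
    have m1 : kap * S2 k.+1 f <= 3^-1 * S2 k.+1 f by rewrite ler_wpM2r// S20.
    have m2 : kap * T k.+1 f <= (1 - om `^ (- theta)) * T k.+1 f by rewrite ler_wpM2r.
    have PE : Phi k.+1 f y = e y + S2 k.+1 f + T k.+1 f by [].
    have PE' : Phi k f y = e y + a2 / ent k f * q f (f - y) + om `^ (- theta) * T k.+1 f.
      by rewrite /Phi hn.
    rewrite PE PE' mulrDr; move: hq m1 m2; clear; rewrite mulrBl mul1r.
    move: (S2 k.+1 f) (T k.+1 f) (e y) (Phi k f _) (a2 / _ * _) (om `^ _ * _) (2^-1 ^+ k) => *; lra.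
have nB f g : n (f - g) = n (g - f).
  have -> : f - g = (-1) *: (g - f) by rewrite scaleN1r opprB.
  by rewrite nZ normrN1 mul1r.
(* The grid has level 2 j because ent >= V2 4^-j: an additive error V2 4^-j at most doubles the
   entropy. The hypothesis on [ce] and [J] bounds the number of grid values. *)
pose g1 j f := grid_label (2 * j) (ent j f / V2).
pose g2 j f := grid_label j (S2 j f).
pose g3 j f := grid_label j (T j f).
(* The [n]-label is that of level j - 1, matching the use of [del k] in the bound [b] of level k +
   1. *)
pose prel j f := (((c1 j.-1 f * 2 ^ (2 * j + J) + g1 j f) * 2 ^ (j + 2) + g2 j f) * 2 ^ (j + 2) + g3 j f)%N.
have g1lt j f : B0 f -> (g1 j f < 2 ^ (2 * j + J))%N.
  move=> Bf; apply: grid_label_lt; first by rewrite divr_ge0// ltW// ent0.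
  apply: le_lt_trans ceJ; rewrite ler_pdivrMr//.
  apply: le_trans (sument j.+1 f Bf).
  rewrite big_ord_recr/=; apply: (@le_trans _ _ (2 ^+ j * ent j f)).
    by rewrite ler_peMl ?(ltW (ent0 j f Bf))// exprn_ege1// ler1n.
  rewrite lerDr; apply: sumr_ge0 => k _; rewrite mulr_ge0 ?exprn_ge0//.
  exact/ltW/ent0.
have two4 : 2 < 2 ^+ 2 :> R by rewrite expr2; lra.
have g2lt j f : B0 f -> (g2 j f < 2 ^ (j + 2))%N.
  by move=> Bf; apply: grid_label_lt; [exact: S20|apply: le_lt_trans two4; exact: S2le].
have g3lt j f : B0 f -> (g3 j f < 2 ^ (j + 2))%N.
  by move=> Bf; apply: grid_label_lt; [exact: T0|apply: le_lt_trans two4; exact: Tle].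
have prelE j f g : B0 f -> B0 g -> prel j f = prel j g ->
    [/\ c1 j.-1 f = c1 j.-1 g, g1 j f = g1 j g, g2 j f = g2 j g & g3 j f = g3 j g].
  move=> Bf Bg /(mulnD_inj (g3lt _ _ Bf) (g3lt _ _ Bg))[].
  by move=> /(mulnD_inj (g2lt _ _ Bf) (g2lt _ _ Bg))[] /(mulnD_inj (g1lt _ _ Bf) (g1lt _ _ Bg))[].
pose H k f := V2 * grid_value (2 * k.+1) (g1 k.+1 f).
pose S k f := grid_value k.+1 (g2 k.+1 f) : R.
pose Tq k f := grid_value k.+1 (g3 k.+1 f) : R.
have H0 k f : 0 < H k f.
  by rewrite mulr_gt0// /grid_value mulr_gt0 ?exprn_gt0 ?ltr0n.
have Hent k f : B0 f -> ent k.+1 f <= H k f <= 2 * ent k.+1 f.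
  move=> Bf; have h0 : 0 <= ent k.+1 f / V2 by rewrite divr_ge0// ltW// ent0.
  have /andP[h1 h2] := grid_valueP (2 * k.+1) h0.
  rewrite /H [V2 * _]mulrC -ler_pdivrMr// h1/= -ler_pdivlMr//.
  apply: le_trans h2 _.
  rewrite -mulrA mulr_natl mulr2n lerD2l ler_pdivlMr// mulrC.
  apply: le_trans (entlo k.+1 f Bf); rewrite ler_pM2l//.
  by rewrite exprM !exprVn (_ : 2 ^+ 2 = 4 :> R)// expr2; ring.
have SP k f : B0 f -> S2 k.+1 f <= S k f <= S2 k.+1 f + 2^-1 ^+ k.+1.
  by move=> Bf; exact/grid_valueP/S20.
have TP k f : T k.+1 f <= Tq k f <= T k.+1 f + 2^-1 ^+ k.+1.
  exact/grid_valueP/T0.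
have S0 k f : 0 <= S k f by rewrite mulr_ge0// exprn_ge0.
have Tq0 k f : 0 <= Tq k f by rewrite mulr_ge0// exprn_ge0.
(* Ellipsoid labels exist up to level K only. Beyond it the trivial diameter 4 V2 keeps the
   recursion defined; the final sum stops at K. *)
pose b j f := if j is k.+1 then
    if (k < K)%N then C3 * (H k f * (S k f + Tq k f + (tau k.+1 * del k f) `^ theta + 2^-1 ^+ k.+1)
     + (Tq k f `^ theta^-1 / tau k.+1) `^ P + del k f `^ P) else 4 * V2
  else 4 * V2.
have V24 : 0 <= 4 * V2 by rewrite mulr_ge0// ltW.
have b0 j f : B0 f -> 0 <= b j f.
  move=> Bf; rewrite /b; case: j => [//|k]; case: ifP => // _.
  apply: mulr_ge0 => //; apply: addr_ge0; [apply: addr_ge0|]; rewrite ?powR_ge0//.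
  apply: mulr_ge0; first exact: ltW.
  by apply: addr_ge0; [apply: addr_ge0; [exact: addr_ge0|exact: powR_ge0]|rewrite exprn_ge0].
have [|||| c [D [cP cn Dc Dle [D00 DS]]]] := @nested_contraction R V B0 (fun f g => q f (f - g))
  (fun j f => if j is k.+1 then prel j f else 0%N)
  (fun j => if j is k.+1 then (2 ^ (6 * 2 ^ k) * 2 ^ (2 * k.+1 + J) * 2 ^ (k.+1 + 2) * 2 ^ (k.+1 + 2)) else 1)%N
  (fun k => 2 ^ (18 * 2 ^ k.+1))%N 64^-1 b.
- case=> [//|k] f Bf; rewrite /prel /=.
  apply: mulnD_lt; last exact: g3lt.
  apply: mulnD_lt; last exact: g2lt.
  by apply: mulnD_lt; [exact: c1A|exact: g1lt].
- case=> [//|k] f g Bf Bg /(prelE _ _ _ Bf Bg)[/= e0' e1 e2 e3].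
  by rewrite /b /H /S /Tq e1 e2 e3 (del_const k f g).
- by move=> f g Bf Bg _; exact: qdiam.
- move=> k A D AB pA dA.
  have [kK|Kk] := ltnP k K; last first.
    exists (fun=> 0%N); split => [f _|f g Af Ag _]; first by rewrite expn_gt0.
    have D0' : 0 <= D by have := dA f f Af Af; rewrite subrr q00.
    rewrite /b ltnNge Kk/=; apply: le_trans (qdiam f g (AB _ Af) (AB _ Ag)) _.
    by rewrite lerDr mulr_ge0// invr_ge0.
  have [[f0 Af0]|nA] := pselect (A !=set0); last first.
    by exists (fun=> 0%N); split => [f Af|f g Af]; case: nA; exists f.
  have B0f0 := AB _ Af0.
  have D_ge0 : 0 <= D by have := dA f0 f0 Af0 Af0; rewrite subrr q00.
  have [h hE] : {h | h = H k f0} by eexists.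
  have [s sE] : {s | s = S k f0} by eexists.
  have [tq tqE] : {tq | tq = Tq k f0} by eexists.
  have [dl dlE] : {dl | dl = del k f0} by eexists.
  have cst f : A f -> [/\ H k f = h, S k f = s, Tq k f = tq, del k f = dl & c1 k f = c1 k f0].
    move=> Af; have [/= e1 e2 e3 e4] := prelE _ _ _ (AB _ Af) B0f0 (pA f f0 Af Af0).
    by rewrite hE sE tqE dlE /H /S /Tq e2 e3 e4 (del_const k f f0)//; exact: AB.
  have h0 : 0 < h by rewrite hE.
  have s0 : 0 <= s by rewrite sE.
  have tq0 : 0 <= tq by rewrite tqE.
  have dl0 : 0 <= dl by rewrite dlE; exact: del0.
  have nA f g : A f -> A g -> n (f - g) <= dl.
    move=> Af Ag; have [_ _ _ <- ef] := cst f Af; have [_ _ _ _ eg] := cst g Ag.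
    by apply: c1del; [exact: AB|exact: AB|rewrite ef eg].
  have [sg sgE] : {sg | sg = tq `^ theta^-1 / tau k.+1} by eexists.
  have tk0 := tau0 k.+1.
  have sg0 : 0 <= sg by rewrite sgE divr_ge0 ?powR_ge0// ltW.
  have tsg : (tau k.+1 * sg) `^ theta = tq.
    by rewrite sgE mulrC divfK ?gt_eqF// powRVK// gt_eqF.
  have [tb tbE] : {tb | tb = a2 / h} by eexists.
  have tb0 : 0 < tb by rewrite tbE divr_gt0.
  have tfP f : A f -> tb <= a2 / ent k.+1 f <= 2 * tb.
    move=> Af; have [hf _ _ _ _] := cst f Af; have /andP[] := Hent k f (AB _ Af); rewrite hf => h1 h2.
    have en0 := ent0 k.+1 f (AB _ Af).
    rewrite tbE ler_pM2l// lef_pV2 ?posrE// h1/= ler_pdivrMr//.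
    have -> : 2 * (a2 / h) * ent k.+1 f = a2 * (2 * ent k.+1 f / h) by ring.
    by rewrite ler_peMr ?(ltW a20)// ler_pdivlMr// mul1r.
  have SPA f : A f -> a2 / ent k.+1 f * q f (f - pi k.+1 f) <= s.
    by move=> Af; have [_ <- _ _ _] := cst f Af; case/andP: (SP k f (AB _ Af)).
  have TPA f : A f -> n (f - pi k.+1 f) <= sg.
    move=> Af; have [_ _ tE _ _] := cst f Af; have /andP[+ _] := TP k f; rewrite tE => hT.
    have nn0 : 0 <= tau k.+1 * n (f - pi k.+1 f) by rewrite mulr_ge0// ltW.
    have th0' : 0 <= theta^-1 by rewrite invr_ge0 ltW.
    have := ler_powR2l (T0 k.+1 f) hT th0'; rewrite /T powRK ?gt_eqF//.
    by rewrite sgE ler_pdivlMr// mulrC.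
  have [rho2 rhoE] : {rho2 | rho2 = 4 * (3 * G * s + 2 * tb * D + 2 * tb * G * (sg `^ P + dl `^ P) +
      6 `^ theta * (tq + (tau k.+1 * dl) `^ theta) + 2^-1 ^+ k.+1)} by eexists.
  have rho0 : 0 < rho2.
    rewrite rhoE mulr_gt0// ltr_wpDl ?exprn_gt0//.
    have tb0' := ltW tb0; have G0' := ltW G0.
    by rewrite !addr_ge0// ?mulr_ge0 ?addr_ge0 ?powR_ge0.
  have close f g : A f -> A g -> e (pi k.+1 f - pi k.+1 g) <= rho2.
    have key f' g' : A f' -> A g' -> e (pi k.+1 g') <= e (pi k.+1 f') ->
        e (pi k.+1 f' - pi k.+1 g') <= rho2.
      move=> Af Ag ezy; rewrite rhoE -tsg.
      have Bf := AB _ Af; have Bg := AB _ Ag.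
      apply: (@euclid_minimizers_close R V L e n q theta P G tb (a2 / ent k.+1 f') (a2 / ent k.+1 g')
        (tau k.+1) D s sg dl (2^-1 ^+ k.+1) f' g') => //.
      - exact: ltW.
      - exact: tfP.
      - by case/andP: (tfP _ Ag).
      - exact: B0L.
      - exact: B0L.
      - exact: piL.
      - exact: piL.
      - exact: pi1.
      - by move=> u Lu eu; have [_ /(_ u (conj Lu eu))] := piP k.+1 f' Bf.
      - exact: pert.
      - exact: dA.
      - exact: nA.
      - exact: SPA.
      - exact: SPA.
      - exact: TPA.
      - exact: TPA.
    move=> Af Ag; have [/key|/ltW/key] := leP (e (pi k.+1 g)) (e (pi k.+1 f)); first exact.
    move=> /(_ Ag Af); have -> : pi k.+1 f - pi k.+1 g = (-1) *: (pi k.+1 g - pi k.+1 f).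
      by rewrite scaleN1r opprB.
    rewrite eZ; first by rewrite sqrrN expr1n mul1r.
    by apply: LB; apply: piL; exact: AB.
  have [l0 [l0lt l0P]] := entlab k.+1 f0 B0f0 kK.
  (* Real dilations are allowed here: the representatives range over the Euclidean ball of the
     linear space [L], only the base points are restricted to [B0]. *)
  have [cs csE] : {cs | cs = (Num.sqrt rho2)^-1} by eexists.
  have cs2 : cs ^+ 2 = rho2^-1 by rewrite csE exprVn sqr_sqrtr// ltW.
  pose y f := cs *: (pi k.+1 f - pi k.+1 f0).
  have Lp f g : A f -> A g -> L (pi k.+1 f - pi k.+1 g).
    by move=> Af Ag; apply: LB; apply: piL; exact: AB.
  have Ly f : A f -> L (y f) by move=> Af; apply: LZ; exact: Lp.
  have ey f : A f -> e (y f) <= 1.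
    move=> Af; rewrite /y eZ; last exact: Lp.
    by rewrite cs2 mulrC ler_pdivrMr// mul1r; exact: close.
  exists (fun f => l0 (y f)); split=> [f Af|f g Af Ag lfg].
    by apply: l0lt; [exact: Ly|exact: ey].
  have qfg : q f0 (pi k.+1 f - pi k.+1 g) <= rho2 * h.
    have := l0P _ _ (Ly f Af) (Ly g Ag) (ey f Af) (ey g Ag) lfg.
    rewrite /y -scalerBr opprB addrA subrK qZ cs2 mulrC ler_pdivrMr// mulrC => /le_trans; apply.
    by rewrite ler_pM2l// hE; case/andP: (Hent k f0 B0f0).
  have Bf := AB _ Af; have Bg := AB _ Ag.
  apply: le_trans (@euclid_cell_diameter R V n q P G tb (a2 / ent k.+1 f) (a2 / ent k.+1 g)
    s sg dl (rho2 * h) f g f0 (pi k.+1 f) (pi k.+1 g) _ _ _ _ _ _ _ _ _ _ _ _ _ _ _ _ _ _ _ _ _ _ _ _) _ => //.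
  - exact: ltW.
  - by case/andP: (tfP _ Af).
  - by case/andP: (tfP _ Ag).
  - exact: pert.
  - exact: pert.
  - exact: pert.
  - exact: nA.
  - exact: nA.
  - exact: nA.
  - exact: nA.
  - exact: SPA.
  - exact: SPA.
  - exact: TPA.
  - exact: TPA.
  have [hf sf tf df _] := cst f Af.
  rewrite /b kK hf sf tf df -sgE /C3 rhoE.
  apply: (@euclid_step_arith R G a2 h (6 `^ theta) D s tq ((tau k.+1 * dl) `^ theta) (2^-1 ^+ k.+1)
    (sg `^ P) (dl `^ P) tb) => //; rewrite ?powR_ge0 ?exprn_ge0//.
  by rewrite a20.
exists c, D; split => //.
- split=> // k f Bf; apply: leq_trans (cP k f Bf) _.
  exact: euclid_label_prod.
- elim=> [|k ih] f Bf; first by rewrite D00.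
  by rewrite DS addr_ge0 ?b0// mulr_ge0 ?invr_ge0 ?ih.
move=> f Bf.
apply: (esum V2 E K (fun k => D k f) (fun k => b k f) (fun k => ent k f) (fun k => S2 k f)
  (fun k => T k f) (fun k => del k f) (fun k => H k f) (fun k => S k f) (fun k => Tq k f)) => //.
- elim=> [|k ih]; first by rewrite D00.
  by rewrite DS addr_ge0 ?b0// mulr_ge0 ?invr_ge0 ?ih.
- by move=> k; exact: b0.
- by move=> k kK; rewrite /b kK !tauE.
- by move=> k; rewrite (ltW (H0 k f))/=; case/andP: (Hent k f Bf).
- by move=> k; rewrite S0/=; case/andP: (SP k f Bf).
- by move=> k; rewrite Tq0/=; case/andP: (TP k f).
- by move=> k; exact: del0.
- by move=> k; exact: S20.
- by move=> k; exact/ltW/ent0.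
- by move=> N; exact: STsum.
- by move=> N; exact: sument.
- by move=> N; under eq_bigr do rewrite mulrAC; exact: sumdel.
Qed.

End euclid_chaining.

Section sample_bound3.
Context {R : realType}.
Variable p : R.
Hypothesis p1 : 1 < p.

Let p0 : 0 < p. Proof. exact: lt_trans p1. Qed.

(** From |f| <= |g| + |f - g| in the weight; the cross term |f - g|^(2(p-1)) h^2 has degree 2 p and
    splits into pure powers. The local metrics therefore vary slowly with respect to the l_(2p)
    distance. *)
Lemma qform_perturbation (Omega : ptopologicalType) m (X : 'I_m -> Omega) (f g h : Omega -> R) :
  qform X (fun j => `|f (X j)| `^ ((p - 1) * 2)) h <=
  2 `^ ((p - 1) * 2) * (qform X (fun j => `|g (X j)| `^ ((p - 1) * 2)) h +
    \sum_j `|h (X j)| `^ (p * 2) + \sum_j `|(f - g) (X j)| `^ (p * 2)).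
Proof.
have pm0 : 0 <= (p - 1) * 2 by rewrite mulr_ge0// subr_ge0 ltW.
rewrite /qform -!big_split/= mulr_sumr; apply: ler_sum => j _.
set F := `|f (X j)|; set G := `|g (X j)|; set H := `|(f - g) (X j)|.
have FGH : F <= G + H.
  by rewrite /F /G /H -[(f - g) (X j)]/(f (X j) - g (X j)) -{1}(subrK (g (X j)) (f (X j))) [leRHS]addrC ler_normD.
have h2 : h (X j) ^+ 2 = `|h (X j)| `^ 2 by rewrite powR_mulrn// real_normK// num_real.
have hH : H `^ ((p - 1) * 2) * h (X j) ^+ 2 <= `|h (X j)| `^ (p * 2) + H `^ (p * 2).
  have e2 : (p - 1) * 2 + 2 = p * 2 by ring.
  have := powR_mul_le_add (normr_ge0 ((f - g) (X j))) (normr_ge0 (h (X j))) pm0 (ler0n R 2).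
  by rewrite e2 h2 [leRHS]addrC.
have hF : F `^ ((p - 1) * 2) <= 2 `^ ((p - 1) * 2) * (G `^ ((p - 1) * 2) + H `^ ((p - 1) * 2)).
  exact: le_trans (ler_powR2l (normr_ge0 _) FGH pm0) (powRD_le (normr_ge0 _) (normr_ge0 _) pm0).
apply: (@le_trans _ _ (2 `^ ((p - 1) * 2) * (G `^ ((p - 1) * 2) + H `^ ((p - 1) * 2)) * h (X j) ^+ 2)).
  by rewrite ler_wpM2r ?sqr_ge0.
by rewrite -mulrA ler_wpM2l ?powR_ge0// mulrDl -addrA lerD2l.
Qed.

(** With s = 2 the weighted term is, for fixed f, a quadratic form in f - g. Its trace bound kap
    times the sum of the weights is at most V2 = kap M^(p-2) Q, and no logarithm goes with it. The
    logarithm comes from the chaining of the inner body in the l_(2p) norm, which also controls how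
    the form varies with f. *)
Lemma sample_bound3 (theta zeta alpha : R) :
  1 <= theta -> 0 < zeta -> 0 < alpha -> alpha <= p -> 2 <= p ->
  exists2 C, 0 <= C & forall (Omega : ptopologicalType) (m : nat) (X : 'I_m -> Omega)
    (L L0 : set (Omega -> R)) (N : (Omega -> R) -> R)
    (ip : (Omega -> R) -> (Omega -> R) -> R) (W M Q kap : R), (2 <= m)%N ->
    is_norm L N -> q_convex_norm L N theta zeta ->
    linear_subspace L -> is_inner_product L ip ->
    (forall f, L f -> N f <= 1 -> ip f f <= 1) ->
    L0 `<=` L -> rational_subspace L0 -> 0 < M -> M <= W -> 0 < Q -> 0 < kap ->
    (forall k, (entropy_number (unit_ball L N) (fun f g => norm_at X (f - g)%R) k
       <= (W * 2 `^ (- (k%:R / alpha)))%:E)%E) ->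
    (forall h j, L h -> h (X j) ^+ 2 <= kap * ip h h) ->
    let B0 := [set f | L0 f /\ N f <= 1] in
    (forall f j, B0 f -> `|f (X j)| <= M) ->
    (forall f, B0 f -> \sum_j `|f (X j)| `^ p <= Q) ->
    forall n (F : 'I_n -> Omega -> R), (forall i, B0 (F i)) ->
    rad_mean (fun e => \big[Num.max/0]_(i < n) `|rad_sum (sample_pow p X (F i)) e|) <=
    C * (((kap * M `^ (p - 2)) `^ 2^-1 +
          ln m%:R `^ Num.max (1 - p / theta) 0 * (W `^ alpha * M `^ (p - alpha)) `^ 2^-1)
         * Q `^ (1 - 2^-1)).
Proof.
move=> th1 zeta0 alpha0 alphap p2.
have th0 : 0 < theta by exact: lt_le_trans th1.
pose r : R := 2 / (2 - 1).
have rE : r = 2 by rewrite /r; field.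
have r1 : 1 <= r by rewrite rE ler1n.
have r0 : 0 < r by exact: lt_le_trans r1.
have pr1 : 1 <= p * r by rewrite -[1]mulr1; apply: ler_pM => //; exact: ltW.
have pm1 : 0 <= p - 1 by rewrite subr_ge0 ltW.
have [[C c1] /= [C0 c10] ch] := sample_chaining_pow p1 th1 zeta0 alpha0 alphap (lexx 2).
pose G : R := 2 `^ ((p - 1) * 2).
have G1 : 1 <= G.
  have := @ler_powR R 2 _ 0 ((p - 1) * 2); rewrite powRr0; apply; first by rewrite ler1n.
  by rewrite mulr_ge0.
(* 98 * 40 from [ellipsoid_entropy], passed through [regularize]; 15682 < 2^14 fixes J = 14. *)
have [ce ceE] : {ce : R | ce = 4 * (98 * 40) + 2} by eexists.
have ce0 : 0 <= ce by rewrite ceE; lra.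
have ceJ : ce < 2 ^+ 14 by rewrite ceE !exprS expr0; lra.
have [C' C'0 ch'] := @euclid_chaining R theta p G C ce 14 th1 p0 G1 C0 ce0 ceJ.
pose C1 := 1 + C + C `^ (p / theta).
have C10 : 0 <= C1 by rewrite /C1 addr_ge0 ?powR_ge0// addr_ge0.
pose cc := (3 * (6 + (60 + 14)) + 20)%:R * (p * (2 * 2 `^ p)) : R.
have cc0 : 0 <= cc.
  by apply: mulr_ge0 => //; apply: mulr_ge0; [exact: ltW|apply: mulr_ge0 => //; exact: powR_ge0].
pose a1 := (6 * (1 + C1) + C' * (6 * (1 + 1))) * c1.
have a10 : 0 <= a1.
  apply: mulr_ge0; last exact: ltW.
  by apply: addr_ge0; apply: mulr_ge0 => //; exact: addr_ge0.
exists (cc * (a1 + C')); first by apply: mulr_ge0 => //; exact: addr_ge0.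
move=> Omega m X L L0 N ip W M Q kap m2 HN Ncvx Llin Hip Nip L0L L0r M0 MW Q0 kap0 ent Hkap BM' BQ' n F BF'.
pose B0 := [set f | L0 f /\ N f <= 1].
have BM : forall f j, B0 f -> `|f (X j)| <= M by exact: BM'.
have BQ : forall f, B0 f -> \sum_j `|f (X j)| `^ p <= Q by exact: BQ'.
have BF : forall i, B0 (F i) by exact: BF'.
clear BM' BQ' BF'.
have W0 : 0 < W by exact: lt_le_trans MW.
have B00 : B0 !=set0.
  have [L00 _ _] := L0r.
  by exists 0; split => //; rewrite (is_norm0 (L0L _ L00) HN) ler01.
have B0L : B0 `<=` L by move=> f [/L0L].
have Bip f : B0 f -> ip f f <= 1 by move=> [/L0L Lf]; exact: Nip.
have BM0 g j : B0 g -> `|g (X j)| `^ 0 <= 1 by rewrite powRr0.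
have [E [c [D [E0 Ep cD sumD supD]]]] := ch Omega m X L L0 N W M Q HN Ncvx L0L L0r M0 MW Q0 ent BM BQ.
have [K [mK KN]] := @dyadic_levels R m m2.
pose w (f : Omega -> R) (j : 'I_m) : R := `|f (X j)| `^ ((p - 1) * 2).
have w0 f j : 0 <= w f j by exact: powR_ge0.
have [V2 V2E] : {V2 : R | V2 = kap * (M `^ (p - 2) * Q)} by eexists.
have V20 : 0 < V2 by rewrite V2E !mulr_gt0// powR_gt0.
have sumw f : B0 f -> kap * \sum_j w f j <= V2.
  move=> Bf; rewrite V2E ler_pM2l//.
  apply: (@le_trans _ _ (M `^ (p - 2) * \sum_j `|f (X j)| `^ p)).
    rewrite mulr_sumr; apply: ler_sum => j _; rewrite /w.
    have -> : (p - 1) * 2 = (p - 2) + p by ring.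
    rewrite powRD_ge0 ?subr_ge0 ?(ltW p0)// ler_wpM2r ?powR_ge0//.
    by apply: ler_powR2l; rewrite ?BM ?subr_ge0.
  by rewrite ler_wpM2l ?powR_ge0// BQ.
have /choice[entf entfP] : forall f, exists e : nat -> R, B0 f ->
  [/\ forall k, V2 * 4^-1 ^+ k <= e k, forall k, e k.+1 <= 2 / 3 * e k,
    forall n, \sum_(k < n) 2 ^+ k * e k <= ce * V2 &
    forall k, (k <= K)%N -> exists l : (Omega -> R) -> nat,
     (forall h, L h -> ip h h <= 1 -> (l h < 2 ^ (18 * 2 ^ k))%N) /\
     forall h h', L h -> L h' -> ip h h <= 1 -> ip h' h' <= 1 -> l h = l h' ->
       qform X (w f) (h - h') <= e k].
  move=> f; have [Bf|nBf] := pselect (B0 f); last by exists (fun=> 0).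
  have [e [e0 esum elab]] := ellipsoid_entropy Llin Hip (w0 f) (ltW kap0) Hkap.
  have esum' k : \sum_(i < k) 2 ^+ i * e i <= (98 * 40) * V2.
    apply: le_trans (esum k) _; rewrite mulrA ler_pM2l ?sumw//.
  have [e' [e1 e2 e3 e4]] := regularize K V20 e0 esum'.
  exists e' => _; split => //; first by move=> k; rewrite ceE; exact: e3.
  move=> k kK; have [l [l1 l2]] := elab k; exists l; split=> // h h' Lh Lh' nh nh' ll.
  by apply: le_trans (e4 k kK); exact: l2.
have nP f : B0 f -> forall h, \sum_j `|h (X j)| `^ (p * 2) <= wnorm X B0 (p * r) 0 h `^ (p * 2).
  move=> Bf h; have := wsum_le pr1 B00 BM0 h Bf; rewrite /wsum.
  by under eq_bigr do rewrite powRr0 mulr1; rewrite rE.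
have LB := subspaceB Llin; have LD := subspaceD Llin; have LZ := subspaceZ Llin.
have qD f h h' : qform X (w f) (h + h') <= 2 * qform X (w f) h + 2 * qform X (w f) h'.
  rewrite /qform !mulr_sumr -big_split/=; apply: ler_sum => j _.
  rewrite !fctE/= ![2 * (w f j * _)]mulrCA -mulrDr ler_wpM2l//.
  have := sqr_ge0 (h (X j) - h' (X j)); rewrite sqrrB sqrrD.
  by move: (h (X j)) (h' (X j)); clear => x y; lra.
have pert f g h : B0 f -> B0 g -> qform X (w f) h <=
    G * (qform X (w g) h + wnorm X B0 (p * r) 0 h `^ (p * 2) + wnorm X B0 (p * r) 0 (f - g) `^ (p * 2)).
  move=> Bf Bg; apply: le_trans (qform_perturbation X f g h) _.
  by rewrite ler_wpM2l ?powR_ge0// !lerD// (nP f).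
have qdiam f g : B0 f -> B0 g -> qform X (w f) (f - g) <= 4 * V2.
  move=> Bf Bg; have Lf := B0L _ Bf; have Lg := B0L _ Bg.
  apply: le_trans (qform_le (w0 f) Hkap (LB _ _ Lf Lg)) _.
  rewrite [leRHS]mulrC; apply: ler_pM; rewrite ?sumw//.
  - by apply: mulr_ge0; [exact: ltW|exact: sumr_ge0].
  - by apply: (ip_ge0 Hip); exact: LB.
  have := ip_ge0 Hip (LZ 2^-1 _ (LD _ _ Lf Lg)).
  rewrite (ip_midpoint Llin Hip Lf Lg); move: (Bip f Bf) (Bip g Bg); clear.
  move: (ip _ _) (ip _ _) (ip _ _) => *; lra.
have ent1 k f : B0 f -> V2 * 4^-1 ^+ k <= entf f k by move=> /entfP[].
have ent2 k f : B0 f -> entf f k.+1 <= 2 / 3 * entf f k by move=> /entfP[].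
have ent3 k f : B0 f -> \sum_(i < k) 2 ^+ i * entf f i <= ce * V2 by move=> /entfP[].
have ent4 k f : B0 f -> (k <= K)%N -> exists l : (Omega -> R) -> nat,
     (forall h, L h -> ip h h <= 1 -> (l h < 2 ^ (18 * 2 ^ k))%N) /\
     forall h h', L h -> L h' -> ip h h <= 1 -> ip h' h' <= 1 -> l h = l h' ->
       qform X (w f) (h - h') <= entf f k by move=> /entfP[_ _ _]; exact.
have [c' [D' [cn' cc' D'0 D'le sumD']]] := ch' (Omega -> R) L B0 (fun f => ip f f)
  (wnorm X B0 (p * r) 0) (fun f => qform X (w f)) (fun k f => entf f k) V2 E c D K
  LB LD LZ (ip_midpoint Llin Hip) (ip_ge0 Hip)
  (fun a f => @ipZ R Omega L ip Llin Hip a f) (fun f a h => qformZ X (w f) a h)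
  qD (fun f h => qform_ge0 X (w0 f) h) (wnorm_ge0 pr1 B00 BM0)
  (wnormZ pr1 B00 BM0) (wnormD pr1 B00 BM0) B0L Bip pert cD E0
  sumD V20 ent1 ent2 ent3 ent4 qdiam.
have t1 := max_sub_div01 p1 th0; set tt1 := Num.max _ _ in t1 sumD' *.
have [h1 [h2 h3]] := level_sum_le m2 KN t1 C10 (powR_ge0 E p).
have [h1' [h2' h3']] := level_sum_le m2 KN t1 ler01 (powR_ge0 E p).
set H1 := E `^ p * _ in h1 h2 h3; set H2 := E `^ p * ((1 + 1) * _) in h1' h2' h3'.
pose G2 := C' * (Num.sqrt V2 + H2).
have H10 : 0 <= H1 by apply: le_trans h1; exact: powR_ge0.
have H20 : 0 <= H2 by apply: le_trans h1'; exact: powR_ge0.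
have G20 : 0 <= G2 by rewrite /G2 mulr_ge0// addr_ge0// sqrtr_ge0.
pose D2 k f := Num.sqrt (D' k f).
have := @two_chain_bound R p p1 2 (60 + 14) Omega m K X B0 c c' D D2 H1 G2 M (lexx 2) BM cD.
move=> /(_ _ _ _ _ H10 G20 mK _ _ _ n F BF)/le_trans; apply.
- exact: cn'.
- by move=> k f g Bf Bg cfg; rewrite /D2 (cc' k f g).
- by move=> k f Bf; exact: sqrtr_ge0.
- move=> k f g Bf Bg cfg; rewrite -/r rE /D2 powR_mulrn ?sqrtr_ge0// sqr_sqrtr ?D'0//.
  apply: le_trans (D'le k f g Bf Bg cfg); apply: ler_sum => j _.
  by rewrite mulrC powR_mulrn// real_normK// num_real.
- move=> f Bf; apply: le_trans (supD f Bf) _.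
  by apply: ler_powR2l; rewrite ?powR_ge0 ?(ltW r0).
- move=> f Bf; apply: le_trans h2; apply: (@pow_chain_sum R p p1 theta 2 C E K (fun k => D k f) th0 _ E0 C0) => //.
  + by move=> k; apply: (chained_ge0 cD).
  + exact: sumD.
- move=> f Bf; apply: le_trans (_ : _ <= C' * (Num.sqrt V2 + E `^ p * K.+1%:R `^ tt1)) _.
    apply: le_trans (sumD' f Bf); apply: ler_sum => k _.
    rewrite sqrtrM ?exprn_ge0// /D2 powRrM powR12_sqrt ?powR_ge0// powR_mulrn//.
  by rewrite /G2 ler_wpM2l// lerD2l; move: h2'; rewrite mul1r.
have -> : (3 * (6 + (60 + 14)) + 20)%:R * (p * (2 * 2 `^ p) * (H1 + G2)) = cc * (H1 + G2) by rewrite mulrA.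
rewrite -[leRHS]mulrA ler_wpM2l//.
have sV : Num.sqrt V2 = (kap * M `^ (p - 2)) `^ 2^-1 * Q `^ (1 - 2^-1).
  have -> : 1 - 2^-1 = 2^-1 :> R by field.
  by rewrite -powRM ?mulr_ge0 ?powR_ge0 ?(ltW kap0) ?(ltW Q0)// powR12_sqrt ?V2E ?mulrA// !mulr_ge0 ?powR_ge0// ltW.
have h4 : G2 <= C' * (Num.sqrt V2 + 6 * (1 + 1) * (ln m%:R `^ tt1 * E `^ p)).
  by rewrite /G2 ler_wpM2l// lerD2l.
apply: le_trans (lerD h3 h4) _; rewrite sV Ep/=.
set Y1 := (kap * _) `^ _; set Y2 := (_ `^ 2^-1); set Z := Q `^ _; set l1 := ln _ `^ _.
have Y10 : 0 <= Y1 * Z by rewrite mulr_ge0 ?powR_ge0.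
have Y20 : 0 <= l1 * Y2 * Z by rewrite !mulr_ge0 ?powR_ge0.
have -> : 6 * (1 + C1) * (l1 * (c1 * (Y2 * Z))) + C' * (Y1 * Z + 6 * (1 + 1) * (l1 * (c1 * (Y2 * Z)))) =
    a1 * (l1 * Y2 * Z) + C' * (Y1 * Z) by rewrite /a1; ring.
rewrite mulrDl [(Y1 + _) * Z]mulrDl.
by apply: lerD; rewrite ler_wpM2l// ?lerDl ?lerDr.
Qed.
End sample_bound3.

(** * Symmetrization *)

Section independence.
Context {R : realType} {Omega : ptopologicalType}.
Context {d : measure_display} {T : measurableType d} (P : probability T R).
Variables (mu : probability (borel Omega) R) (m : nat) (X : 'I_m -> {RV P >-> borel Omega}).
Hypothesis iidX : iid_sample mu X.
Variable I : {set 'I_m}.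

(** A pi-system generating the sigma-algebra of the coordinates with index in [I]. *)
Definition cylinders : set (set T) :=
  [set S | exists2 A : 'I_m -> set (borel Omega), (forall j, measurable (A j)) &
     S = \bigcap_(j in [set` I]) (X j @^-1` A j)].

Let mX j (A : set (borel Omega)) : measurable A -> measurable (X j @^-1` A).
Proof. by move=> mA; rewrite -[X in measurable X]setTI; exact: measurable_funPT. Qed.

Lemma cylinders_measurable : cylinders `<=` measurable.
Proof.
move=> _ [A mA ->]; apply: fin_bigcap_measurable; first exact: finite_finset.
by move=> j _; exact: mX.
Qed.

Lemma cylindersT : cylinders setT.
Proof.
exists (fun=> setT) => //; apply/seteqP; split => // w _ j _ //.
Qed.

Lemma cylindersI : setI_closed cylinders.
Proof.
move=> _ _ [A mA ->] [A' mA' ->]; exists (fun j => A j `&` A' j).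
  by move=> j; exact: measurableI.
by rewrite -bigcapI; apply: eq_bigcapr => j _; rewrite preimage_setI.
Qed.

Lemma cylinders_preimage j (A : set (borel Omega)) :
  j \in I -> measurable A -> cylinders (X j @^-1` A).
Proof.
move=> jI mA; exists (fun i => if i == j then A else setT).
  by move=> i; case: ifP.
apply/seteqP; split => [w Aw i _|w /(_ j jI)]; last by rewrite eqxx.
by case: eqP => // ->.
Qed.

Lemma sigma_measurable S : <<s cylinders >> S -> measurable S.
Proof. exact: smallest_sub (@sigma_algebra_measurable _ T) cylinders_measurable S. Qed.

(** Uniqueness of finite measures on a pi-system: both sides are measures in S and agree on
    cylinders by independence. Scaled measures take a nonnegative real factor, hence the detour
    through [fine (mu A)]. *)
Lemma independent_event S l (A : set (borel Omega)) :
  <<s cylinders >> S -> l \notin I -> measurable A ->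
  P (S `&` X l @^-1` A) = (P S * mu A)%E.
Proof.
move=> CS lI mA; have [Xmu Xind] := iidX.
have muA0 : 0 <= fine (mu A) by rewrite fine_ge0.
have muAE : mu A = (fine (mu A))%:E by rewrite fineK// fin_num_measure.
have mB := mX l mA.
have [c cE] : {c : {nonneg R} | c%:num = fine (mu A)} by exists (NngNum muA0).
have cP (E : set T) : mscale c P E = (mu A * P E)%E by rewrite muAE -cE.
have h : mrestr P mB S = mscale c P S; last first.
  by rewrite [RHS]muleC; apply: etrans (cP S); exact: h.
apply: (g_sigma_algebra_measure_unique cylinders cylinders_measurable (fun=> setT)) => //.
- by move=> _; exact: cylindersT.
- by apply/seteqP; split => // w _; exists 0%N.
- exact: cylindersI.
- move=> _ [A' mA' ->]; set E := bigcap _ _.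
  suff h : P (E `&` X l @^-1` A) = (mu A * P E)%E by exact: etrans h (esym (cP E)).
  pose A2 j := if j == l then A else A' j.
  have mA2 j : measurable (A2 j) by rewrite /A2; case: ifP.
  have -> : E `&` X l @^-1` A =
      \bigcap_(j in [set` l |: I]) (X j @^-1` A2 j).
    apply/seteqP; split => [w [wI wl] j|w h].
      rewrite /= in_setU1 /A2 => /orP[/eqP ->|jI]; first by rewrite eqxx.
      by case: eqP => [->//|_]; exact: wI.
    split; last by have := h l; rewrite /A2 eqxx; apply; rewrite /= setU11.
    move=> j jI; have := h j; rewrite /A2; case: eqP => [jl|_].
      by move: lI; rewrite -jl (jI : j \in I).
    by apply; rewrite /= in_setU1 (jI : j \in I) orbT.
  rewrite Xind// big_setU1//= /E Xind//; congr (_ * _)%E.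
    by rewrite /A2 eqxx; exact: Xmu.
  apply: eq_bigr => j jI; rewrite /A2; case: eqP => // jl.
  by move: lI; rewrite -jl jI.
- move=> _; have h : (P (setT `&` X l @^-1` A) < +oo)%E; last exact: h.
  by rewrite setTI (le_lt_trans (probability_le1 P mB))// ltry.
Qed.

(** By [independent_event], [X l] maps the restriction of P to S onto P S times mu; the rest is
    change of variables. *)
Lemma independent_integral S l (phi : borel Omega -> \bar R) :
  <<s cylinders >> S -> l \notin I -> measurable_fun setT phi -> (forall x, 0 <= phi x)%E ->
  (\int[P]_(w in S) phi (X l w) = P S * \int[mu]_x phi x)%E.
Proof.
move=> CS lI mphi phi0; have mS := sigma_measurable CS.
have mphiX : measurable_fun [set: T] (phi \o X l) by exact: measurableT_comp.
have PS0 : 0 <= fine (P S) by rewrite fine_ge0.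
have PSE : P S = (fine (P S))%:E by rewrite fineK// fin_num_measure.
have [c cE] : {c : {nonneg R} | c%:num = fine (P S)} by exists (NngNum PS0).
have cP (E : set (borel Omega)) : mscale c mu E = (P S * mu E)%E by rewrite PSE -cE.
transitivity (\int[mrestr P mS]_(w in S) phi (X l w))%E.
  apply: eq_measure_integral => A mA AS.
  have h : P A = P (A `&` S) by rewrite setIidl.
  exact: h.
transitivity (\int[mrestr P mS]_w phi (X l w))%E.
  rewrite [RHS](@ge0_negligible_integral _ _ _ _ setT (~` S))//.
  - by rewrite setTD setCK.
  - exact: measurableC.
  - have h : P (~` S `&` S) = 0%E by rewrite setICl measure0.
    exact: h.
transitivity (\int[pushforward (mrestr P mS) (X l)]_x phi x)%E.
  by rewrite ge0_integral_pushforward.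
rewrite PSE -cE -(ge0_integral_mscale mu measurableT c)//.
apply: eq_measure_integral => A mA _.
apply: etrans (esym (cP _)); rewrite -(independent_event CS lI mA) setIC; by [].
Qed.

End independence.

Section bigmax_functions.
Context {R : realType} {d : measure_display} {T : measurableType d}.

Lemma measurable_bigmax (K : Type) (ks : seq K) (f : K -> T -> R) :
  (forall k, measurable_fun setT (f k)) ->
  measurable_fun setT (fun w => \big[Num.max/0]_(k <- ks) f k w).
Proof.
move=> mf; elim: ks => [|k ks ih].
  by under eq_fun do rewrite big_nil; exact: measurable_cst.
by under eq_fun do rewrite big_cons; exact: measurable_maxr.
Qed.

Lemma integrable_bigmax (P : {measure set T -> \bar R}) (K : Type) (ks : seq K) (f : K -> T -> R) :
  (forall k, P.-integrable setT (EFin \o f k)) ->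
  P.-integrable setT (EFin \o (fun w => \big[Num.max/0]_(k <- ks) f k w)).
Proof.
move=> intf; elim: ks => [|k ks ih].
  rewrite (_ : _ \o _ = cst 0%E); first exact: integrable0.
  by apply/funext => w; rewrite /= big_nil.
have /= := integrableD measurableT (integrable_abse (intf k)) (integrable_abse ih).
apply: le_integrable => //.
  apply/measurable_EFinP; apply: measurable_bigmax => i.
  by apply/measurable_EFinP; exact: measurable_int (intf i).
move=> w _ /=; rewrite big_cons lee_fin [leRHS]ger0_norm ?addr_ge0//.
by rewrite maxEle; case: ifP => _; rewrite ?lerDl ?lerDr.
Qed.

End bigmax_functions.

Section decoupling.
Context {R : realType} {d : measure_display} {T : measurableType d} (P : probability T R).
Variables (C : set (set T)) (mC : C `<=` measurable).

(* Splitting the domain according to whether the last function attains the maximum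
   turns the supremum into single functions, over which [V'] integrates to 0. *)
Lemma decoupling (K : Type) (ks : seq K) (V V' : K -> T -> R) :
  (forall k, measurable_fun [set: g_sigma_algebraType C] (V k)) ->
  (forall k, P.-integrable setT (EFin \o V k)) ->
  (forall k, P.-integrable setT (EFin \o V' k)) ->
  (forall k S, <<s C >> S -> \int[P]_(w in S) V' k w = 0) ->
  forall S, <<s C >> S ->
  \int[P]_(w in S) (\big[Num.max/0]_(k <- ks) V k w) <=
  \int[P]_(w in S) (\big[Num.max/0]_(k <- ks) (V k w - V' k w)).
Proof.
move=> mV iV iV' V'0; have sub S : <<s C >> S -> measurable S.
  exact: smallest_sub (@sigma_algebra_measurable _ T) mC S.
have iB k : P.-integrable setT (EFin \o (fun w => V k w - V' k w)).
  exact: integrableB (iV k) (iV' k).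
have iM ks' : P.-integrable setT (EFin \o (fun w => \big[Num.max/0]_(k <- ks') V k w)).
  exact: integrable_bigmax.
have iMB ks' : P.-integrable setT (EFin \o (fun w => \big[Num.max/0]_(k <- ks') (V k w - V' k w))).
  exact: integrable_bigmax.
have iS (f : T -> R) S : <<s C >> S -> P.-integrable setT (EFin \o f) -> P.-integrable S (EFin \o f).
  by move=> CS; apply: integrableS => //; exact: sub.
elim: ks => [S CS|k ks ih S CS].
  by apply: le_Rintegral; [exact: sub|exact: iS|exact: iS|move=> w _; rewrite !big_nil].
(* This event lies in the sigma-algebra generated by [C], so both parts of S are admissible: on one
   [V' k] integrates to 0, on the other the induction hypothesis applies. *)
pose U : set T := [set w | \big[Num.max/0]_(k <- ks) V k w <= V k w].
have CU : <<s C >> U.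
  have mM : measurable_fun [set: g_sigma_algebraType C] (fun w => \big[Num.max/0]_(k <- ks) V k w).
    by apply: measurable_bigmax.
  have mt : measurable [set true] by [].
  have := measurable_fun_ler mM (mV k) measurableT mt.
  by rewrite setTI.
have CS1 : <<s C >> (S `&` U) by exact: (@measurableI _ (g_sigma_algebraType C)).
have CS2 : <<s C >> (S `&` ~` U).
  by apply: (@measurableI _ (g_sigma_algebraType C)) => //; exact: (@measurableC _ (g_sigma_algebraType C)).
have split (f : T -> R) : P.-integrable setT (EFin \o f) ->
    \int[P]_(w in S) f w = \int[P]_(w in S `&` U) f w + \int[P]_(w in S `&` ~` U) f w.
  move=> intf; rewrite -Rintegral_setU//.
  - by rewrite -setIUr setUv setIT.
  - exact: sub.
  - exact: sub.
  - by rewrite -setIUr setUv setIT; exact: iS.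
  - by apply/disj_setPS => w [[_ Uw] [_ nUw]].
rewrite (split _ (iM (k :: ks))) (split _ (iMB (k :: ks))); apply: lerD.
  rewrite (_ : \int[P]_(w in _) _ = \int[P]_(w in S `&` U) (V k w - V' k w)); last first.
    rewrite RintegralB ?V'0 ?subr0//; [|exact: sub|exact: iS|exact: iS].
    by apply: eq_Rintegral => w /set_mem[_ Uw]; rewrite big_cons; apply/max_idPl.
  apply: le_Rintegral; [exact: sub|exact: iS|exact: iS|].
  by move=> w _; rewrite big_cons le_max lexx.
apply: le_trans (_ : \int[P]_(w in S `&` ~` U) (\big[Num.max/0]_(k <- ks) V k w) <= _).
  apply: le_Rintegral; [exact: sub|exact: iS|exact: iS|].
  by move=> w [_ /negP]; rewrite -ltNge big_cons => /ltW h; rewrite ge_max h/=.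
apply: le_trans (ih _ CS2) _; apply: le_Rintegral; [exact: sub|exact: iS|exact: iS|].
by move=> w _; rewrite big_cons le_max lexx orbT.
Qed.

End decoupling.

Section symmetrization.
Context {R : realType} {Omega : ptopologicalType}.
Context {d : measure_display} {T : measurableType d} (P : probability T R).
Variables (mu : probability (borel Omega) R) (m : nat) (X : 'I_m -> {RV P >-> borel Omega}).
Hypothesis iidX : iid_sample mu X.

Lemma integrable_rsum (S : set T) (K : Type) (s : seq K) (Q : pred K) (f : K -> T -> R) :
  measurable S -> (forall k, P.-integrable S (EFin \o f k)) ->
  P.-integrable S (EFin \o (fun w => \sum_(k <- s | Q k) f k w)).
Proof.
move=> mS intf; rewrite (_ : _ \o _ = (fun w => \sum_(k <- s | Q k) (f k w)%:E)%E).
  by apply: integrable_sum => // k _; exact: intf.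
by apply/funext => w; rewrite /= sumEFin.
Qed.

Lemma Rintegral_rsum (S : set T) (K : Type) (s : seq K) (Q : pred K) (f : K -> T -> R) :
  measurable S -> (forall k, P.-integrable S (EFin \o f k)) ->
  \int[P]_(w in S) (\sum_(k <- s | Q k) f k w) = \sum_(k <- s | Q k) \int[P]_(w in S) f k w.
Proof.
move=> mS intf; elim: s => [|k s ih].
  rewrite big_nil (_ : (fun _ => _) = (fun=> 0)); last by apply/funext => w; rewrite big_nil.
  by rewrite Rintegral_cst// mul0r.
rewrite big_cons -ih; case: ifP => Qk; last first.
  by apply: eq_Rintegral => w _; rewrite big_cons Qk.
rewrite -RintegralD//; last exact: integrable_rsum.
by apply: eq_Rintegral => w _; rewrite big_cons Qk.
Qed.

(** Doubling the index set removes the absolute values, since [decoupling] is stated for maxima of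
    the functions themselves. *)
Lemma bigmax_signed (n : nat) (x : 'I_n -> R) :
  \big[Num.max/0]_(k : 'I_n * bool) (sgn k.2 * x k.1) = \big[Num.max/0]_(i < n) `|x i|.
Proof.
apply/eqP; rewrite eq_le; apply/andP; split.
  apply: bigmax_le => [|[i b] _ /=]; first exact: bigmax_ge_id.
  apply: (le_trans _ (le_bigmax _ (fun i => `|x i|) i)).
  by apply: le_trans (ler_norm _) _; rewrite normrM /sgn normrX normrN1 expr1n mul1r.
apply: bigmax_le => [|i _]; first exact: bigmax_ge_id.
have [x0|x0] := leP 0 (x i).
  apply: le_trans (le_bigmax _ (fun k : 'I_n * bool => sgn k.2 * x k.1) (i, false)).
  by rewrite /sgn/= mul1r ger0_norm.
apply: le_trans (le_bigmax _ (fun k : 'I_n * bool => sgn k.2 * x k.1) (i, true)).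
by rewrite /sgn/= expr1 mulN1r ltr0_norm.
Qed.

Variables (n : nat) (phi : 'I_n -> borel Omega -> R).
Hypothesis mphi : forall i, measurable_fun setT (phi i).
Hypothesis phi0 : forall i x, 0 <= phi i x.
Hypothesis iphi : forall i, mu.-integrable setT (EFin \o phi i).

Let c i := \int[mu]_x phi i x.
Let Y i j w := phi i (X j w).

Let mphiE i : measurable_fun setT (EFin \o phi i).
Proof. exact/measurable_EFinP. Qed.

Let intE i j : (\int[P]_w (Y i j w)%:E = \int[mu]_x (phi i x)%:E)%E.
Proof.
rewrite -(@ge0_integral_distribution _ _ _ _ _ P (X j) (EFin \o phi i))//.
  by apply: eq_measure_integral => A mA _; case: iidX => h _; exact: h.
by move=> y; rewrite lee_fin.
Qed.

Lemma integrable_sample i j : P.-integrable setT (EFin \o (fun w => phi i (X j w))).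
Proof.
apply/integrableP; split; first exact: (measurableT_comp (mphiE i)).
rewrite (_ : (\int[P]_w _)%E = (\int[mu]_x (phi i x)%:E)%E).
  have /integrableP[_] := iphi i.
  by under eq_integral do rewrite /= ger0_norm//.
by rewrite -(intE i j); apply: eq_integral => w _; rewrite /= ger0_norm.
Qed.

Lemma Rintegral_sample i j : \int[P]_w phi i (X j w) = c i.
Proof. by rewrite /Rintegral intE. Qed.

Lemma Rintegral_sample_independent (I : {set 'I_m}) S i l :
  <<s cylinders X I >> S -> l \notin I -> \int[P]_(w in S) (phi i (X l w) - c i) = 0.
Proof.
move=> CS lI; have mS := sigma_measurable CS.
rewrite RintegralB//; last 2 first.
- by apply: integrableS (integrable_sample i l).
- exact: finite_measure_integrable_cst.
rewrite Rintegral_cst// /Rintegral (independent_integral iidX CS lI (mphiE i)); last first.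
  by move=> x; rewrite lee_fin.
rewrite fineM ?fin_num_measure//; first by rewrite mulrC subrr.
exact: integrable_fin_num.
Qed.

Let dev i j w := Y i j w - c i.

Let idev i j : P.-integrable setT (EFin \o dev i j).
Proof.
exact: (integrableB measurableT (integrable_sample i j) (finite_measure_integrable_cst P (c i) measurableT)).
Qed.

Variable e : {ffun 'I_m -> bool}.
Let U (b : bool) i w := \sum_(j | e j == b) dev i j w.

Let iU b i : P.-integrable setT (EFin \o U b i).
Proof. exact: integrable_rsum. Qed.

Let iAbs (f : 'I_n -> T -> R) : (forall i, P.-integrable setT (EFin \o f i)) ->
  P.-integrable setT (EFin \o (fun w => \big[Num.max/0]_(i < n) `|f i w|)).
Proof. by move=> h; apply: integrable_bigmax => i; exact: integrable_norm. Qed.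

Let iZl (f : T -> R) a : P.-integrable setT (EFin \o f) ->
  P.-integrable setT (EFin \o (fun w => a * f w)).
Proof. by move=> h; exact: (integrableZl measurableT a h). Qed.

(** The coordinates of sign b generate the sigma-algebra; the sum over the others is centred on each
    of its events and can be subtracted inside the maximum. *)
Let decouple b : \int[P]_w (\big[Num.max/0]_(i < n) `|U b i w|) <=
  \int[P]_w (\big[Num.max/0]_(i < n) `|U b i w - U (~~ b) i w|).
Proof.
pose I := [set j | e j == b]%SET.
pose V (k : 'I_n * bool) w := sgn k.2 * U b k.1 w.
pose V' (k : 'I_n * bool) w := sgn k.2 * U (~~ b) k.1 w.
have VE w : \big[Num.max/0]_k V k w = \big[Num.max/0]_(i < n) `|U b i w|.
  exact: (bigmax_signed (fun i => U b i w)).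
have VE' w : \big[Num.max/0]_k (V k w - V' k w) = \big[Num.max/0]_(i < n) `|U b i w - U (~~ b) i w|.
  by rewrite -bigmax_signed; apply: eq_bigr => k _; rewrite /V /V' mulrBr.
under eq_Rintegral do rewrite -VE.
under [leRHS]eq_Rintegral do rewrite -VE'.
apply: (@decoupling R d T P (cylinders X I) (@cylinders_measurable _ _ _ _ _ _ X I) _
  (index_enum ('I_n * bool)%type) V V') => //.
- move=> [i s] /=; apply: measurable_funM => //.
  rewrite (_ : U b i = fun w => \sum_j (if e j == b then dev i j w else 0)); last first.
    by apply/funext => w; rewrite /U big_mkcond.
  apply: measurable_sum => j; case: (boolP (e j == b)) => // ejb.
  apply: measurable_funB => //; apply: (measurableT_comp (mphi i)).
  move=> _ A mA; rewrite setTI; apply: sub_sigma_algebra.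
  by apply: cylinders_preimage => //; rewrite inE.
- by move=> [i s]; exact: (iZl (sgn s) (iU _ i)).
- by move=> [i s]; exact: (iZl (sgn s) (iU _ i)).
- move=> [i s] S CS; have mS := sigma_measurable CS.
  have iS j : P.-integrable S (EFin \o dev i j) by exact: integrableS (idev i j).
  rewrite RintegralZl//; last exact: integrable_rsum.
  rewrite Rintegral_rsum// big1 ?mulr0// => j ej.
  apply: Rintegral_sample_independent CS _; rewrite inE.
  by move: ej => /eqP->; case: (b).
- exact: (@measurableT _ (g_sigma_algebraType (cylinders X I))).
Qed.

(** No independent copy of the sample is introduced. The deviations split as U true + U false;
    subtracting the opposite part turns each into the signed sum of the deviations, whose centring
    constant [k0] is at most Z by Jensen's inequality. This gives 4 = 2 * 2 for every single sign
    pattern. *)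
Lemma symmetrization :
  \int[P]_w (\big[Num.max/0]_(i < n) `|\sum_j (phi i (X j w) - c i)|) <=
  4 * \int[P]_w (\big[Num.max/0]_(i < n) `|rad_sum (fun j => phi i (X j w)) e|).
Proof.
set Z := \int[P]_w (\big[Num.max/0]_(i < n) `|rad_sum _ e|).
have irad i : P.-integrable setT (EFin \o (fun w => rad_sum (fun j => Y i j w) e)).
  by apply: integrable_rsum => // j; exact: (iZl (sgn (e j)) (integrable_sample i j)).
have iZ := iAbs irad.
have Eself i : \int[P]_w rad_sum (fun j => Y i j w) e = rad_sum (fun=> c i) e.
  rewrite /rad_sum Rintegral_rsum//; last first.
    by move=> j; exact: (iZl (sgn (e j)) (integrable_sample i j)).
  by apply: eq_bigr => j _; rewrite RintegralZl ?Rintegral_sample//; exact: integrable_sample.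
pose k0 := \big[Num.max/0]_(i < n) `|rad_sum (fun=> c i) e|.
have k0Z : k0 <= Z.
  apply: bigmax_le => [|i _]; first by apply: Rintegral_ge0 => w _; exact: bigmax_ge_id.
  rewrite -Eself; apply: le_trans (le_normr_Rintegral measurableT (irad i)) _.
  apply: le_Rintegral => //; first exact: integrable_norm.
  by move=> w _; exact: (le_bigmax _ (fun i => `|rad_sum (fun j => Y i j w) e|) i).
have UE b i w : `|U b i w - U (~~ b) i w| = `|rad_sum (fun j => Y i j w) e - rad_sum (fun=> c i) e|.
  have rE : rad_sum (fun j => Y i j w) e - rad_sum (fun=> c i) e = U false i w - U true i w.
    rewrite /rad_sum -sumrB (bigID (fun j => e j == false))/= /U -sumrN; congr (_ + _).
      by apply: eq_bigr => j /eqP->; rewrite /sgn !mul1r.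
    rewrite (eq_bigl (fun j => e j == true)); last by move=> j; case: (e j).
    by apply: eq_bigr => j /eqP->; rewrite /sgn expr1 !mulN1r opprB addrC opprK.
  by rewrite rE; case: b => //=; rewrite distrC.
have dec b : \int[P]_w (\big[Num.max/0]_(i < n) `|U b i w|) <= 2 * Z.
  apply: le_trans (decouple b) _.
  have ic := finite_measure_integrable_cst P k0 measurableT.
  apply: (@le_trans _ _ (\int[P]_w ((\big[Num.max/0]_(i < n) `|rad_sum (fun j => Y i j w) e|) + k0))).
    apply: le_Rintegral => //.
    - by apply: (@iAbs (fun i w => U b i w - U (~~ b) i w)) => i; exact: (integrableB measurableT (iU b i) (iU (~~ b) i)).
    - exact: (integrableD measurableT iZ ic).
    move=> w _; apply: bigmax_le => [|i _]; first by rewrite addr_ge0// bigmax_ge_id.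
    rewrite UE; apply: le_trans (ler_normB _ _) _; apply: lerD.
      exact: (le_bigmax _ (fun i => `|rad_sum (fun j => Y i j w) e|) i).
    exact: (le_bigmax _ (fun i => `|rad_sum (fun=> c i) e|) i).
  rewrite RintegralD// Rintegral_cst//= probability_setT mulr1.
  by rewrite mulr_natl mulr2n lerD2l.
apply: (@le_trans _ _ (\int[P]_w ((\big[Num.max/0]_(i < n) `|U true i w|) +
    \big[Num.max/0]_(i < n) `|U false i w|))).
  apply: le_Rintegral => //.
  - by apply: (@iAbs (fun i w => \sum_j dev i j w)) => i; exact: integrable_rsum.
  - exact: (integrableD measurableT (iAbs (iU true)) (iAbs (iU false))).
  move=> w _; apply: bigmax_le => [|i _]; first by rewrite addr_ge0// bigmax_ge_id.
  rewrite (bigID (fun j => e j == true))/=; apply: le_trans (ler_normD _ _) _; apply: lerD.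
    exact: (le_bigmax _ (fun i => `|U true i w|) i).
  rewrite (eq_bigl (fun j => e j == false)); last by move=> j; case: (e j).
  exact: (le_bigmax _ (fun i => `|U false i w|) i).
rewrite RintegralD//; [|exact: iAbs|exact: iAbs].
by apply: le_trans (lerD (dec _) (dec _)) _; rewrite -mulrDl; have -> : 2 + 2 = 4 :> R by ring.
Qed.

End symmetrization.

(** * Self-bounding and the expected discrepancy *)

Section self_bounding.
Context {R : realType}.

(** The product is unchanged when x is multiplied by lam^(s-1) and y by lam^-1; the free parameter
    permits absorption later. *)
Lemma young_le (s x y lam : R) : 1 < s -> 0 <= x -> 0 <= y -> 0 < lam ->
  x `^ s^-1 * y `^ (1 - s^-1) <= lam `^ (s - 1) * x + lam^-1 * y.
Proof.
move=> s1 x0 y0 l0; have s0 : 0 < s by exact: lt_trans s1.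
have is0 : 0 <= s^-1 by rewrite invr_ge0 ltW.
have is1 : 0 <= 1 - s^-1 by rewrite subr_ge0 invf_le1// ltW.
have lE : (lam `^ (s - 1)) `^ s^-1 * (lam^-1) `^ (1 - s^-1) = 1.
  rewrite -[lam^-1]powR_inv1 ?(ltW l0)// -!powRrM -powRD; last by rewrite (gt_eqF l0) implybT.
  by rewrite (_ : _ + _ = 0) ?powRr0//; field; rewrite gt_eqF.
have a0 : 0 <= lam `^ (s - 1) * x by rewrite mulr_ge0 ?powR_ge0.
have b0 : 0 <= lam^-1 * y by rewrite mulr_ge0// invr_ge0 ltW.
have -> : x `^ s^-1 * y `^ (1 - s^-1) = (lam `^ (s - 1) * x) `^ s^-1 * (lam^-1 * y) `^ (1 - s^-1).
  by rewrite !powRM ?powR_ge0 ?invr_ge0 ?(ltW l0)// mulrACA lE mul1r.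
apply: le_trans (powR_mul_le_add a0 b0 is0 is1) _.
by rewrite [s^-1 + _]addrC subrK !powRr1.
Qed.

(** For lam >= 2 c the term with Z on the right is at most Z / 2 and is absorbed. Then lam = 2 c
    max(1, (S/A)^(1/s)) balances the other two. *)
Lemma self_bound (s c : R) : 1 < s -> 0 < c ->
  exists2 C, 0 < C & forall A S Z : R, 0 <= A -> 0 <= S -> 0 <= Z ->
    (forall lam, 0 < lam -> Z <= c * (lam `^ (s - 1) * A + lam^-1 * (S + Z))) ->
    Z <= C * (A + A `^ s^-1 * S `^ (1 - s^-1)).
Proof.
move=> s1 c0; have s0 : 0 < s by exact: lt_trans s1.
have c2 : 0 < 2 * c by rewrite mulr_gt0.
pose C := 2 * c * ((2 * c) `^ (s - 1) + (2 * c)^-1).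
have C0 : 0 < C by rewrite mulr_gt0// addr_gt0 ?powR_gt0 ?invr_gt0.
exists C => // A S Z A0 S0 Z0 h.
have {}h lam : 2 * c <= lam -> Z <= 2 * c * (lam `^ (s - 1) * A + lam^-1 * S).
  move=> cl; have l0 : 0 < lam by exact: lt_le_trans cl.
  have := h lam l0; have hl : c * (lam^-1 * Z) <= Z / 2.
    rewrite mulrA [leRHS]mulrC ler_wpM2r// ler_pdivrMr//; move: cl; clear; lra.
  move: hl; clear; move: (lam `^ _) (lam^-1) => u v; lra.
have G0 : 0 <= A `^ s^-1 * S `^ (1 - s^-1) by rewrite mulr_ge0 ?powR_ge0.
move: A0; rewrite le_eqVlt => /predU1P[A0|A0].
  have [Zp|Zn] := ltP 0 Z; last by apply: le_trans Zn _; rewrite mulr_ge0 ?(ltW C0)// addr_ge0// -A0.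
  (* With A = 0 the claim is Z <= 0, the limit of lam to infinity; this value of lam already
     contradicts Z > 0. *)
  pose lam := 2 * c + 4 * c * S / Z.
  have l1 : 2 * c <= lam by rewrite lerDl divr_ge0// !mulr_ge0// ltW.
  have l0 : 0 < lam by exact: lt_le_trans l1.
  have := h lam l1; rewrite -A0 mulr0 add0r mulrCA mulrC ler_pdivlMr//.
  rewrite /lam mulrDr [Z * (_ / Z)]mulrC divfK ?gt_eqF//.
  have := mulr_gt0 Zp c2; have := mulr_ge0 (ltW c0) S0.
  by clear; lra.
have [SA|AS] := leP S A.
  apply: le_trans (h _ (lexx _)) _; rewrite /C -[leRHS]mulrA ler_pM2l//.
  apply: (@le_trans _ _ (((2 * c) `^ (s - 1) + (2 * c)^-1) * A)).
    by rewrite [leRHS]mulrDl lerD2l ler_pM2l// invr_gt0.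
  by rewrite ler_pM2l ?lerDl// addr_gt0 ?powR_gt0 ?invr_gt0.
have Sp : 0 < S by exact: lt_trans AS.
pose t := (S / A) `^ s^-1.
have t0 : 0 < t by rewrite powR_gt0// divr_gt0.
have t1 : 1 <= t.
  have := @ler_powR2l R 1 (S / A) s^-1 ler01; rewrite powR1 ler_pdivlMr// mul1r.
  by apply; rewrite ?invr_ge0 ltW.
have tE : t = S `^ s^-1 * A `^ (- s^-1).
  by rewrite /t powRM ?invr_ge0 ?(ltW A0)// -[A^-1]powR_inv1 ?(ltW A0)// -powRrM mulN1r.
have e1 : t `^ (s - 1) * A = A `^ s^-1 * S `^ (1 - s^-1).
  rewrite tE powRM ?powR_ge0// -!powRrM -{2}[A]powRr1 ?(ltW A0)//.
  rewrite -mulrA -powRD; last by rewrite (gt_eqF A0) implybT.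
  by rewrite mulrC; congr (_ `^ _ * _ `^ _); field; rewrite gt_eqF.
have e2 : t^-1 * S = A `^ s^-1 * S `^ (1 - s^-1).
  rewrite tE invfM -!powRN opprK -{2}[S]powRr1// mulrAC -powRD; last by rewrite (gt_eqF Sp) implybT.
  by rewrite mulrC addrC.
have := h (2 * c * t); rewrite ler_peMr ?(ltW c2)// => /(_ isT)/le_trans; apply.
rewrite /C -[leRHS]mulrA ler_pM2l// powRM ?(ltW c2) ?(ltW t0)// -mulrA e1 invfM -mulrA e2 -[leLHS]mulrDl.
by rewrite ler_pM2l ?lerDr ?(ltW A0)// addr_gt0 ?powR_gt0 ?invr_gt0.
Qed.

End self_bounding.

Section sampling.
Context {R : realType}.

Lemma measurable_countable_sup (d : measure_display) (T : measurableType d) (I : Type)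
    (B : set I) (g : I -> T -> \bar R) :
  countable B -> (forall f, B f -> measurable_fun setT (g f)) ->
  measurable_fun setT (fun w => ereal_sup [set g f w | f in B]).
Proof.
move=> /pfcard_geP[->|[e']] mg.
  by under eq_fun do rewrite image_set0; exact: measurable_cst.
have [e eB] : exists e : nat -> I, range e = B by exists e'; exact: image_eq.
rewrite (_ : (fun _ => _) = (fun w => esups (fun n => g (e n) w) 0%N)).
  by apply: measurable_fun_esups => n; apply: mg; rewrite -eB; exists n.
apply/funext => w; rewrite /esups /sdrop -eB; congr ereal_sup.
apply/seteqP; split=> [_ [_ [n _ <-] <-]|_ [n _ <-]]; first by exists n.
by exists (e n) => //; exists n.
Qed.

Section discrepancy_bound.
Context {Omega : ptopologicalType} {d : measure_display} {T : measurableType d}.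
Context (P : probability T R) (mu : probability (borel Omega) R).
Variables (p : R) (m : nat) (X : 'I_m -> {RV P >-> borel Omega}).
Hypotheses (p1 : 1 <= p) (m0 : (0 < m)%N) (iidX : iid_sample mu X).

Let p0 : p != 0. Proof. by rewrite gt_eqF// (lt_le_trans _ p1). Qed.

Let phi (f : Omega -> R) : borel Omega -> R := fun x => `|f x| `^ p.

Lemma measurable_pow f : f \in Lfun mu p%:E -> measurable_fun setT (phi f).
Proof.
rewrite inE => /andP[/[!inE]/= mf _].
apply: (measurableT_comp (measurable_powR _)) => //.
exact: measurableT_comp.
Qed.

Lemma discrepancyE f x : f \in Lfun mu p%:E ->
  discrepancy mu p f x =
  `|m%:R^-1 * \sum_(j < m) `|f (x j)| `^ p - \int[mu]_y phi f y|%:E.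
Proof.
move=> Lf; rewrite /discrepancy powR_Lnorm// (_ : \int[mu]_y _ = (\int[mu]_y phi f y)%:E)%E.
  by rewrite -EFinB.
rewrite /Rintegral fineK//; apply: integrable_fin_num => //; exact: Lfun_integrable.
Qed.

Lemma discrepancy_measurable f : f \in Lfun mu p%:E ->
  measurable_fun [set: T] (fun w => discrepancy mu p f (fun j => X j w)).
Proof.
move=> Lf; under eq_fun do rewrite discrepancyE//.
apply/measurable_EFinP; apply: measurableT_comp => //; apply: measurable_funB => //.
apply: measurable_funM => //; apply: measurable_sum => j.
exact: (measurableT_comp (measurable_pow Lf)).
Qed.

Lemma sampleE f j : f \in Lfun mu p%:E ->
  (\int[P]_w (`|f (X j w)| `^ p)%:E = \int[mu]_x (phi f x)%:E)%E.
Proof.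
move=> Lf; rewrite -(@ge0_integral_distribution _ _ _ _ _ P (X j) (EFin \o phi f)).
- by apply: eq_measure_integral => C mC _; case: iidX => h _; exact: h.
- by apply/measurable_EFinP; exact: measurable_pow.
by move=> y; rewrite lee_fin powR_ge0.
Qed.

Lemma expected_discrepancy_le (n : nat) (F : 'I_n -> Omega -> R) :
  (forall i, F i \in Lfun mu p%:E) ->
  (\int[P]_w (m%:R^-1 * \big[Num.max/0]_(i < n)
       `|\sum_(j < m) (phi (F i) (X j w) - \int[mu]_y phi (F i) y)|)%:E <=
   4%:E * \int[P]_w (m%:R^-1 *
     rad_mean (fun e => \big[Num.max/0]_(i < n) `|rad_sum (sample_pow p (X^~ w) (F i)) e|))%:E)%E.
Proof.
move=> LF.
have mF i := measurable_pow (LF i).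
have iF i : mu.-integrable setT (EFin \o phi (F i)) by exact: Lfun_integrable.
have F0 i x : 0 <= phi (F i) x by exact: powR_ge0.
have iS i j := integrable_sample iidX mF F0 iF i j.
have iU i : P.-integrable setT (EFin \o (fun w => \sum_(j < m) (phi (F i) (X j w) - \int[mu]_y phi (F i) y))).
  apply: integrable_rsum => // j.
  exact: (integrableB measurableT (iS i j) (finite_measure_integrable_cst P _ measurableT)).
pose Z w := \big[Num.max/0]_(i < n) `|\sum_(j < m) (phi (F i) (X j w) - \int[mu]_y phi (F i) y)|.
have iZ : P.-integrable setT (EFin \o Z).
  by apply: integrable_bigmax => i; exact: integrable_norm.
pose V e w := \big[Num.max/0]_(i < n) `|rad_sum (sample_pow p (X^~ w) (F i)) e|.
have iV e : P.-integrable setT (EFin \o V e).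
  apply: integrable_bigmax => i; apply: integrable_norm => //.
  apply: integrable_rsum => // j.
  exact: (integrableZl measurableT (sgn (e j)) (iS i j)).
have iRV : P.-integrable setT (EFin \o (fun w => rad_mean (V^~ w))).
  apply: (integrableZl measurableT (2 ^+ m)^-1 (f := EFin \o (fun w => \sum_e V e w))).
  exact: integrable_rsum.
have key : \int[P]_w Z w <= 4 * \int[P]_w rad_mean (V^~ w).
  have -> : \int[P]_w rad_mean (V^~ w) = rad_mean (fun e => \int[P]_w V e w).
    by rewrite /rad_mean RintegralZl ?Rintegral_rsum//; exact: integrable_rsum.
  rewrite -rad_meanZ -{1}(rad_mean_cst m (\int[P]_w Z w)); apply: rad_mean_le => e.
  exact: symmetrization.
have mi0 : 0 <= m%:R^-1 :> R by rewrite invr_ge0.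
have e1 (f : T -> R) : P.-integrable setT (EFin \o f) ->
    (\int[P]_w (m%:R^-1 * f w)%:E = (m%:R^-1 * \int[P]_w f w)%:E)%E.
  move=> intf; under eq_integral do rewrite EFinM.
  rewrite integralZl// EFinM /Rintegral fineK//; exact: integrable_fin_num.
rewrite (e1 Z iZ) (e1 (fun w => rad_mean (V^~ w)) iRV) -EFinM lee_fin.
by rewrite mulrCA ler_wpM2l.
Qed.

End discrepancy_bound.
End sampling.

(** * From fixed samples to expectations over a countable family *)

Section sampling_bound.
Context {R : realType}.
Local Open Scope ereal_scope.

Section fixed_family.
Context {Omega : ptopologicalType} {d : measure_display} {T : measurableType d}.
Context (P : probability T R) (mu : probability (borel Omega) R).
Variables (p s C0 c : R) (m : nat) (X : 'I_m -> {RV P >-> borel Omega}).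
Variables (B : set (Omega -> R)) (a : T -> \bar R).
Hypotheses (p1 : (1 <= p)%R) (s1 : (1 < s)%R) (C00 : (0 < C0)%R) (c0 : (0 <= c)%R).
Hypotheses (m0 : (0 < m)%N) (iidX : iid_sample mu X).
Hypotheses (Bc : countable B) (B0 : B !=set0) (LB : forall f, B f -> f \in Lfun mu p%:E).
Hypotheses (ma : measurable_fun setT a) (a0 : forall w, 0 <= a w).
Hypothesis dom : forall w f j, B f -> (`|f (X j w)| `^ p)%:E <= c%:E * a w.
Hypothesis bound : forall w r Q n (F : 'I_n -> Omega -> R), a w = r%:E -> (0 < Q)%R ->
  (forall f, B f -> (\sum_j `|f (X j w)| `^ p <= Q)%R) -> (forall i, B (F i)) ->
  (rad_mean (fun e => \big[Num.max/0]_(i < n) `|rad_sum (sample_pow p (X^~ w) (F i)) e|) <=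
     C0 * (r `^ s^-1 * Q `^ (1 - s^-1)))%R.

Let mr0 : (0 < m%:R^-1 :> R)%R. Proof. by rewrite invr_gt0 ltr0n. Qed.

Let emp (f : Omega -> R) w : R := (m%:R^-1 * \sum_j `|f (X j w)| `^ p)%R.

Let q w : \bar R := ereal_sup [set (emp f w)%:E | f in B].

Let disc (f : Omega -> R) w : \bar R := discrepancy mu p f (fun j => X j w).

Let emp0 f w : (0 <= emp f w)%R.
Proof. by rewrite mulr_ge0 ?(ltW mr0)// sumr_ge0// => j _; exact: powR_ge0. Qed.

Let q0 w : 0 <= q w.
Proof.
have [f Bf] := B0; apply: le_ereal_sup_tmp; exists (emp f w)%:E; first by exists f.
by rewrite lee_fin.
Qed.

Let q_le w : q w <= c%:E * a w.
Proof.
apply: ge_ereal_sup => _ [f Bf <-].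
have h j := dom w j Bf; move: h.
have : 0 <= c%:E * a w by apply: mule_ge0.
case: (c%:E * a w) => [r| |//] r0 h; last exact: leey.
rewrite lee_fin /emp ler_pdivrMl ?ltr0n//.
apply: (@le_trans _ _ (\sum_(j < m) r)%R); last by rewrite sumr_const card_ord mulr_natl.
by apply: ler_sum => j _; have := h j; rewrite lee_fin.
Qed.

(** [bound] asks for a positive Q, while the supremum of the empirical means may be 0; Q is enlarged
    by a term that contributes an arbitrary eps in the end. *)
Let young w n (F : 'I_n -> Omega -> R) lam : (forall i, B (F i)) -> (0 < lam)%R ->
  (m%:R^-1 * rad_mean (fun e => \big[Num.max/0]_(i < n) `|rad_sum (sample_pow p (X^~ w) (F i)) e|))%:E
  <= C0%:E * ((lam `^ (s - 1))%:E * ((m%:R^-1)%:E * a w) + (lam^-1)%:E * q w).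
Proof.
move=> BF lam0.
have l1 : (0 < lam `^ (s - 1))%R by rewrite powR_gt0.
have qw0 : 0 <= (lam^-1)%:E * q w by rewrite mule_ge0// lee_fin invr_ge0 ltW.
have := a0 w; case aE : (a w) => [r| |//] r0; last first.
  rewrite (gt0_muley (x := (m%:R^-1)%:E))// gt0_muley// addye; last first.
    by rewrite gt_eqF// (lt_le_trans _ qw0).
  by rewrite gt0_muley// leey.
have := q_le w; rewrite aE => qr.
have [Q QE] : exists Q, q w = Q%:E.
  have : q w \is a fin_num by rewrite ge0_fin_numE// (le_lt_trans qr)// ltry.
  by move=> /fineK <-; eexists.
have Q0 : (0 <= Q)%R by have := q0 w; rewrite QE.
rewrite QE -!EFinM lee_fin; apply/ler_addgt0Pr => eps eps0.
pose Q' := (m%:R * (Q + lam * eps / C0))%R.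
have eps1 : (0 < lam * eps / C0)%R by rewrite divr_gt0// mulr_gt0.
have Q'0 : (0 < Q')%R by rewrite mulr_gt0 ?ltr0n// ltr_wpDl.
have := @bound w r Q' n F aE Q'0 _ BF.
have hQ f : B f -> (\sum_j `|f (X j w)| `^ p <= Q')%R.
  move=> Bf; rewrite /Q' -ler_pdivrMl ?ltr0n//.
  apply: le_trans (_ : Q <= _)%R; last by rewrite lerDl ltW.
  by rewrite -lee_fin -QE; apply: ereal_sup_ubound; exists f.
move=> /(_ hQ) h.
have := young_le s1 r0 (ltW Q'0) lam0.
move=> /(ler_wpM2l (ltW C00)) /(le_trans h) /(ler_wpM2l (ltW mr0)) /le_trans; apply.
rewrite le_eqVlt; apply/orP; left; apply/eqP; rewrite /Q'; field.
by rewrite !gt_eqF// ltr0n.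
Qed.

Let S : \bar R := ereal_sup [set \int[mu]_x (`|(f : Omega -> R) x| `^ p)%:E | f in B].
Let A := (m%:R^-1)%:E * \int[P]_w a w.
Let Zs w := ereal_sup [set disc f w | f in B].
Let Z := \int[P]_w Zs w.

Let mq : measurable_fun setT q.
Proof.
apply: measurable_countable_sup => // f Bf.
apply/measurable_EFinP; apply: measurable_funM => //; apply: measurable_sum => j.
exact: (measurableT_comp (measurable_pow (LB Bf))).
Qed.

Let mdisc f : B f -> measurable_fun [set: T] (disc f).
Proof. by move=> Bf; apply: discrepancy_measurable => //; exact: LB. Qed.

Let disc0 f w : 0 <= disc f w.
Proof. exact: abse_ge0. Qed.

(** For fixed lam the bound is linear in [a] and [q], so it can be integrated directly; optimizing
    lam only afterwards spares Hölder's inequality for expectations. *)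
Let expected_disc_le lam : (0 < lam)%R ->
  expected_sup P B disc <= (4 * C0)%:E * ((lam `^ (s - 1))%:E * A + (lam^-1)%:E * \int[P]_w q w).
Proof.
move=> lam0; apply: ge_ereal_sup => _ [F [finF FB] <-].
have l1 : 0 <= (lam `^ (s - 1))%:E :> \bar R by rewrite lee_fin powR_ge0.
have l2 : 0 <= (lam^-1)%:E :> \bar R by rewrite lee_fin invr_ge0 ltW.
have rhs0 : 0 <= (4 * C0)%:E * ((lam `^ (s - 1))%:E * A + (lam^-1)%:E * \int[P]_w q w).
  rewrite mule_ge0 ?lee_fin ?mulr_ge0 ?(ltW C00)//.
  rewrite adde_ge0//; apply: mule_ge0 => //; last exact: integral_ge0.
  by rewrite /A mule_ge0 ?lee_fin ?(ltW mr0)// integral_ge0.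
have [us FE] := (finite_seqP F).1 finF.
pose n := size us; pose f (i : 'I_n) := tnth (in_tuple us) i.
have Bf i : B (f i) by apply: FB; rewrite FE /= mem_tnth.
have Lf i := LB (Bf i).
have ms i j : measurable_fun setT (fun w => `|f i (X j w)| `^ p)%R.
  exact: (measurableT_comp (measurable_pow (Lf i))).
apply: (@le_trans _ _ (\int[P]_w (m%:R^-1 * \big[Num.max/0]_(i < n)
       `|\sum_(j < m) (`|f i (X j w)| `^ p - \int[mu]_y (`|f i y| `^ p))%R|)%:E)).
  have [F0|[g Fg]] : F = set0 \/ F !=set0.
    by case: (pselect (F = set0)) => [|/eqP/set0P]; [left|right].
    rewrite (_ : (fun _ => _) = cst -oo).
      by rewrite integral_cst//= probability_setT mule1 leNye.
    by apply/funext => w; rewrite F0 image_set0 ereal_sup0.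
  apply: ge0_le_integral => //.
  - move=> w _; apply: le_ereal_sup_tmp; exists (disc g w); [by exists g|exact: disc0].
  - apply: measurable_countable_sup; first exact: finite_set_countable.
    by move=> h /FB; exact: mdisc.
  - apply/measurable_EFinP; apply: measurable_funM => //; apply: measurable_bigmax => i.
    apply: measurableT_comp => //; apply: measurable_sum => j.
    by apply: measurable_funB => //; exact: ms.
  move=> w _; apply: ge_ereal_sup => _ [h Fh <-].
  have [i hi] : exists i, h = f i.
    by move: Fh; rewrite FE /= => /(tnthP (in_tuple us))[i ->]; exists i.
  rewrite /disc hi discrepancyE// lee_fin.
  set c' := (\int[mu]_y _)%R; set x := fun j => (`|f i (X j w)| `^ p)%R.
  have -> : (m%:R^-1 * \sum_j x j - c' = m%:R^-1 * \sum_j (x j - c'))%R.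
    rewrite sumrB sumr_const card_ord -[(c' *+ m)%R]mulr_natl mulrBr mulrA mulVf ?mul1r//.
    by rewrite pnatr_eq0 -lt0n.
  rewrite normrM gtr0_norm// ler_wpM2l ?(ltW mr0)//.
  exact: (le_bigmax _ (fun i => `|\sum_(j < m) (`|f i (X j w)| `^ p - \int[mu]_y (`|f i y| `^ p))%R|)%R i).
apply: le_trans (expected_discrepancy_le p1 iidX Lf) _.
rewrite EFinM -muleA lee_pmul2l//.
pose h1 w := (lam `^ (s - 1))%:E * ((m%:R^-1)%:E * a w).
pose h2 w := (lam^-1)%:E * q w.
have m1 : measurable_fun setT h1.
  by apply: measurable_funeM; exact: measurable_funeM.
have m2 : measurable_fun setT h2 by exact: measurable_funeM.
have h10 w : 0 <= h1 w by rewrite mule_ge0// mule_ge0// lee_fin ltW.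
have h20 w : 0 <= h2 w by rewrite mule_ge0.
apply: (@le_trans _ _ (\int[P]_w (C0%:E * (h1 w + h2 w)))).
  apply: ge0_le_integral => //.
  - move=> w _; rewrite lee_fin mulr_ge0 ?(ltW mr0)// /rad_mean mulr_ge0 ?invr_ge0 ?exprn_ge0//.
    by apply: sumr_ge0 => e _; exact: bigmax_ge_id.
  - apply/measurable_EFinP; do 2![apply: measurable_funM => //]; apply: measurable_sum => e.
    apply: measurable_bigmax => i; apply: measurableT_comp => //; apply: measurable_sum => j.
    by apply: measurable_funM => //; exact: ms.
  - by apply: measurable_funeM; exact: emeasurable_funD.
  by move=> w _; exact: young.
have h120 w : setT w -> 0 <= h1 w + h2 w by move=> _; rewrite adde_ge0.
have m12 : measurable_fun setT (fun w => h1 w + h2 w) by exact: emeasurable_funD.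
have C0' := ltW C00.
rewrite (ge0_integralZl_EFin P measurableT h120 m12 C0').
rewrite (ge0_integralD P measurableT (fun w _ => h10 w) m1 (fun w _ => h20 w) m2).
have ma1 : measurable_fun setT (fun w => (m%:R^-1)%:E * a w) by exact: measurable_funeM.
have a10 w : setT w -> 0 <= (m%:R^-1)%:E * a w by move=> _; rewrite mule_ge0// lee_fin ltW.
rewrite (ge0_integralZl P measurableT ma1 a10 l1).
rewrite (ge0_integralZl_EFin P measurableT (fun w _ => a0 w) ma (ltW mr0)).
by rewrite (ge0_integralZl P measurableT mq (fun w _ => q0 w) l2).
Qed.

Let expected_discE : expected_sup P B disc = Z.
Proof. exact: (@expected_supE R d T P (Omega -> R)%type B B disc Bc B0 (@subset_refl _ B) mdisc (fun f w _ => disc0 f w) (fun=> erefl)). Qed.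

(** Source of the self-reference: empirical means exceed the true ones by at most the discrepancy
    that is being estimated. *)
Let q_le_sup w : q w <= S + Zs w.
Proof.
apply: ge_ereal_sup => _ [f Bf <-].
have cE : \int[mu]_x (`|(f : Omega -> R) x| `^ p)%:E = (\int[mu]_x (`|f x| `^ p))%R%:E.
  by rewrite /Rintegral fineK//; apply: integrable_fin_num => //; exact: Lfun_integrable (LB Bf).
apply: (@le_trans _ _ ((\int[mu]_x (`|f x| `^ p))%R%:E + disc f w)).
  by rewrite /disc discrepancyE ?LB// -EFinD lee_fin -lerBlDl; exact: ler_norm.
apply: leeD; last by apply: ereal_sup_ubound; exists f.
by rewrite -cE; apply: ereal_sup_ubound; exists f.
Qed.

Let S_le : S <= c%:E * \int[P]_w a w.
Proof.
apply: ge_ereal_sup => _ [f Bf <-]; rewrite -(sampleE iidX (Ordinal m0) (LB Bf)).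
rewrite -(ge0_integralZl_EFin P measurableT (fun w _ => a0 w) ma c0); apply: ge0_le_integral => //.
- by apply/measurable_EFinP; exact: (measurableT_comp (measurable_pow (LB Bf))).
- exact: measurable_funeM.
by move=> w _; exact: dom.
Qed.

Let S0 : 0 <= S.
Proof.
have [f Bf] := B0; apply: le_ereal_sup_tmp; exists (\int[mu]_x (`|(f : Omega -> R) x| `^ p)%:E); first by exists f.
by apply: integral_ge0 => x _; rewrite lee_fin powR_ge0.
Qed.

Let Zs0 w : 0 <= Zs w.
Proof. by have [f Bf] := B0; apply: le_ereal_sup_tmp; exists (disc f w); [exists f|exact: disc0]. Qed.

Let mZs : measurable_fun setT Zs.
Proof. exact: measurable_countable_sup. Qed.

(** Absorption requires Z to be finite beforehand. If the integral of [a] is infinite, so is the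
    right side; otherwise [dom] makes S and the integral of [q] finite, and lam = 1 bounds Z. *)
Lemma expected_discrepancy_bound (C : R) : (0 < C)%R ->
  (forall A S Z : R, 0 <= A -> 0 <= S -> 0 <= Z ->
    (forall lam, 0 < lam -> Z <= 4 * C0 * (lam `^ (s - 1) * A + lam^-1 * (S + Z))) ->
    Z <= C * (A + A `^ s^-1 * S `^ (1 - s^-1)))%R ->
  expected_sup P B disc <= C%:E * (A + A `^ s^-1 * S `^ (1 - s^-1)).
Proof.
move=> Cp opt; have ia0 : 0 <= \int[P]_w a w by exact: integral_ge0.
have := ia0; case iaE : (\int[P]_w a w) => [ia| |//] _; last first.
  rewrite /A iaE (gt0_muley (x := (m%:R^-1)%:E))// addye ?gt0_muley ?leey//.
  by rewrite gt_eqF// (lt_le_trans _ (mule_ge0 (poweR_ge0 _ _) (poweR_ge0 _ _))).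
have iqoo : \int[P]_w q w < +oo.
  apply: (@le_lt_trans _ _ (c%:E * \int[P]_w a w)); last by rewrite iaE ltry.
  rewrite -(ge0_integralZl_EFin P measurableT (fun w _ => a0 w) ma c0); apply: ge0_le_integral => //.
  exact: measurable_funeM.
have Soo : S < +oo by apply: le_lt_trans S_le _; rewrite iaE ltry.
have iq0 : 0 <= \int[P]_w q w by exact: integral_ge0.
have Z0 : 0 <= Z by exact: integral_ge0.
have AE : A = (m%:R^-1 * ia)%:E by rewrite /A iaE.
have Zoo : Z < +oo.
  rewrite -expected_discE; apply: le_lt_trans (expected_disc_le ltr01) _.
  move: iqoo; rewrite -ge0_fin_numE// => /fineK <-.
  by rewrite AE -!EFinM ltry.
rewrite expected_discE.
have /fineK ZE : Z \is a fin_num by rewrite ge0_fin_numE.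
have /fineK SE : S \is a fin_num by rewrite ge0_fin_numE.
rewrite -ZE -SE AE !poweR_EFin -!EFinM lee_fin; apply: opt.
- by rewrite mulr_ge0 ?(ltW mr0)// -lee_fin -iaE.
- by rewrite -lee_fin SE.
- by rewrite -lee_fin ZE.
move=> lam lam0; rewrite -lee_fin ZE -[leLHS]expected_discE.
apply: le_trans (expected_disc_le lam0) _.
rewrite [leRHS]EFinM; apply: lee_wpmul2l; first by rewrite lee_fin mulr_ge0// ltW.
rewrite [leRHS]EFinD; apply: leeD; first by rewrite AE.
rewrite [leRHS]EFinM; apply: lee_wpmul2l; first by rewrite lee_fin invr_ge0 ltW.
rewrite [leRHS]EFinD SE ZE.
apply: (@le_trans _ _ (\int[P]_w (S + Zs w))).
  by apply: ge0_le_integral => //; apply: emeasurable_funD => //; exact: measurable_cst.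
rewrite ge0_integralD//.
by rewrite integral_cst//= probability_setT mule1.
Qed.

End fixed_family.
End sampling_bound.

(** * Reduction of the supremum to countable rational unit balls *)

Section reduction.
Context {R : realType}.

Lemma rational_span (Omega : ptopologicalType) (L F : set (Omega -> R)) :
  linear_subspace L -> finite_set F -> F `<=` L ->
  exists L0, [/\ countable L0, rational_subspace L0, L0 `<=` L & F `<=` L0].
Proof.
move=> Llin /finite_seqP[us FE] FL.
pose n := size us; pose f (i : 'I_n) := tnth (in_tuple us) i.
have Lf i : L (f i) by apply: FL; rewrite FE /= mem_tnth.
pose comb (q : {ffun 'I_n -> rat}) : Omega -> R := \sum_i ratr (q i) *: f i.
exists (comb @` setT); split.
- exact: sub_countable (card_image_le _ _) (countableP _).
- split=> [|_ _ [q _ <-] [q' _ <-]|r _ [q _ <-]].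
  + by exists [ffun=> 0] => //; rewrite /comb big1// => i _; rewrite ffunE rmorph0 scale0r.
  + exists [ffun i => q i - q' i] => //; rewrite /comb -sumrB; apply: eq_bigr => i _.
    by rewrite ffunE rmorphB scalerBl.
  + exists [ffun i => r * q i] => //; rewrite /comb scaler_sumr; apply: eq_bigr => i _.
    by rewrite ffunE rmorphM scalerA.
- by move=> _ [q _ <-]; apply: subspace_sum => // i; exact: subspaceZ.
- move=> g; rewrite FE /= => /(tnthP (in_tuple us))[i gi].
  exists [ffun j => (j == i)%:R] => //; rewrite /comb (bigD1 i)//= ffunE eqxx rmorph1 scale1r.
  rewrite big1 ?addr0 -?gi// => j ji.
  by rewrite ffunE (negbTE ji) rmorph0 scale0r.
Qed.

(** [expected_sup] ranges over finite F, so each F may be placed in the unit ball B0 of its own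
    rational span. The fixed-sample bound is required only for M the least bound of |f(X_j)| over
    B0, which makes M comparable with [sup_max_pow]; if M = 0, all sums of signs vanish. *)
Lemma expected_sup_bound (p s C0 : R) : 1 <= p -> 1 < s -> 0 < C0 ->
  exists2 C, 0 < C & forall (m : nat) (m0 : (0 < m)%N) (Omega : ptopologicalType)
    (mu : probability (borel Omega) R) (d : measure_display) (T : measurableType d)
    (P : probability T R) (X : 'I_m -> {RV P >-> borel Omega})
    (L : set (Omega -> R)) (N : (Omega -> R) -> R) (a : T -> \bar R) (c : R),
  linear_subspace L -> is_norm L N -> (forall f, L f -> f \in Lfun mu p%:E) ->
  iid_sample mu X -> measurable_fun setT a -> (forall w, (0 <= a w)%E) -> 0 <= c ->
  (forall w f j, unit_ball L N f -> ((`|f (X j w)| `^ p)%:E <= c%:E * a w)%E) ->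
  (forall (L0 : set (Omega -> R)) w r M Q n (F : 'I_n -> Omega -> R),
    L0 `<=` L -> rational_subspace L0 -> a w = r%:E -> 0 < M -> 0 < Q ->
    let B0 := [set f | L0 f /\ N f <= 1] in
    (forall f j, B0 f -> `|f (X j w)| <= M) ->
    (forall K, (forall f j, B0 f -> `|f (X j w)| <= K) -> M <= K) ->
    (forall f, B0 f -> \sum_j `|f (X j w)| `^ p <= Q) -> (forall i, B0 (F i)) ->
    rad_mean (fun e => \big[Num.max/0]_(i < n) `|rad_sum (sample_pow p (X^~ w) (F i)) e|) <=
      C0 * (r `^ s^-1 * Q `^ (1 - s^-1))) ->
  forall A S : \bar R, A = ((m%:R^-1)%:E * \int[P]_w a w)%E ->
  S = ereal_sup [set \int[P]_w (`|f (X (Ordinal m0) w)| `^ p)%:E | f in unit_ball L N]%E ->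
  (expected_sup P (unit_ball L N) (fun f w => discrepancy mu p f (fun j => X j w))
     <= C%:E * (A + A `^ s^-1 * S `^ (1 - s^-1)))%E.
Proof.
move=> p1 s1 C00; have p0 : 0 < p by exact: lt_le_trans p1.
have [C Cp opt] := @self_bound R s (4 * C0) s1 (mulr_gt0 (ltr0n _ 4) C00).
exists C; first exact: Cp.
move=> m m0 Omega mu d T P X L N a c Llin HN LL iid ma a0 c0 dom bound.
move=> A S AE SE.
apply: ge_ereal_sup => _ [F [finF FB] <-].
have FL : F `<=` L by move=> f /FB[].
have [L0 [L0c L0r L0L FL0]] := rational_span Llin finF FL.
pose B0 := [set f | L0 f /\ N f <= 1].
have B0B : B0 `<=` unit_ball L N by move=> f [/L0L Lf Nf].
have FB0 : F `<=` B0 by move=> f Ff; split; [exact: FL0|case: (FB f Ff)].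
have B0c : countable B0.
  by apply: sub_countable L0c; apply: subset_card_le => f [].
have B00 : B0 !=set0.
  have [L00 _ _] := L0r.
  by exists 0; split => //; rewrite (is_norm0 (L0L _ L00) HN) ler01.
have LB0 f : B0 f -> f \in Lfun mu p%:E by move=> /B0B[/LL].
have bound0 w r Q n (G : 'I_n -> Omega -> R) : a w = r%:E -> 0 < Q ->
    (forall f, B0 f -> \sum_j `|f (X j w)| `^ p <= Q) -> (forall i, B0 (G i)) ->
    rad_mean (fun e => \big[Num.max/0]_(i < n) `|rad_sum (sample_pow p (X^~ w) (G i)) e|) <=
      C0 * (r `^ s^-1 * Q `^ (1 - s^-1)).
  move=> awr Q0 hQ BG.
  pose E := [set x | exists f j, B0 f /\ x = `|f (X j w)|].
  have E0 : E !=set0 by have [f Bf] := B00; exists `|f (X (Ordinal m0) w)|, f, (Ordinal m0).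
  have supE : has_sup E.
    split => //; exists (Q `^ p^-1) => _ [f [j [Bf ->]]].
    rewrite -[leLHS](@powRK R _ p)//; last by rewrite gt_eqF.
    apply: ler_powR2l; rewrite ?powR_ge0 ?invr_ge0 ?(ltW p0)//.
    apply: le_trans (hQ f Bf); rewrite (bigD1 j)//= lerDl.
    by apply: sumr_ge0 => i _; exact: powR_ge0.
  have Eub f j : B0 f -> `|f (X j w)| <= sup E.
    by move=> Bf; apply: ub_le_sup; [case: supE|exists f, j].
  have [Mp|M0] := ltP 0 (sup E).
    apply: (bound L0 w r (sup E) Q n G) => // K hK.
    by apply: ge_sup => // _ [f [j [Bf ->]]]; exact: hK.
  have z f j : B0 f -> sample_pow p (X^~ w) f j = 0.
    move=> Bf; have /normr0_eq0 h : `|f (X j w)| = 0.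
      by apply/eqP; rewrite eq_le normr_ge0 andbT; apply: le_trans (Eub f j Bf) M0.
    by rewrite /sample_pow h normr0 powR0// gt_eqF.
  rewrite (_ : (fun _ => _) = (fun=> 0)).
    by rewrite rad_mean_cst mulr_ge0 ?(ltW C00)// mulr_ge0 ?powR_ge0.
  apply/funext => e; apply/le_anti/andP; split; last exact: bigmax_ge_id.
  apply: bigmax_le => // i _; rewrite /rad_sum big1 ?normr0// => j _.
  by rewrite z// mulr0.
have := @expected_discrepancy_bound R Omega d T P mu p s C0 c m X B0 a p1 s1 C00 c0 m0 iid
  B0c B00 LB0 ma a0 (fun w f j Bf => dom w f j (B0B f Bf)) bound0 C Cp opt.
rewrite -AE; set S0 := ereal_sup _ => h.
have S0S : (S0 <= S)%E.
  rewrite SE; apply: ge_ereal_sup => _ [f Bf <-]; apply: ereal_sup_ubound; exists f; first exact: B0B.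
  by rewrite (sampleE iid (Ordinal m0) (LB0 f Bf)).
have h0 : (0 <= S0)%E.
  have [f Bf] := B00; apply: le_ereal_sup_tmp; eexists; first by exists f.
  by apply: integral_ge0 => x _; rewrite lee_fin powR_ge0.
apply: le_trans (_ : _ <= expected_sup P B0 (fun f w => discrepancy mu p f (fun j => X j w)))%E _.
  by apply: ereal_sup_ubound; exists F.
apply: le_trans h _; apply: lee_wpmul2l; first by rewrite lee_fin ltW.
rewrite leeD2l// lee_wpmul2l ?poweR_ge0//.
apply: gt0_ler_poweR => //; first by rewrite subr_ge0 invf_le1 ?ltW// (lt_trans _ s1).
- by rewrite in_itv/= leey h0.
- by rewrite in_itv/= leey (le_trans h0).
Qed.

End reduction.

Section sample_suprema.
Context {R : realType} {Omega : ptopologicalType} (m : nat) (m0 : (0 < m)%N).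
Variables (L : set (Omega -> R)) (N : (Omega -> R) -> R).
Hypotheses (Llin : linear_subspace L) (HN : is_norm L N).

Let B := unit_ball L N.

Lemma unit_ball0 : B 0.
Proof. by have [L0 _] := Llin; split => //; rewrite (is_norm0 L0 HN) ler01. Qed.

Lemma unit_ballN f : B f -> B (- f).
Proof.
move=> [Lf Nf]; rewrite -scaleN1r; split; first exact: subspaceZ.
by have [_ _ NZ _] := HN; rewrite NZ// normrN1 mul1r.
Qed.

Lemma entropy_bound_sup (W : ('I_m -> Omega) -> R) (alpha : R) x f j :
  entropy_bound B alpha W -> B f -> `|f (x j)| <= W x.
Proof. by move=> ent; apply: (@entropy0_sup _ _ _ x B (W x) alpha); [exact: unit_ballN|exact: ent]. Qed.

Lemma sup_max_pow_ge (D : set (Omega -> R)) (rho : R) (x : 'I_m -> Omega) f j : D f ->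
  ((`|f (x j)| `^ rho)%:E <= sup_max_pow D rho x)%E.
Proof.
move=> Df; apply: le_ereal_sup_tmp; eexists; first by exists f.
by rewrite lee_fin; exact: (le_bigmax _ (fun j => `|f (x j)| `^ rho) j).
Qed.

Lemma sup_max_pow_ge0 (D : set (Omega -> R)) (rho : R) (x : 'I_m -> Omega) : D 0 ->
  (0 <= sup_max_pow D rho x)%E.
Proof.
move=> D0; apply: le_trans (sup_max_pow_ge rho x (Ordinal m0) D0).
by rewrite lee_fin powR_ge0.
Qed.

(** For rho = 0 the supremum is at least 1, as [D] and the sample are nonempty. For rho > 0 the
    rho-th root of a finite supremum bounds |f(x_j)| on B0, and M is below every such bound. *)
Lemma sup_max_pow_least (D B0 : set (Omega -> R)) (rho M : R) (x : 'I_m -> Omega) :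
  D 0 -> B0 `<=` D -> 0 < M -> 0 <= rho ->
  (forall K, (forall f j, B0 f -> `|f (x j)| <= K) -> M <= K) ->
  ((M `^ rho)%:E <= sup_max_pow D rho x)%E.
Proof.
move=> D0 B0D M0; rewrite le_eqVlt => /predU1P[<-|rho0] least.
  apply: le_trans (sup_max_pow_ge 0 x (Ordinal m0) D0).
  by rewrite !powRr0.
have := sup_max_pow_ge0 rho x D0; have := fun f j => @sup_max_pow_ge D rho x f j.
case: (sup_max_pow D rho x) => [K| |//] h K0; last exact: leey.
rewrite lee_fin -[leRHS](@powRVK R _ rho) ?gt_eqF//.
apply: (ler_powR2l (ltW M0) _ (ltW rho0)); apply: least => f j Bf.
rewrite -[leLHS](@powRK R _ rho) ?gt_eqF//.
by apply: ler_powR2l; rewrite ?powR_ge0 ?invr_ge0 ?(ltW rho0)//; exact/h/B0D.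
Qed.

(** Splits p = alpha + (p - alpha) and uses |f(x_j)| <= W, the entropy bound of level 0. It supplies
    the majorant required by [expected_sup_bound]. *)
Lemma pow_le_sup_max_pow (W : ('I_m -> Omega) -> R) (alpha p : R) x f j :
  0 <= alpha <= p -> entropy_bound B alpha W -> B f ->
  ((`|f (x j)| `^ p)%:E <= (W x `^ alpha)%:E * sup_max_pow B (p - alpha) x)%E.
Proof.
move=> /andP[al0 alp] ent Bf.
rewrite -[p in leLHS](subrKC alpha) powRD_ge0 ?subr_ge0// EFinM.
apply: lee_pmul; rewrite ?lee_fin ?powR_ge0//; last exact: sup_max_pow_ge.
by apply: ler_powR2l => //; exact: entropy_bound_sup ent Bf.
Qed.

End sample_suprema.

Section roots.
Context {R : realType}.

(** Moves a logarithmic factor under the s-th root, where it becomes part of the quantity A. *)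
Lemma root_le (l x r s kappa : R) : 0 <= l -> 0 <= x -> 0 < s -> l `^ (s * kappa) * x <= r ->
  l `^ kappa * x `^ s^-1 <= r `^ s^-1.
Proof.
move=> l0 x0 s0 h.
have -> : l `^ kappa * x `^ s^-1 = (l `^ (s * kappa) * x) `^ s^-1.
  by rewrite powRM ?powR_ge0// -powRrM mulrAC mulfV ?mul1r// gt_eqF.
by apply: ler_powR2l; rewrite ?mulr_ge0 ?powR_ge0// invr_ge0 ltW.
Qed.

Lemma scaled_le (k x M r : R) (y : \bar R) : 0 <= k -> 0 <= x -> (M%:E <= y)%E ->
  (k%:E * (x%:E * y) <= r%:E)%E -> k * (x * M) <= r.
Proof.
move=> k0 x0 My h; rewrite -lee_fin; apply: le_trans h.
by rewrite EFinM lee_wpmul2l ?lee_fin// EFinM lee_wpmul2l ?lee_fin.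
Qed.

End roots.

(** * Assembly of the three sampling bounds *)

Theorem theorem3p5 (R : realType) (p theta alpha zeta : R)
    (hp : 1 < p) (htheta : 2 <= theta) (halpha : 0 < alpha) (hzeta : 0 < zeta) :
  [/\
  (* 1) *)
  alpha <= p ->
  exists C : R,
  forall (m : nat) (hm : (2 <= m)%N)
    (Omega : ptopologicalType) (mu : probability (borel Omega) R)
    (L B : set (Omega -> R)) (W_B : ('I_m -> Omega) -> R)
    (d : measure_display) (T : measurableType d) (P : probability T R)
    (X : 'I_m -> {RV P >-> borel Omega}),
  compact [set: Omega] ->
  linear_subspace L ->
  (forall f, L f -> f \in Lfun mu p%:E /\ continuous f) ->
  q_convex_body L theta zeta B ->
  entropy_bound B alpha W_B ->
  iid_sample mu X ->
  let Xw := fun w j => X j w in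
  let Y_B := fun w =>
    ((W_B (Xw w) `^ alpha)%:E * sup_max_pow B (p - alpha) (Xw w))%E in
  measurable_fun [set: T] Y_B ->
  let s := Num.max alpha 2 in
  let A := ((ln m%:R `^ (s * (1 - theta^-1)) / m%:R)%:E
            * \int[P]_w Y_B w)%E in
  let S := ereal_sup [set \int[P]_w (`|f (X (Ordinal (ltnW hm)) w)| `^ p)%:E
                     | f in B]%E in
  (expected_sup P B (fun f w => discrepancy mu p f (Xw w))
     <= C%:E * (A + A `^ s^-1 * S `^ (1 - s^-1)))%E,
  (* 2) *)
  Num.max alpha 2 <= p ->
  forall (q eta beta : R), 2 <= q -> 0 < eta -> 2 <= beta <= p ->
  exists C : R,
  forall (m : nat) (hm : (2 <= m)%N)
    (Omega : ptopologicalType) (mu : probability (borel Omega) R)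
    (L B D : set (Omega -> R)) (W_B W_D : ('I_m -> Omega) -> R)
    (d : measure_display) (T : measurableType d) (P : probability T R)
    (X : 'I_m -> {RV P >-> borel Omega}),
  compact [set: Omega] ->
  linear_subspace L ->
  (forall f, L f -> f \in Lfun mu p%:E /\ continuous f) ->
  q_convex_body L theta zeta B ->
  entropy_bound B alpha W_B ->
  q_convex_body L q eta D ->
  B `<=` D ->
  entropy_bound D beta W_D ->
  iid_sample mu X ->
  let Xw := fun w j => X j w in
  let Y_B := fun w =>
    ((W_B (Xw w) `^ alpha)%:E * sup_max_pow B (p - alpha) (Xw w))%E in
  let Y_D := fun w =>
    ((W_D (Xw w) `^ beta)%:E * sup_max_pow B (p - beta) (Xw w))%E in
  measurable_fun [set: T] Y_B ->
  measurable_fun [set: T] Y_D ->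
  let A_B := ((ln m%:R `^ (beta * Num.max (1 - p / theta) 0) / m%:R)%:E
              * \int[P]_w Y_B w)%E in
  let A_D := ((ln m%:R `^ (beta * (1 - q^-1)) / m%:R)%:E
              * \int[P]_w Y_D w)%E in
  let S := ereal_sup [set \int[P]_w (`|f (X (Ordinal (ltnW hm)) w)| `^ p)%:E
                     | f in B]%E in
  (expected_sup P B (fun f w => discrepancy mu p f (Xw w))
     <= C%:E * (A_B + A_D
                + (A_B + A_D) `^ beta^-1 * S `^ (1 - beta^-1)))%E
  & (* 3) *)
  Num.max alpha 2 <= p ->
  exists C : R,
  forall (m : nat) (hm : (2 <= m)%N)
    (Omega : ptopologicalType) (mu : probability (borel Omega) R)
    (L B D : set (Omega -> R)) (W_B : ('I_m -> Omega) -> R)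
    (d : measure_display) (T : measurableType d) (P : probability T R)
    (X : 'I_m -> {RV P >-> borel Omega}),
  compact [set: Omega] ->
  linear_subspace L ->
  (forall f, L f -> f \in Lfun mu p%:E /\ continuous f) ->
  q_convex_body L theta zeta B ->
  entropy_bound B alpha W_B ->
  euclidean_ball L D ->
  B `<=` D ->
  iid_sample mu X ->
  let Xw := fun w j => X j w in
  let Y_B := fun w =>
    ((W_B (Xw w) `^ alpha)%:E * sup_max_pow B (p - alpha) (Xw w))%E in
  let Y_D := fun w =>
    (sup_max_pow D 2 (Xw w) * sup_max_pow B (p - 2) (Xw w))%E in
  measurable_fun [set: T] Y_B ->
  measurable_fun [set: T] Y_D ->
  let A := ((m%:R^-1)%:E * \int[P]_w Y_D w
            + (ln m%:R `^ (2 * Num.max (1 - p / theta) 0) / m%:R)%:E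
              * \int[P]_w Y_B w)%E in
  let S := ereal_sup [set \int[P]_w (`|f (X (Ordinal (ltnW hm)) w)| `^ p)%:E
                     | f in B]%E in
  (expected_sup P B (fun f w => discrepancy mu p f (Xw w))
     <= C%:E * (A + A `^ 2^-1 * S `^ 2^-1))%E].
Proof.
have th1 : 1 <= theta by apply: le_trans htheta; rewrite ler1n.
have lnm0 m : (2 <= m)%N -> 0 < ln m%:R :> R by move=> m2; rewrite ln_gt0// ltr1n.
split.
- move=> alphap; pose s := Num.max alpha 2.
  have s2 : 2 <= s by rewrite le_max lexx orbT.
  have s1 : 1 < s by apply: lt_le_trans s2; rewrite ltr1n.
  have s0 : 0 < s by exact: lt_trans s1.
    have [C0 C00 fixed] := @sample_bound1 R p hp theta zeta alpha th1 hzeta halpha alphap.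
  have C01 : 0 < C0 + 1 by rewrite ltr_wpDl.
  have [C Cp red] := expected_sup_bound (ltW hp) s1 C01.
  exists C => m m2 Omega mu L B W d T P X cptO Llin LL [N [HN Ncvx BE]] entB iid Xw Y mY.
  subst B; have m0 := ltnW m2.
  have ln0 := lnm0 m m2.
  (* The logarithm is put into the random variable [k%:E * Y w], so that [expected_sup_bound]
     delivers A together with it. *)
  pose k : R := ln m%:R `^ (s * (1 - theta^-1)).
  have k0 : 0 < k by rewrite powR_gt0.
  have B0 := unit_ball0 Llin HN.
  have al0p : 0 <= alpha <= p by rewrite (ltW halpha).
  have Y0 w : (0 <= Y w)%E by rewrite mule_ge0 ?lee_fin ?powR_ge0// sup_max_pow_ge0.
  cbv zeta.
  apply: (red m (ltnW m2) Omega mu d T P X L N (fun w => k%:E * Y w)%E k^-1) => //.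
  + by move=> f /LL[].
  + exact: measurable_funeM.
  + by move=> w; rewrite mule_ge0// lee_fin ltW.
  + by rewrite invr_ge0 ltW.
  + move=> w f j Bf; rewrite muleA -EFinM mulVf ?gt_eqF// mul1e.
    exact: pow_le_sup_max_pow.
  + move=> L0 w r M Q n F L0L L0r aE M0 Q0 B0' BM least BQ BF.
    have B0B : [set f | L0 f /\ N f <= 1] `<=` unit_ball L N by move=> f [/L0L].
    have MW : M <= W (Xw w).
      by apply: least => f j /B0B Bf; exact: (entropy_bound_sup Llin HN (Xw w) j entB Bf).
    have W0 : 0 < W (Xw w) by exact: lt_le_trans MW.
    have := fixed Omega m (Xw w) L L0 N (W (Xw w)) M Q m2 HN Ncvx L0L L0r M0 MW Q0 (entB (Xw w)) BM BQ n F BF.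
    move=> /le_trans; apply; apply: ler_pM => //.
    * by rewrite mulr_ge0 ?powR_ge0// mulr_ge0 ?powR_ge0.
    * by rewrite lerDl.
    rewrite ler_wpM2r ?powR_ge0//; apply: root_le => //; first exact: ltW.
      by rewrite mulr_ge0 ?powR_ge0.
    apply: (@scaled_le _ _ _ _ _ (sup_max_pow (unit_ball L N) (p - alpha) (Xw w))); rewrite ?powR_ge0//.
      by apply: (sup_max_pow_least m0 B0 B0B M0) => //; rewrite subr_ge0.
    by rewrite -aE.
  rewrite (ge0_integralZl_EFin P measurableT (fun w _ => Y0 w) mY (ltW k0)).
  by rewrite muleA -EFinM mulrC.
- rewrite ge_max => /andP[alphap _] q eta beta q2 eta0 /andP[b2 bp].
  have q1 : 1 <= q by apply: le_trans q2; rewrite ler1n.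
  have be1 : 1 < beta by apply: lt_le_trans b2; rewrite ltr1n.
  have be0 : 0 < beta by exact: lt_trans be1.
  have [C0 C00 fixed] := @sample_bound2 R p hp theta zeta alpha q eta beta
    th1 hzeta halpha alphap q1 eta0 b2 bp.
  have C01 : 0 < 2 * C0 + 1 by rewrite ltr_wpDl// mulr_ge0.
  have [C Cp red] := expected_sup_bound (ltW hp) be1 C01.
  exists C => m m2 Omega mu L B D WB WD d T P X cptO Llin LL [N [HN Ncvx BE]] entB
    [ND [HND NDcvx DE]] BD entD iid Xw YB YD mYB mYD.
  subst B D; have m0 := ltnW m2; have ln0 := lnm0 m m2.
  have [k1 k1E] : {k : R | k = ln m%:R `^ (beta * Num.max (1 - p / theta) 0)} by eexists.
  have [k2 k2E] : {k : R | k = ln m%:R `^ (beta * (1 - q^-1))} by eexists.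
  have k10 : 0 < k1 by rewrite k1E powR_gt0.
  have k20 : 0 < k2 by rewrite k2E powR_gt0.
  have B0 := unit_ball0 Llin HN.
  have al0p : 0 <= alpha <= p by rewrite (ltW halpha).
  have YB0 w : (0 <= YB w)%E by rewrite mule_ge0 ?lee_fin ?powR_ge0// sup_max_pow_ge0.
  have YD0 w : (0 <= YD w)%E by rewrite mule_ge0 ?lee_fin ?powR_ge0// sup_max_pow_ge0.
  have kYB0 w : (0 <= k1%:E * YB w)%E by rewrite mule_ge0// lee_fin ltW.
  have kYD0 w : (0 <= k2%:E * YD w)%E by rewrite mule_ge0// lee_fin ltW.
  have mkYB : measurable_fun setT (fun w => k1%:E * YB w)%E by exact: measurable_funeM.
  have mkYD : measurable_fun setT (fun w => k2%:E * YD w)%E by exact: measurable_funeM.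
  cbv zeta.
  apply: (red m (ltnW m2) Omega mu d T P X L N (fun w => k1%:E * YB w + k2%:E * YD w)%E k1^-1) => //.
  + by move=> f /LL[].
  + exact: emeasurable_funD.
  + by move=> w; rewrite adde_ge0.
  + by rewrite invr_ge0 ltW.
  (* The summand of [B] alone already majorizes |f(X_j)|^p. *)
  + move=> w f j Bf; apply: (@le_trans _ _ (k1^-1%:E * (k1%:E * YB w))%E).
      by rewrite muleA -EFinM mulVf ?gt_eqF// mul1e; exact: pow_le_sup_max_pow.
    by rewrite lee_wpmul2l ?leeDl// lee_fin invr_ge0 ltW.
  + move=> L0 w r M Q n F L0L L0r aE M0 Q0 B0' BM least BQ BF.
    have B0B : [set f | L0 f /\ N f <= 1] `<=` unit_ball L N by move=> f [/L0L].
    have MW : M <= WB (Xw w).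
      by apply: least => f j /B0B Bf; exact: (entropy_bound_sup Llin HN (Xw w) j entB Bf).
    have MWD : M <= WD (Xw w).
      by apply: least => f j /B0B/BD Df; exact: (entropy_bound_sup Llin HND (Xw w) j entD Df).
    have := fixed Omega m (Xw w) L L0 N ND (WB (Xw w)) (WD (Xw w)) M Q m2 HN Ncvx Llin HND NDcvx BD
      L0L L0r M0 MW MWD Q0 (entB (Xw w)) (entD (Xw w)) BM BQ n F BF.
    move=> /le_trans; apply; rewrite mulrDl.
    have h1 : ln m%:R `^ Num.max (1 - p / theta) 0 * (WB (Xw w) `^ alpha * M `^ (p - alpha)) `^ beta^-1
        <= r `^ beta^-1.
      apply: root_le => //; [exact: ltW|by rewrite mulr_ge0 ?powR_ge0|rewrite -k1E].
      apply: (@scaled_le _ _ _ _ _ (sup_max_pow (unit_ball L N) (p - alpha) (Xw w))); rewrite ?powR_ge0 ?(ltW k10)//.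
        by apply: (sup_max_pow_least m0 B0 B0B M0) => //; rewrite subr_ge0.
      by rewrite -aE leeDl.
    have h2 : ln m%:R `^ (1 - q^-1) * (WD (Xw w) `^ beta * M `^ (p - beta)) `^ beta^-1 <= r `^ beta^-1.
      apply: root_le => //; [exact: ltW|by rewrite mulr_ge0 ?powR_ge0|rewrite -k2E].
      apply: (@scaled_le _ _ _ _ _ (sup_max_pow (unit_ball L N) (p - beta) (Xw w))); rewrite ?powR_ge0 ?(ltW k20)//.
        by apply: (sup_max_pow_least m0 B0 B0B M0) => //; rewrite subr_ge0.
      by rewrite -aE leeDr.
    have Z0 := powR_ge0 Q (1 - beta^-1).
    have := ler_wpM2l C00 (lerD (ler_wpM2r Z0 h1) (ler_wpM2r Z0 h2)).
    move=> /le_trans; apply; have rQ0 : 0 <= r `^ beta^-1 * Q `^ (1 - beta^-1) by rewrite mulr_ge0 ?powR_ge0.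
    by move: rQ0; clear; move: (_ * Q `^ _) => t t0; lra.
  rewrite (ge0_integralD P measurableT (fun w _ => kYB0 w) mkYB (fun w _ => kYD0 w) mkYD).
  rewrite (ge0_integralZl_EFin P measurableT (fun w _ => YB0 w) mYB (ltW k10)).
  rewrite (ge0_integralZl_EFin P measurableT (fun w _ => YD0 w) mYD (ltW k20)).
  have IB : (0 <= k1%:E * \int[P]_w YB w)%E.
    by rewrite mule_ge0 ?lee_fin ?(ltW k10)// integral_ge0.
  have ID : (0 <= k2%:E * \int[P]_w YD w)%E.
    by rewrite mule_ge0 ?lee_fin ?(ltW k20)// integral_ge0.
  rewrite [RHS](ge0_muleDr _ IB ID) -k1E -k2E; congr (_ + _)%E.
    by rewrite [RHS]muleA -(EFinM m%:R^-1 k1) (mulrC _ k1).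
  by rewrite [RHS]muleA -(EFinM m%:R^-1 k2) (mulrC _ k2).
- rewrite ge_max => /andP[alphap p2].
  have e2 : 1 - 2^-1 = 2^-1 :> R by field.
  have [C0 C00 fixed] := @sample_bound3 R p hp theta zeta alpha th1 hzeta halpha alphap p2.
  have C01 : 0 < 2 * C0 + 1 by rewrite ltr_wpDl// mulr_ge0.
  have [C Cp red] := expected_sup_bound (ltW hp) (ltr1n R 2 : 1 < 2) C01.
  rewrite e2 in red; rewrite e2 in fixed.
  exists C => m m2 Omega mu L B D WB d T P X cptO Llin LL [N [HN Ncvx BE]] entB
    [ip [Hip DE]] BD iid Xw YB YD mYB mYD.
  subst B; have m0 := ltnW m2; have ln0 := lnm0 m m2.
  have [k kE] : {k : R | k = ln m%:R `^ (2 * Num.max (1 - p / theta) 0)} by eexists.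
  have k0 : 0 < k by rewrite kE powR_gt0.
  have B0 := unit_ball0 Llin HN; have D0 := BD _ B0.
  have al0p : 0 <= alpha <= p by rewrite (ltW halpha).
  have YB0 w : (0 <= YB w)%E by rewrite mule_ge0 ?lee_fin ?powR_ge0// sup_max_pow_ge0.
  have YD0 w : (0 <= YD w)%E by rewrite mule_ge0// sup_max_pow_ge0.
  have kYB0 w : (0 <= k%:E * YB w)%E by rewrite mule_ge0// lee_fin ltW.
  have mkYB : measurable_fun setT (fun w => k%:E * YB w)%E by exact: measurable_funeM.
  cbv zeta.
  apply: (red m (ltnW m2) Omega mu d T P X L N (fun w => YD w + k%:E * YB w)%E k^-1) => //.
  + by move=> f /LL[].
  + exact: emeasurable_funD.
  + by move=> w; rewrite adde_ge0.
  + by rewrite invr_ge0 ltW.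
  + move=> w f j Bf; apply: (@le_trans _ _ (k^-1%:E * (k%:E * YB w))%E).
      by rewrite muleA -EFinM mulVf ?gt_eqF// mul1e; exact: pow_le_sup_max_pow.
    by rewrite lee_wpmul2l ?leeDr// lee_fin invr_ge0 ltW.
  + move=> L0 w r M Q n F L0L L0r aE M0 Q0 B0' BM least BQ BF.
    have B0B : [set f | L0 f /\ N f <= 1] `<=` unit_ball L N by move=> f [/L0L].
    have MW : M <= WB (Xw w).
      by apply: least => f j /B0B Bf; exact: (entropy_bound_sup Llin HN (Xw w) j entB Bf).
    have Nip f : L f -> N f <= 1 -> ip f f <= 1.
      move=> Lf Nf; have := BD f (conj Lf Nf); rewrite DE => -[_ h].
      by rewrite -(sqr_sqrtr (ip_ge0 Hip Lf)) exprn_ile1 ?sqrtr_ge0.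
    have B0D : [set f | L0 f /\ N f <= 1] `<=` D by move=> f /B0B/BD.
    have YDr : (sup_max_pow D 2 (Xw w) * sup_max_pow (unit_ball L N) (p - 2) (Xw w) <= r%:E)%E.
      by rewrite -aE leeDl.
    have hB := sup_max_pow_least m0 B0 B0B M0 (_ : 0 <= p - 2) least.
    have {}hB : ((M `^ (p - 2))%:E <= sup_max_pow (unit_ball L N) (p - 2) (Xw w))%E.
      by apply: hB; rewrite subr_ge0.
    have hD : ((M `^ 2)%:E <= sup_max_pow D 2 (Xw w))%E.
      exact: (sup_max_pow_least m0 D0 B0D M0 (ler0n R 2) least).
    have Dle f j : D f -> ((`|f (Xw w j)| `^ 2)%:E <= sup_max_pow D 2 (Xw w))%E.
      exact: sup_max_pow_ge.
    (* The supremum over [D] is finite because its product with a positive quantity is at most r.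
       Its value bounds the square norm of every evaluation at a sample point. *)
    have [kap kapE] : exists kap, sup_max_pow D 2 (Xw w) = kap%:E.
      move: hD YDr; case: (sup_max_pow D 2 (Xw w)) => [kap| |]; [by exists kap| |by []].
      by rewrite gt0_mulye//; apply: lt_le_trans hB; rewrite lte_fin powR_gt0.
    rewrite kapE in YDr hD Dle.
    have kap0 : 0 < kap by move: hD; rewrite lee_fin; apply: lt_le_trans; rewrite powR_gt0.
    (* By homogeneity: h is rescaled to the Euclidean unit sphere, which lies in [D]. *)
    have Hkap h j : L h -> h (Xw w j) ^+ 2 <= kap * ip h h.
      move=> Lh; have [h0|hn0] := eqVneq (ip h h) 0.
        have [_ _ _ ip0] := Hip.
        by rewrite h0 mulr0 (ip0 h Lh h0) [X in X <= _](_ : _ = 0)//; exact: expr0n.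
      have ip0 : 0 < ip h h by rewrite lt_def hn0 (ip_ge0 Hip).
      pose t := Num.sqrt (ip h h); have t0 : 0 < t by rewrite sqrtr_gt0.
      have Dg : D (t^-1 *: h).
        rewrite DE; split; first exact: subspaceZ.
        by rewrite (ipZ Llin Hip)// exprVn sqr_sqrtr ?(ltW ip0)// mulVf// sqrtr1.
      have := Dle _ j Dg; rewrite lee_fin powR_mulrn// real_normK ?num_real//.
      rewrite (_ : (t^-1 *: h) (Xw w j) = t^-1 * h (Xw w j))// exprMn exprVn sqr_sqrtr ?(ltW ip0)//.
      by rewrite mulrC ler_pdivrMr.
    have := fixed Omega m (Xw w) L L0 N ip (WB (Xw w)) M Q kap m2 HN Ncvx Llin Hip Nip
      L0L L0r M0 MW Q0 kap0 (entB (Xw w)) Hkap BM BQ n F BF.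
    move=> /le_trans; apply; rewrite mulrDl.
    have h1 : (kap * M `^ (p - 2)) `^ 2^-1 <= r `^ 2^-1.
      apply: ler_powR2l; rewrite ?invr_ge0 ?mulr_ge0 ?powR_ge0 ?(ltW kap0)//.
      by rewrite -lee_fin EFinM; apply: le_trans YDr; rewrite lee_wpmul2l// lee_fin ltW.
    have h2 : ln m%:R `^ Num.max (1 - p / theta) 0 * (WB (Xw w) `^ alpha * M `^ (p - alpha)) `^ 2^-1
        <= r `^ 2^-1.
      apply: root_le => //; [exact: ltW|by rewrite mulr_ge0 ?powR_ge0|rewrite -kE].
      apply: (@scaled_le _ _ _ _ _ (sup_max_pow (unit_ball L N) (p - alpha) (Xw w))); rewrite ?powR_ge0 ?(ltW k0)//.
        by apply: (sup_max_pow_least m0 B0 B0B M0) => //; rewrite subr_ge0.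
      by rewrite -aE leeDr.
    have Z0 := powR_ge0 Q 2^-1.
    have := ler_wpM2l C00 (lerD (ler_wpM2r Z0 h1) (ler_wpM2r Z0 h2)).
    move=> /le_trans; apply; have rQ0 : 0 <= r `^ 2^-1 * Q `^ 2^-1 by rewrite mulr_ge0 ?powR_ge0.
    by move: rQ0; clear; move: (_ * Q `^ _) => t t0; lra.
  rewrite (ge0_integralD P measurableT (fun w _ => YD0 w) mYD (fun w _ => kYB0 w) mkYB).
  rewrite (ge0_integralZl_EFin P measurableT (fun w _ => YB0 w) mYB (ltW k0)).
  have IB : (0 <= k%:E * \int[P]_w YB w)%E.
    by rewrite mule_ge0 ?lee_fin ?(ltW k0)// integral_ge0.
  have ID : (0 <= \int[P]_w YD w)%E by exact: integral_ge0.
  rewrite [RHS](ge0_muleDr _ ID IB) -kE; congr (_ + _)%E.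
  by rewrite [RHS]muleA -(EFinM m%:R^-1 k) (mulrC _ k).
Qed.
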